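(* Let $E$ be the finite directed graph with two vertices $v,w$ and exactly six edges: two loops at $v$ (source and range $v$), three loops at $w$ (source and range $w$), and one edge with source $w$ and range $v$. Let $E^\infty$ be the infinite-path space of $E$, let $\sigma:E^\infty\to E^\infty$ be the backward shift (a surjective local homeomorphism of a compact Hausdorff space), let $X(E^\infty)$ be the Hilbert bimodule over $C(E^\infty)$ associated to $\sigma$, and let $\alpha$ be the dynamics on the Cuntz-Pimsner algebra $\mathcal{O}(X(E^\infty))$ obtained from the gauge action. Set $$\beta_c=\limsup_{n\to\infty}\Big(\tfrac1n\ln\big(\max_{x\in E^\infty}|\sigma^{-n}(x)|\big)\Big),\qquad \beta_l=\limsup_{n\to\infty}\Big(\tfrac1n\ln\big(\min_{x\in E^\infty}|\sigma^{-n}(x)|\big)\Big).$$ Then $\beta_c=\ln 3$ and $\beta_l=\ln 2$, and the system $(\mathcal{O}(X(E^\infty)),\alpha)$ has a KMS$_\beta$ state for $\beta=\beta_c=\ln 3$ and a KMS$_\beta$ state for $\beta=\beta_l=\ln 2$. (Thus both Thomsen's upper bound $\beta_c$ and his lower bound $\beta_l$ for the inverse temperatures of KMS states are attained for the local homeomorphism $\sigma$.)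
   Context: A finite directed graph $E=(E^0,E^1,r,s)$ has finite vertex set $E^0$, finite edge set $E^1$, and range and source maps $r,s:E^1\to E^0$. An infinite path is a sequence $x=x_1x_2x_3\cdots$ of edges with $s(x_i)=r(x_{i+1})$ for all $i\ge 1$; its range is $r(x)=r(x_1)$. $E^\infty$ is the set of infinite paths with the topology inherited from the product space $(E^1)^\infty$ ($E^1$ discrete). The backward shift is $\sigma(x_1x_2x_3\cdots)=x_2x_3\cdots$, and $\sigma^{-n}(x)$ is the preimage of $\{x\}$ under $\sigma^n$, with cardinality $|\sigma^{-n}(x)|$. For a compact Hausdorff space $Z$ and a surjective local homeomorphism $h:Z\to Z$, the associated Hilbert bimodule $X$ over $C(Z)$ is $C(Z)$ as a vector space, with $(a\cdot x\cdot b)(z)=a(z)x(z)b(h(z))$ and $\langle x,y\rangle(z)=\sum_{h(w)=z}\overline{x(w)}y(w)$ for $a,b\in C(Z)$, $x,y\in X$. A representation $(\psi,\pi)$ of $X$ in a $C^*$-algebra $B$ consists of a linear map $\psi:X\to B$ and a $*$-homomorphism $\pi:C(Z)\to B$ with $\psi(a\cdot x\cdot b)=\pi(a)\psi(x)\pi(b)$ and $\pi(\langle x,y\rangle)=\psi(x)^*\psi(y)$. The Toeplitz algebra $\mathcal{T}(X)$ is the $C^*$-algebra generated by a universal such representation. The Cuntz-Pimsner algebra $\mathcal{O}(X)$ is the quotient of $\mathcal{T}(X)$ that is universal for representations that are Cuntz-Pimsner covariant: $(\psi,\pi)^{(1)}(\varphi(a))=\pi(a)$ for all $a\in C(Z)$,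 where $\varphi(a)$ is the operator of left multiplication by $a$ on $X$ (which is compact here) and $(\psi,\pi)^{(1)}$ is the homomorphism on the compact operators $\mathcal{K}(X)$ sending the rank-one operator $\Theta_{x,y}:z\mapsto x\cdot\langle y,z\rangle$ to $\psi(x)\psi(y)^*$. The gauge action $\gamma$ of the circle on $\mathcal{T}(X)$ is given by $\gamma_z(\psi(x))=z\psi(x)$, $\gamma_z(\pi(a))=\pi(a)$; it descends to $\mathcal{O}(X)$, and the dynamics is $\alpha_t=\gamma_{e^{it}}$, $t\in\mathbb{R}$. For $Z=E^\infty$ and $h=\sigma$ the bimodule is written $X(E^\infty)$. For $\beta\in(0,\infty)$, a state $\phi$ of a $C^*$-algebra $A$ with dynamics $\alpha:\mathbb{R}\to\operatorname{Aut}A$ is a KMS$_\beta$ state (with inverse temperature $\beta$) if $\phi(ab)=\phi(b\,\alpha_{i\beta}(a))$ for all $a,b$ in a norm-dense $\alpha$-invariant $*$-subalgebra of $\alpha$-analytic elements. *)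

(* Defs.v *)
From HB Require Import structures.
From mathcomp Require Import all_boot all_order all_algebra finmap.
From mathcomp Require Import all_classical all_reals all_analysis.
From mathcomp Require Import complex.

Set Implicit Arguments.
Unset Strict Implicit.
Unset Printing Implicit Defensive.

Import Order.TTheory GRing.Theory Num.Theory.
Import numFieldNormedType.Exports.

Local Open Scope classical_set_scope.
Local Open Scope ring_scope.

(* R[i] repackaged so that it inherits the topology and the normed module
   structure that every numFieldType has. *)
Definition Cplx (R : realType) : numClosedFieldType := R[i].

Definition cplx_of (R : realType) (x : R) : Cplx R := (x%:C)%C.

Definition expi (R : realType) (t : R) : Cplx R := (cos t +i* sin t)%C.

(* No unit is required. *)
Record cstarAlg (R : realType) := CStarAlg {
  cs_car :> completeNormedModType (Cplx R);
  cs_mul : cs_car -> cs_car -> cs_car;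
  cs_star : cs_car -> cs_car;
  cs_mulA : associative cs_mul;
  cs_mulDl : left_distributive cs_mul +%R;
  cs_mulDr : right_distributive cs_mul +%R;
  cs_scaleAl : forall (c : Cplx R) a b, cs_mul (c *: a) b = c *: cs_mul a b;
  cs_scaleAr : forall (c : Cplx R) a b, cs_mul a (c *: b) = c *: cs_mul a b;
  cs_starK : involutive cs_star;
  cs_starD : {morph cs_star : a b / a + b};
  cs_starZ : forall (c : Cplx R) a, cs_star (c *: a) = c^* *: cs_star a;
  cs_starM : forall a b, cs_star (cs_mul a b) = cs_mul (cs_star b) (cs_star a);
  cs_normM : forall a b, `|cs_mul a b| <= `|a| * `|b|;
  cs_normE : forall a, `|cs_mul (cs_star a) a| = `|a| ^+ 2
}.

Arguments cs_mul {R _}.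
Arguments cs_star {R _}.

Declare Scope cstar_scope.
Delimit Scope cstar_scope with cs.
Notation "a ** b" := (cs_mul a b)
  (at level 40, left associativity) : cstar_scope.
Notation "a ^†" := (cs_star a) (at level 2, format "a ^†") : cstar_scope.
Local Open Scope cstar_scope.

Section CStar.
Variable R : realType.
Local Notation C := (Cplx R).

Record star_hom (A B : cstarAlg R) (f : A -> B) : Prop := StarHom {
  star_hom_linear : linear f;
  star_hom_mul : forall a b, f (a ** b) = f a ** f b;
  star_hom_star : forall a, f (a^†) = (f a)^†
}.

Record star_subalg (A : cstarAlg R) (D : set A) : Prop := StarSubalg {
  star_subalg0 : D 0;
  star_subalgZD : forall (c : C) a b, D a -> D b -> D (c *: a + b);
  star_subalgM : forall a b, D a -> D b -> D (a ** b);
  star_subalg_star : forall a, D a -> D (a^†)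
}.

Definition cs_generates (A : cstarAlg R) (S : set A) :=
  forall D : set A, star_subalg D -> closed D -> S `<=` D -> D = setT.

Record state (A : cstarAlg R) (phi : A -> C) : Prop := State {
  state_linear : linear (phi : A -> C^o);
  state_pos : forall a, 0 <= phi (a^† ** a);
  (* The norm of [phi] is 1.  As [sup] is 0 on unbounded sets, this includes
     the boundedness of [phi]. *)
  state_norm : sup [set complex.Re `|phi a| | a in [set a : A | `|a| <= 1]] = 1
}.

Definition entire (A : cstarAlg R) (F : C -> A) :=
  forall z : C, derivable F z 1.

(* [F] extends t |-> alpha_t(a) to an entire function, so that [a] is
   alpha-analytic and alpha_z(a) is [F z]. *)
Definition analytic_extension (A : cstarAlg R) (alpha : R -> A -> A) (a : A)
    (F : C -> A) :=
  entire F /\ forall t : R, F (cplx_of t) = alpha t a.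

Definition kms_state (A : cstarAlg R) (alpha : R -> A -> A) (beta : R)
    (phi : A -> C) :=
  state phi /\
  exists D : set A,
    [/\ star_subalg D, dense D,
        (forall t a, D a -> D (alpha t a)) &
        forall a, D a -> exists2 F : C -> A, analytic_extension alpha a F &
          forall b, D b -> phi (a ** b) = phi (b ** F (0 +i* beta)%C)].

End CStar.

Definition local_homeo (Z : topologicalType) (h : Z -> Z) :=
  forall w : Z, exists (U : set Z) (g : Z -> Z),
    [/\ open U /\ U w, open (h @` U), {in U, cancel h g},
        {within U, continuous h} & {within h @` U, continuous g}].

Record lhSystem := LhSystem {
  lh_space :> topologicalType;
  lh_map : lh_space -> lh_space;
  lh_compact : compact [set: lh_space];
  lh_hausdorff : hausdorff_space lh_space;
  lh_surj : forall z, exists w, lh_map w = z;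
  lh_local_homeo : local_homeo lh_map
}.

Arguments lh_map {_}.

Section FibreSum.
Variables (R : realType) (Z : lhSystem).
Local Notation C := (Cplx R).
Local Notation h := (@lh_map Z).

Lemma lh_continuous : continuous h.
Proof.
move=> w; have [U [g [[oU Uw] _ _ + _]]] := lh_local_homeo w.
rewrite (continuous_open_subspace _ oU) => /(_ w); apply.
by rewrite inE.
Qed.

Definition fibre_sum (f : Z -> C) (z : Z) : C :=
  \sum_(w \in h @^-1` [set z]) f w.

Lemma lh_fibre_closed z : closed (h @^-1` [set z]).
Proof.
apply: preimage_closed => [w _|]; first exact: lh_continuous.
exact/accessible_closed_set1/hausdorff_accessible/lh_hausdorff.
Qed.

Lemma lh_fibre_finite z : finite_set (h @^-1` [set z]).
Proof.
have [w0 _] := lh_surj z.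
pose Zp := HB.pack_for ptopologicalType (lh_space Z)
  (isPointed.Build (lh_space Z) w0).
have cF : @compact Zp (h @^-1` [set z]).
  apply: (@subclosed_compact Zp _ setT) => //; first exact: lh_fibre_closed.
  exact: lh_compact.
move: cF; rewrite compact_cover.
have /choice[U HU] : forall w : Z, exists U : set Z,
    [/\ open U, U w & set_inj U h].
  move=> w; have [U [g [[oU Uw] _ hK _ _]]] := lh_local_homeo w.
  by exists U; split => // x y xU yU e; rewrite -[x]hK// e hK.
move=> /(_ Z (h @^-1` [set z]) U) [].
- by move=> w _; have [] := HU w.
- by move=> w Fw; exists w => //; have [] := HU w.
move=> D DF Dcov; apply: (@sub_finite_set _ _ [set` D]) => // w Fw.
have [v vD Uw] := Dcov _ Fw.
have [_ Uv inj] := HU v.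
have /DF := vD; rewrite inE /= => hv.
by rewrite (inj w v) ?inE//= Fw hv.
Qed.

Lemma fibre_sum_continuous (f : Z -> C) :
  continuous f -> continuous (fibre_sum f).
Proof.
move=> cf z; set F := h @^-1` [set z].
have finF : finite_set F := lh_fibre_finite z.
have /choice[U /choice[g Hg]] := @lh_local_homeo Z.
have cg w : F w -> g w @ z --> w.
  move=> Fw; have [[oU Uw] ohU hK _ cg] := Hg w.
  have zhU : z \in h @` U w by rewrite inE; exists w.
  have gz : g w z = w by rewrite -Fw hK// inE.
  move: cg; rewrite continuous_open_subspace// => /(_ z zhU).
  by rewrite /continuous_at gz.
(* the complement of the sheets does not meet the fibres near z *)
pose K := ~` \bigcup_(w in F) U w.
have clK : closed K.
  by apply: open_closedC; apply: bigcup_open => w _; have [[]] := Hg w.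
have clhK : closed (h @` K).
  apply: compact_closed; first exact: lh_hausdorff.
  apply: continuous_compact.
    by apply: continuous_subspaceT; exact: lh_continuous.
  by apply: (subclosed_compact clK (@lh_compact Z)).
have nearK : \forall z' \near z, ~ (h @` K) z'.
  apply: open_nbhs_nbhs; split; first exact: closed_openC.
  by move=> [w + hw]; apply; exists w => //; have [[]] := Hg w.
have near_fin (P : Z -> Z -> Prop) :
    (forall w, F w -> \forall z' \near z, P w z') ->
    \forall z' \near z, forall w, F w -> P w z'.
  move=> HP; have := @filter_bigI _ _ (fset_set F) (fun w => [set z' | P w z'])
    (nbhs z) (nbhs_filter z).
  have HP' : forall w, w \in fset_set F -> nbhs z [set z' | P w z'].
    by move=> w; rewrite in_fset_set// inE => /HP.
  move=> /(_ HP'); apply: filterS => z' H w Fw.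
  by apply: H; rewrite /= in_fset_set// inE.
have near_h : \forall z' \near z, forall w, F w -> (h @` U w) z'.
  apply: near_fin => w Fw; have [[_ Uw] ohU _ _ _] := Hg w.
  by apply: open_nbhs_nbhs; split => //; exists w.
have near_inj : \forall z' \near z, forall w, F w -> forall v, F v ->
    g w z' = g v z' -> w = v.
  apply/near_fin => w Fw; apply/near_fin => v Fv.
  have [->|wv] := eqVneq w v; first exact: nearW.
  have := @lh_hausdorff Z; rewrite open_hausdorff => /(_ w v wv).
  move=> [[A B]] /= [/set_mem Aw /set_mem Bv] [oA oB /eqP AB].
  have nA : nbhs w A by apply: open_nbhs_nbhs.
  have nB : nbhs v B by apply: open_nbhs_nbhs.
  have nAz : \forall z' \near z, A (g w z') by exact: cg.
  have nBz : \forall z' \near z, B (g v z') by exact: cg.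
  apply: filterS (filterI nAz nBz) => z' [/= Az Bz] e.
  by have : (A `&` B) (g w z') by [split => //; rewrite e]; rewrite AB.
have nearE : \forall z' \near z,
    \sum_(w \in F) f (g w z') = fibre_sum f z'.
  near=> z'; rewrite /fibre_sum.
  have -> : h @^-1` [set z'] = [set g w z' | w in F].
    apply/seteqP; split => [x /= hx|_ /= [w Fw <-]].
      have : ~ K x by move=> Kx; have := near nearK z' => /(_ _); apply => //;
        exists x.
      move=> /contrapT [w Fw Ux]; exists w => //.
      by have [_ _ hK _ _] := Hg w; rewrite -hx hK// inE.
    have : (h @` U w) z' by apply: (near near_h z').
    by move=> [x Ux <-]; have [_ _ hK _ _] := Hg w; rewrite hK// inE.
  rewrite fsbig_image//= => w v /set_mem Fw /set_mem Fv.
  by apply: (near near_inj z').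
have cvg_sum (r : seq Z) : (forall w, w \in r -> F w) ->
    (fun z' => \sum_(w <- r) f (g w z')) @ z --> \sum_(w <- r) f w.
  elim: r => [_|w r IHr rF].
    rewrite big_nil (_ : (fun _ => _) = cst 0); first exact: cvg_cst.
    by apply/funext => z'; rewrite big_nil.
  rewrite big_cons (_ : (fun _ => _) =
    (fun z' => f (g w z') + \sum_(v <- r) f (g v z'))); last first.
    by apply/funext => z'; rewrite big_cons.
  apply: cvgD; last by apply: IHr => v vr; apply: rF; rewrite inE vr orbT.
  by apply: continuous_cvg; [exact: cf|apply/cg/rF; rewrite inE eqxx].
apply: (cvg_trans (near_eq_cvg nearE)).
have -> : fibre_sum f z = \sum_(w <- fset_set F) f w.
  by rewrite /fibre_sum fsbig_finite.
rewrite (_ : (fun _ => _) = (fun z' => \sum_(w <- fset_set F) f (g w z'))).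
  by apply: cvg_sum => w; rewrite in_fset_set// inE.
by apply/funext => z'; rewrite fsbig_finite.
Unshelve. all: by end_near. Qed.

End FibreSum.

Definition cfun (R : realType) (Z : topologicalType) :=
  continuousType Z (Cplx R).

Section CFun.
Variables (R : realType) (Z : topologicalType).
Local Notation C := (Cplx R).
Local Notation CZ := (cfun R Z).
Implicit Types f g : CZ.

HB.instance Definition _ := Choice.on CZ.

Let cfunP f : continuous f := @cts_fun _ _ f.

Let zero_cts : continuous (fun _ : Z => 0 : C).
Proof. exact: cst_continuous. Qed.

Let opp_cts f : continuous (fun z => - f z).
Proof. by move=> z; apply: cvgN; exact: cfunP. Qed.

Let add_cts f g : continuous (fun z => f z + g z).
Proof. by move=> z; apply: cvgD; exact: cfunP. Qed.

Let scale_cts (c : C) f : continuous (fun z => c * f z).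
Proof. by move=> z; apply: cvgM; [exact: cvg_cst|exact: cfunP]. Qed.

Let mul_cts f g : continuous (fun z => f z * g z).
Proof. by move=> z; apply: cvgM; exact: cfunP. Qed.

Let conj_cts f : continuous (fun z => (f z)^*).
Proof.
move=> z; apply/cvgrPdist_lt => e e0.
have := @cfunP f z; move/cvgrPdist_lt => /(_ e e0).
by apply: filterS => w; rewrite -rmorphB norm_conjC.
Qed.

Let cf0 : CZ := mkcts zero_cts.
Let cfopp f : CZ := mkcts (@opp_cts f).
Let cfadd f g : CZ := mkcts (@add_cts f g).
Let cfscale (c : C) f : CZ := mkcts (@scale_cts c f).
Definition cfmul f g : CZ := mkcts (@mul_cts f g).
Definition cfconj f : CZ := mkcts (@conj_cts f).

Let cfaddA : associative cfadd.
Proof. by move=> f g k; apply/continuousEP => z; exact: addrA. Qed.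
Let cfaddC : commutative cfadd.
Proof. by move=> f g; apply/continuousEP => z; exact: addrC. Qed.
Let cfadd0 : left_id cf0 cfadd.
Proof. by move=> f; apply/continuousEP => z; exact: add0r. Qed.
Let cfaddN : left_inverse cf0 cfopp cfadd.
Proof. by move=> f; apply/continuousEP => z; exact: addNr. Qed.

HB.instance Definition _ :=
  GRing.isZmodule.Build CZ cfaddA cfaddC cfadd0 cfaddN.

Let cfscaleA a b f : cfscale a (cfscale b f) = cfscale (a * b) f.
Proof. by apply/continuousEP => z; exact: mulrA. Qed.
Let cfscale1 : left_id 1 cfscale.
Proof. by move=> f; apply/continuousEP => z; exact: mul1r. Qed.
Let cfscaleDr : right_distributive cfscale +%R.
Proof. by move=> a f g; apply/continuousEP => z; exact: mulrDr. Qed.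
Let cfscaleDl f : {morph cfscale^~ f : a b / a + b}.
Proof. by move=> a b; apply/continuousEP => z; exact: mulrDl. Qed.

HB.instance Definition _ :=
  GRing.Zmodule_isLmodule.Build C CZ cfscaleA cfscale1 cfscaleDr cfscaleDl.

Definition cfnorm f : R := sup [set complex.Re `|f z| | z in [set: Z]].

End CFun.

Section Bimodule.
Variables (R : realType) (Z : lhSystem).
Local Notation C := (Cplx R).
Local Notation CZ := (cfun R Z).

Local Notation X := (cfun R Z).

Let ract_cts (x : X) (b : CZ) : continuous (fun z => x z * b (lh_map z)).
Proof.
move=> z; apply: cvgM; first exact: (@cts_fun _ _ x).
by apply: continuous_comp; [exact: lh_continuous|exact: (@cts_fun _ _ b)].
Qed.

Definition lact (a : CZ) (x : X) : X := cfmul a x.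
Definition ract (x : X) (b : CZ) : X := mkcts (@ract_cts x b).

Definition inner (x y : X) : CZ :=
  mkcts (fibre_sum_continuous (@cts_fun _ _ (cfmul (cfconj x) y))).

Definition bnorm (x : X) : R := Num.sqrt (cfnorm (inner x x)).

Definition adjoint_ops (S T : X -> X) :=
  forall x y, inner (S x) y = inner x (T y).

Definition rank_one (x y : X) : X -> X := fun z => ract x (inner y z).

(* Scalars are absorbed in the rank-one operators, so their finite sums are
   their linear span. *)
Definition compact_op (T : X -> X) :=
  (exists S, adjoint_ops T S) /\
  forall e : R, 0 < e -> exists s : seq (X * X), forall z : X,
    bnorm (T z - \sum_(p <- s) rank_one p.1 p.2 z) <= e * bnorm z.

Record representation (B : cstarAlg R) (psi : X -> B) (pi : CZ -> B) : Prop :=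
  Representation {
  rep_psi_linear : linear psi;
  rep_pi_linear : linear pi;
  rep_pi_mul : forall a b, pi (cfmul a b) = pi a ** pi b;
  rep_pi_conj : forall a, pi (cfconj a) = (pi a)^†;
  rep_act : forall a x b, psi (ract (lact a x) b) = pi a ** psi x ** pi b;
  rep_inner : forall x y, pi (inner x y) = (psi x)^† ** psi y
}.

(* [Psi] restricts to the *-homomorphism (psi, pi)^(1) on K(X); its values
   outside K(X) are irrelevant. *)
Record induced_hom (B : cstarAlg R) (psi : X -> B) (Psi : (X -> X) -> B)
    : Prop := InducedHom {
  ind_linear : forall (c : C) S T, compact_op S -> compact_op T ->
    Psi (fun x => c *: S x + T x) = c *: Psi S + Psi T;
  ind_mul : forall S T, compact_op S -> compact_op T ->
    Psi (S \o T) = Psi S ** Psi T;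
  ind_star : forall S T, compact_op S -> compact_op T -> adjoint_ops S T ->
    Psi T = (Psi S)^†;
  ind_rank_one : forall x y, Psi (rank_one x y) = psi x ** (psi y)^†
}.

(* The left action of [a] is [lact a].  For a general Hilbert bimodule the
   condition is imposed only on the [a] acting by compact operators; here that
   is every [a]. *)
Definition cp_covariant (B : cstarAlg R) (psi : X -> B) (pi : CZ -> B) :=
  exists2 Psi, induced_hom psi Psi &
    forall a, compact_op (lact a) -> Psi (lact a) = pi a.

(* The universal properties range over all C*-algebras [B], and determine the
   two algebras below up to isomorphism. *)
Record toeplitz_algebra (T : cstarAlg R) (iX : X -> T) (iA : CZ -> T)
    : Prop := ToeplitzAlgebra {
  toeplitz_rep : representation iX iA;
  toeplitz_gen : cs_generates (range iX `|` range iA);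
  toeplitz_univ : forall (B : cstarAlg R) (psi : X -> B) (pi : CZ -> B),
    representation psi pi ->
    exists2 rho : T -> B, star_hom rho & rho \o iX = psi /\ rho \o iA = pi
}.

Record cuntz_pimsner_algebra (T : cstarAlg R) (iX : X -> T) (iA : CZ -> T)
    (O : cstarAlg R) (q : T -> O) : Prop := CuntzPimsnerAlgebra {
  cp_quotient : star_hom q;
  cp_surj : range q = setT;
  cp_cov : cp_covariant (q \o iX) (q \o iA);
  cp_univ : forall (B : cstarAlg R) (psi : X -> B) (pi : CZ -> B),
    representation psi pi -> cp_covariant psi pi ->
    exists2 rho : O -> B, star_hom rho &
      rho \o (q \o iX) = psi /\ rho \o (q \o iA) = pi
}.

(* The values of [gamma] off the unit circle are irrelevant; on it, [gamma] is
   determined because [T] is generated by the ranges of [iX] and [iA]. *)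
Definition gauge_action (T : cstarAlg R) (iX : X -> T) (iA : CZ -> T)
    (gamma : C -> T -> T) :=
  forall z : C, `|z| = 1 ->
    [/\ star_hom (gamma z), forall x, gamma z (iX x) = z *: iX x &
        forall a, gamma z (iA a) = iA a].

Definition gauge_dynamics (T : cstarAlg R) (gamma : C -> T -> T)
    (O : cstarAlg R) (q : T -> O) (alpha : R -> O -> O) :=
  forall t a, alpha t (q a) = q (gamma (expi t) a).

End Bimodule.

Record digraph := Digraph {
  vertex : finType;
  edge : finType;
  rng : edge -> vertex;
  src : edge -> vertex
}.

Arguments rng {_}.
Arguments src {_}.

Section PathSpace.
Variable E : digraph.

Definition edge_seq := prod_topology (fun _ : nat => discrete_topology (edge E)).

Definition is_path : set edge_seq :=
  [set x | forall i, src (x i : edge E) = rng (x i.+1 : edge E)].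

Definition path_space : topologicalType := set_type is_path.

Let shift_subproof (x : path_space) :
  is_path (fun i => set_val x i.+1).
Proof. by move=> i; have := set_mem (valP x); exact. Qed.

Definition shift (x : path_space) : path_space := SigSub (mem_set (shift_subproof x)).

Lemma path_valP (x : path_space) i :
  src (set_val x i : edge E) = rng (set_val x i.+1 : edge E).
Proof. by have := set_mem (valP x); exact. Qed.

Lemma path_ext (x y : path_space) :
  (forall i, set_val x i = set_val y i) -> x = y.
Proof. by move=> e; apply/val_inj/funext. Qed.

Lemma set_val_continuous : continuous (set_val : path_space -> edge_seq).
Proof. exact: initial_continuous. Qed.

Lemma near_seq_coord (x : edge_seq) i : \forall y \near x, y i = x i.
Proof.
have := @proj_continuous nat (fun _ => discrete_topology (edge E)) i x.
by move=> /(_ [set x i]); apply; exact: discrete_set1.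
Qed.

Lemma near_coord (x : path_space) i :
  \forall y \near x, set_val y i = set_val x i.
Proof. exact: (set_val_continuous (near_seq_coord (set_val x) i)). Qed.

Lemma cvg_path (F : set_system path_space) (x : path_space) : Filter F ->
  (forall i, \forall y \near F, set_val y i = set_val x i) -> F --> x.
Proof.
move=> FF Fx.
have Fval : set_val @ F --> (set_val x : edge_seq).
  apply/cvg_sup => i A [B [[W oW WB] Bx] BA].
  apply: filterS (Fx i) => y yx; apply: BA; rewrite -WB /= /proj yx.
  by move: Bx; rewrite -WB.
move=> A [B [[W oW WB] Bx] BA].
have FW : \forall y \near F, W (set_val y).
  by apply: Fval; apply: open_nbhs_nbhs; split => //; move: Bx; rewrite -WB.
by apply: filterS FW => y Wy; apply: BA; rewrite -WB.
Qed.

Lemma path_continuous_at (T : topologicalType) (f : T -> path_space) (t : T) :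
  (forall i, \forall u \near t, set_val (f u) i = set_val (f t) i) ->
  {for t, continuous f}.
Proof. exact: (cvg_path (fmap_filter f (nbhs_filter t))). Qed.

Lemma path_hausdorff : hausdorff_space path_space.
Proof.
move=> x y xy; apply: path_ext => i.
have [z [zx zy]] := xy _ _ (near_coord x i) (near_coord y i).
by rewrite -zx -zy.
Qed.

Lemma is_path_closed : closed is_path.
Proof.
move=> x clx i.
have nx : nbhs x [set y | y i = x i /\ y i.+1 = x i.+1].
  exact: (@filterI _ _ (nbhs_filter x) _ _ (near_seq_coord x i) (near_seq_coord x i.+1)).
have [y [py [yi yi1]]] := clx _ nx.
by have := py i; rewrite yi yi1.
Qed.

Lemma path_compact : compact [set: path_space].
Proof.
have cseq : compact [set: edge_seq].
  have := @tychonoff nat (fun _ => discrete_topology (edge E)) (fun _ => setT).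
  rewrite (_ : mkset _ = setT); last by apply/seteqP; split.
  by apply=> _; apply: finite_compact; exact: finite_finset.
have cpath : compact is_path.
  by apply: subclosed_compact cseq _; [exact: is_path_closed|].
move=> F PF _.
have Fpath : (set_val @ F) is_path.
  by apply: (@filterS _ F _ setT) => [y _ /=|]; [exact/set_mem/valP|exact: filterT].
have [x [px clx]] := cpath _ (fmap_proper_filter _ PF) Fpath.
exists (SigSub (mem_set px)); split => // A B FA [B' [[W oW WB] B'x] B'B].
have Wx : nbhs x W.
  by apply: open_nbhs_nbhs; split => //; move: B'x; rewrite -WB.
have [_ [[y Ay <-] Wy]] : (set_val @` A) `&` W !=set0.
  by apply: clx => //; apply: (@filterS _ F _ A) => // y Ay; exists y.
by exists y; split => //; apply: B'B; rewrite -WB.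
Qed.

Let cons_subproof (e : edge E) (x : path_space) :
  src e = rng (set_val x 0 : edge E) ->
  is_path (fun i => if i is j.+1 then set_val x j else e).
Proof. by move=> ex [|i] //=; exact: path_valP. Qed.

(* Junk value [x] if the concatenation [e x] is not a path. *)
Definition path_cons (e : edge E) (x : path_space) : path_space :=
  if pselect (src e = rng (set_val x 0 : edge E)) is left p
  then SigSub (mem_set (cons_subproof p)) else x.

Lemma path_consE (e : edge E) (x : path_space) i :
  src e = rng (set_val x 0 : edge E) ->
  set_val (path_cons e x) i = if i is j.+1 then set_val x j else e.
Proof. by rewrite /path_cons; case: pselect. Qed.

Lemma shift_cons (e : edge E) (x : path_space) :
  src e = rng (set_val x 0 : edge E) -> shift (path_cons e x) = x.
Proof.
by move=> ex; apply: path_ext => i; rewrite -[LHS]/(set_val _ i.+1) path_consE.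
Qed.

Lemma cons_shift (x : path_space) : path_cons (set_val x 0) (shift x) = x.
Proof.
apply: path_ext => i; rewrite path_consE; last exact: path_valP x 0.
by case: i.
Qed.

Lemma shift_continuous : continuous shift.
Proof. by move=> x; apply: path_continuous_at => i; exact: near_coord x i.+1. Qed.

Lemma shift_local_homeo : local_homeo shift.
Proof.
move=> w; pose e : edge E := set_val w 0.
pose U : set path_space := [set x | set_val x 0 = e].
have hU : shift @` U = [set y | src e = rng (set_val y 0 : edge E)].
  apply/seteqP; split => [_ [x Ux <-]|y ey] /=.
    by rewrite -[e]Ux; exact: path_valP x 0.
  by exists (path_cons e y); [rewrite /U /= path_consE|exact: shift_cons].
have ohU : open (shift @` U).
  rewrite hU openE => y /= ey; apply: filterS (near_coord y 0) => z /= zy.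
  by rewrite zy.
exists U, (path_cons e); split => //.
- split => //; rewrite openE => x Ux; apply: filterS (near_coord x 0) => z /= zx.
  by rewrite /U /= zx.
- by move=> x /set_mem Ux; rewrite -{1}[e]Ux cons_shift.
- by apply: continuous_subspaceT; exact: shift_continuous.
- rewrite continuous_open_subspace// => y; rewrite hU => /set_mem /= ey.
  apply: path_continuous_at => i.
  suff : \forall z \near y, set_val z 0 = set_val y 0 /\
      set_val z i.-1 = set_val y i.-1.
    by apply: filterS => z [z0 zi]; rewrite !path_consE ?z0//; case: i zi.
  apply: (@filterI _ _ (nbhs_filter y)); exact: near_coord.
Qed.

Lemma shift_surj : (forall v, exists e : edge E, src e = v) ->
  forall x, exists y, shift y = x.
Proof.
move=> Esrc x; have [e ex] := Esrc (rng (set_val x 0 : edge E)).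
by exists (path_cons e x); exact: shift_cons.
Qed.

Definition path_system (Esrc : forall v, exists e : edge E, src e = v) :=
  LhSystem path_compact path_hausdorff (shift_surj Esrc) shift_local_homeo.

End PathSpace.

Section Growth.
Variables (R : realType) (Z : choiceType) (h : Z -> Z).

Definition preim_card (n : nat) (z : Z) : nat :=
  #|` fset_set (iter n h @^-1` [set z])|.

(* 0 if there is no maximum (resp. minimum). *)
Definition nat_max (A : set nat) : nat := xget 0%N (A `&` ubound A).
Definition nat_min (A : set nat) : nat := xget 0%N (A `&` lbound A).

Definition beta_c : \bar R :=
  limn_esup (fun n => (n%:R^-1 * ln (nat_max (range (preim_card n)))%:R)%:E).

Definition beta_l : \bar R :=
  limn_esup (fun n => (n%:R^-1 * ln (nat_min (range (preim_card n)))%:R)%:E).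

End Growth.

Inductive ex_vertex := vtx_v | vtx_w.

Definition bool_of_ex_vertex x := if x is vtx_v then true else false.
Definition ex_vertex_of_bool (b : bool) := if b then vtx_v else vtx_w.
Lemma bool_of_ex_vertexK : cancel bool_of_ex_vertex ex_vertex_of_bool.
Proof. by case. Qed.
HB.instance Definition _ := Finite.copy ex_vertex (can_type bool_of_ex_vertexK).

(* Loops at v, loops at w, and the edge from w to v. *)
Definition ex_edge : finType := ('I_2 + 'I_3 + unit)%type.

Definition ex_rng (e : ex_edge) : ex_vertex :=
  match e with inl (inl _) => vtx_v | inl (inr _) => vtx_w | inr _ => vtx_v end.

Definition ex_src (e : ex_edge) : ex_vertex :=
  match e with inl (inl _) => vtx_v | inl (inr _) => vtx_w | inr _ => vtx_w end.

Definition ex_graph : digraph := Digraph ex_rng ex_src.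

Lemma ex_graph_src (v : vertex ex_graph) :
  exists e : edge ex_graph, src e = v.
Proof.
by case: v; [exists (inl (inl ord0))|exists (inr tt)].
Qed.

Definition ex_system : lhSystem := path_system ex_graph_src.

(* Main.v *)
From HB Require Import structures.
Require Import Defs.
From mathcomp Require Import all_boot all_order all_algebra finmap.
From mathcomp Require Import all_classical all_reals all_analysis.
From mathcomp Require Import complex zify ring lra.

(* For a fixed base point z0, the transfer operator (L F)(z) = sum of F over
   sigma^-1(z) has total masses (L^k 1)(z0) comparable to N^k: N = 3 when z0
   runs through the loops at w, N = 2 when it runs through the loops at v.
   Hence every limit tau, along an ultrafilter, of the averages of
   N^-k (L^k F)(z0) over k < n is a positive functional on the bounded
   functions of the path space with tau (L F) = N tau F.

   O(X) acts on l^2 of the path space by (pi(a) f)(z) = a(z) f(z) and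
   (psi(x) f)(z) = x(z) f(sigma z).  Write D_b(z) = <delta_z, b delta_z>.  Since
   D_(b psi(x)) = L (D_(psi(x) b)), the functional phi(b) = tau(D_b) satisfies
   phi(b psi(x)) = N phi(psi(x) b) for all b, which is the KMS condition at
   ln N on the generators.  Positivity and the norm of phi on O(X) use that
   homomorphisms of C*-algebras are contractive; for h self-adjoint of norm
   < 1 this follows from h = (u + u^* ) / 2 with u = h + i sqrt(1 - h^2) unitary.

   |sigma^-n(z)| is 2^n or 2 * 3^n - 2^n according to the range of z. *)

Set Implicit Arguments.
Unset Strict Implicit.
Unset Printing Implicit Defensive.

Import Order.TTheory GRing.Theory Num.Theory.
Import numFieldNormedType.Exports.

Local Open Scope classical_set_scope.
Local Open Scope ring_scope.
Local Open Scope cstar_scope.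

(** [T] and [O] are given only by universal properties, so a state on [O] has to be pulled back
    along a homomorphism into a C*-algebra built by hand. That is why the bounded operators on l^2
    are constructed, with adjoints and completeness. Covariance of the l^2 representation comes from
    the indicators of the edges: they form a finite frame of the bimodule, which turns the
    homomorphism on compact operators into a finite formula. The functional tau lives on all bounded
    functions because the diagonal of an arbitrary bounded operator need not be continuous. The KMS
    relation spreads from the generators by degrees: call an element homogeneous of degree n if
    alpha_t multiplies it by e^(int) and phi(ba) = N^n phi(ab) for every b. Products add degrees,
    adjoints negate them, and e^(inz) takes the value N^-n at z = i ln N, which is exactly the
    factor that the KMS condition asks for. Density of the sums of such elements is inherited from
    the generation of [T] through [q], and the continuity of [q] is a second use of contractivity.
    Only the two loops at v have source v, so the base point at v sees the lower growth rate
    alone. *)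

(** * Real and imaginary parts, and the squared modulus *)

Section ComplexFacts.
Variable R : realType.
Local Notation C := (Cplx R).
Implicit Types (z w : C) (x y : R).

Definition reC z : R := complex.Re z.
Definition imC z : R := complex.Im z.
(** The squared modulus is taken in [R], where estimates are polynomial inequalities; the norm of
    [Cplx R] takes its values in [Cplx R] itself. *)
Definition sqnorm z : R := reC z ^+ 2 + imC z ^+ 2.

Lemma complexP z w : reC z = reC w -> imC z = imC w -> z = w.
Proof. by case: z; case: w => a b c d /= -> ->. Qed.

Lemma reCD z w : reC (z + w) = reC z + reC w.
Proof. by case: z; case: w. Qed.
Lemma imCD z w : imC (z + w) = imC z + imC w.
Proof. by case: z; case: w. Qed.
Lemma reCN z : reC (- z) = - reC z. Proof. by case: z. Qed.
Lemma imCN z : imC (- z) = - imC z. Proof. by case: z. Qed.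
Lemma reCB z w : reC (z - w) = reC z - reC w.
Proof. by rewrite reCD reCN. Qed.
Lemma imCB z w : imC (z - w) = imC z - imC w.
Proof. by rewrite imCD imCN. Qed.
Lemma reCM z w : reC (z * w) = reC z * reC w - imC z * imC w.
Proof. by case: z; case: w. Qed.
Lemma imCM z w : imC (z * w) = reC z * imC w + imC z * reC w.
Proof. by case: z => a b; case: w => c d /=; rewrite /imC /=; ring. Qed.
Lemma reCJ z : reC z^* = reC z. Proof. by case: z. Qed.
Lemma imCJ z : imC z^* = - imC z. Proof. by case: z. Qed.
Lemma reC0 : reC 0 = 0. Proof. by []. Qed.
Lemma imC0 : imC 0 = 0. Proof. by []. Qed.
Lemma reC_of x : reC (cplx_of x) = x. Proof. by []. Qed.
Lemma imC_of x : imC (cplx_of x) = 0. Proof. by []. Qed.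

Lemma reC_sum I (r : seq I) (P : pred I) (F : I -> C) :
  reC (\sum_(i <- r | P i) F i) = \sum_(i <- r | P i) reC (F i).
Proof. by apply: (big_morph reC reCD). Qed.
Lemma imC_sum I (r : seq I) (P : pred I) (F : I -> C) :
  imC (\sum_(i <- r | P i) F i) = \sum_(i <- r | P i) imC (F i).
Proof. by apply: (big_morph imC imCD). Qed.

Lemma cplx_ofD x y : cplx_of (x + y) = cplx_of x + cplx_of y.
Proof. by apply: complexP; rewrite ?reCD ?imCD ?reC_of ?imC_of ?addr0. Qed.
Lemma cplx_ofM x y : cplx_of (x * y) = cplx_of x * cplx_of y.
Proof.
by apply: complexP; rewrite ?reCM ?imCM ?reC_of ?imC_of !(mul0r, mulr0, addr0, subr0).
Qed.
Lemma cplx_of0 : cplx_of 0 = 0 :> C. Proof. by []. Qed.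
Lemma cplx_ofX x n : cplx_of (x ^+ n) = cplx_of x ^+ n.
Proof. by elim: n => // n IH; rewrite !exprS cplx_ofM IH. Qed.
Lemma cplx_of_le x y : (cplx_of x <= cplx_of y) = (x <= y).
Proof. exact: lecR. Qed.
Lemma cplx_of_lt x y : (cplx_of x < cplx_of y) = (x < y).
Proof. exact: ltcR. Qed.
Lemma cplx_ofJ x : (cplx_of x)^* = cplx_of x.
Proof. by apply: complexP; rewrite ?reCJ ?imCJ ?imC_of ?oppr0. Qed.
Lemma cplx_ofV x : cplx_of x^-1 = (cplx_of x)^-1.
Proof.
have [->|x0] := eqVneq x 0; first by rewrite invr0 cplx_of0 invr0.
have cx0 : cplx_of x != 0 by apply: contra x0 => /eqP[->].
by apply: (mulfI cx0); rewrite -cplx_ofM !mulfV.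
Qed.

Lemma cplx_of_reC z : 0 <= z -> cplx_of (reC z) = z.
Proof.
move=> z0; apply: complexP; first by [].
by rewrite imC_of; move: z0; rewrite lecE => /andP[/eqP].
Qed.

Lemma normC_reC z : cplx_of (reC `|z|) = `|z|.
Proof. by rewrite cplx_of_reC. Qed.

Lemma sqnorm_ge0 z : 0 <= sqnorm z.
Proof. by rewrite addr_ge0 ?sqr_ge0. Qed.

Lemma sqnormE z : cplx_of (sqnorm z) = `|z| ^+ 2.
Proof. exact: add_Re2_Im2. Qed.

Lemma sqnorm_mulJ z : z^* * z = cplx_of (sqnorm z).
Proof.
by apply: complexP; rewrite ?reCM ?imCM ?reCJ ?imCJ ?reC_of ?imC_of /sqnorm; ring.
Qed.

Lemma sqnormM z w : sqnorm (z * w) = sqnorm z * sqnorm w.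
Proof. by rewrite /sqnorm reCM imCM; ring. Qed.

Lemma sqnorm_eq0 z : sqnorm z = 0 -> z = 0.
Proof.
move=> /eqP; rewrite paddr_eq0 ?sqr_ge0// !sqrf_eq0 => /andP[/eqP z0 /eqP z1].
exact: complexP.
Qed.

Lemma sqnormJ z : sqnorm z^* = sqnorm z.
Proof. by rewrite /sqnorm reCJ imCJ sqrrN. Qed.

Lemma sqnorm_norm z : reC `|z| = Num.sqrt (sqnorm z).
Proof. by rewrite normc_def. Qed.

Lemma reC_norm_le z : `|reC z| <= reC `|z|.
Proof.
by rewrite sqnorm_norm -sqrtr_sqr ler_sqrt ?sqnorm_ge0// lerDl sqr_ge0.
Qed.

Lemma imC_norm_le z : `|imC z| <= reC `|z|.
Proof.
by rewrite sqnorm_norm -sqrtr_sqr ler_sqrt ?sqnorm_ge0// lerDr sqr_ge0.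
Qed.

Lemma norm_le_of z x : (`|z| <= cplx_of x) = (reC `|z| <= x).
Proof. by rewrite -{1}normC_reC cplx_of_le. Qed.

Lemma norm_lt_of z x : (`|z| < cplx_of x) = (reC `|z| < x).
Proof. by rewrite -{1}normC_reC cplx_of_lt. Qed.

End ComplexFacts.

(** * Limits along an ultrafilter *)

Section UltraLimit.
Variables (R : realType) (I : Type) (U : set_system I).
Hypothesis UU : UltraFilter U.
Local Notation C := (Cplx R).

(** [lim] has a default value on families that do not converge; boundedness ([ubddR]) ensures
    convergence, by compactness of segments. *)
Definition ulimR (u : I -> R) : R := lim (u @ U).

Definition ubddR (u : I -> R) := exists M : R, U [set i | `|u i| <= M].

Lemma ultra_map (T : Type) (u : I -> T) : UltraFilter (u @ U).
Proof.
split; first exact: fmap_proper_filter.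
move=> G GG sG; apply/seteqP; split => // A GA.
have [//|UnA] := in_ultra_setVsetC (u @^-1` A) UU.
have GnA : G (~` A) by apply: sG.
by have := @filter_ex _ _ GG _ (filterI GA GnA) => -[x []].
Qed.

Lemma ulimR_cvg u : ubddR u -> u @ U --> ulimR u.
Proof.
move=> [M UM]; suff [p pM] : exists p : R, u @ U --> p.
  by rewrite /ulimR; apply: cvgP pM.
have := @segment_compact R (- M) M; rewrite compact_ultra.
move=> /(_ _ (ultra_map u)) []; last by move=> p [_]; exists p.
have FU : Filter U by typeclasses eauto.
by apply: (@filterS _ U FU _ _ _ UM) => i /= uiM; rewrite in_itv /= -ler_norml.
Qed.

Lemma ulimR_eq u p : u @ U --> p -> ulimR u = p.
Proof. by move=> up; apply: cvg_lim up. Qed.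

Lemma ubddRD u v : ubddR u -> ubddR v -> ubddR (fun i => u i + v i).
Proof.
move=> [M UM] [N UN]; exists (M + N); apply: filterS (filterI UM UN) => i /= [a b].
by rewrite (le_trans (ler_normD _ _))// lerD.
Qed.

Lemma ubddRZ c u : ubddR u -> ubddR (fun i => c * u i).
Proof.
move=> [M UM]; exists (`|c| * M); apply: filterS UM => i /= a.
by rewrite normrM ler_wpM2l.
Qed.

Lemma ulimRD u v : ubddR u -> ubddR v ->
  ulimR (fun i => u i + v i) = ulimR u + ulimR v.
Proof.
by move=> bu bv; apply: ulimR_eq; exact: (cvgD (ulimR_cvg bu) (ulimR_cvg bv)).
Qed.

Lemma ulimRZ c u : ubddR u -> ulimR (fun i => c * u i) = c * ulimR u.
Proof.
by move=> bu; apply: ulimR_eq; exact: (cvgM (cvg_cst c) (ulimR_cvg bu)).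
Qed.

Lemma ulimR_cst c : ulimR (fun=> c) = c.
Proof. by apply: ulimR_eq; exact: cvg_cst. Qed.

Lemma ulimR_near_eq u v : U [set i | u i = v i] -> ulimR u = ulimR v.
Proof.
have aux u' v' : U [set i | u' i = v' i] -> u' @ U `<=` v' @ U.
  move=> uv A uA; change (U (v' @^-1` A)).
  have uA' : U (u' @^-1` A) by exact: uA.
  by apply: filterS (filterI uv uA') => i [/= e]; rewrite e.
move=> uv; rewrite /ulimR; congr (lim _); apply/seteqP; split; apply: aux => //.
by apply: filterS uv => i /= ->.
Qed.

Lemma ulimR_ge u c : ubddR u -> U [set i | c <= u i] -> c <= ulimR u.
Proof. by move=> bu cu; apply: limr_ge => //; apply: cvgP (ulimR_cvg bu). Qed.

Lemma ulimR_le u c : ubddR u -> U [set i | u i <= c] -> ulimR u <= c.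
Proof. by move=> bu cu; apply: limr_le => //; apply: cvgP (ulimR_cvg bu). Qed.

Definition ulim (u : I -> C) : C :=
  (ulimR (@reC R \o u) +i* ulimR (@imC R \o u))%C.

Definition ubdd (u : I -> C) := ubddR (@reC R \o u) /\ ubddR (@imC R \o u).

Lemma ulim_near_eq u v : U [set i | u i = v i] -> ulim u = ulim v.
Proof.
by move=> uv; congr Complex; apply: ulimR_near_eq; apply: filterS uv => i /= ->.
Qed.

Lemma ubdd_norm u M : U [set i | reC `|u i| <= M] -> ubdd u.
Proof.
move=> uM; split; exists M; apply: filterS uM => i /=; apply: le_trans.
  exact: reC_norm_le.
exact: imC_norm_le.
Qed.

Lemma ubdd_cst c : ubdd (fun=> c).
Proof. by apply: (@ubdd_norm _ (reC `|c|)); apply: nearW => i /=. Qed.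

Lemma ubddD u v : ubdd u -> ubdd v -> ubdd (fun i => u i + v i).
Proof.
move=> [a b] [c d]; split; rewrite /comp.
  by under eq_fun do rewrite reCD; exact: ubddRD.
by under eq_fun do rewrite imCD; exact: ubddRD.
Qed.

Lemma ubddZ c u : ubdd u -> ubdd (fun i => c * u i).
Proof.
move=> [a b]; split; rewrite /comp.
  under eq_fun do rewrite reCM -mulNr; exact/ubddRD/ubddRZ/b/ubddRZ.
by under eq_fun do rewrite imCM; exact/ubddRD/ubddRZ/a/ubddRZ.
Qed.

Lemma ulimD u v : ubdd u -> ubdd v ->
  ulim (fun i => u i + v i) = ulim u + ulim v.
Proof.
move=> [a b] [c d]; apply: complexP; rewrite ?reCD ?imCD /reC /imC /= /comp.
  by under eq_fun do rewrite reCD; exact: ulimRD.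
by under eq_fun do rewrite imCD; exact: ulimRD.
Qed.

Lemma ulimZ c u : ubdd u -> ulim (fun i => c * u i) = c * ulim u.
Proof.
move=> [a b]; apply: complexP; rewrite ?reCM ?imCM /reC /imC /= /comp.
  under eq_fun do rewrite reCM -mulNr.
  rewrite ulimRD; [|exact: ubddRZ..].
  by rewrite (ulimRZ _ a) (ulimRZ _ b) mulNr.
under eq_fun do rewrite imCM.
rewrite ulimRD; [|exact: ubddRZ..].
by rewrite (ulimRZ _ a) (ulimRZ _ b).
Qed.

Lemma ulimJ u : ubdd u -> ulim (fun i => (u i)^*) = (ulim u)^*.
Proof.
move=> [a b]; apply: complexP; rewrite ?reCJ ?imCJ /reC /imC /= /comp.
  by under eq_fun do rewrite reCJ.
under eq_fun do rewrite imCJ -mulN1r.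
by rewrite (ulimRZ _ b) mulN1r.
Qed.

Lemma ulim_cst c : ulim (fun=> c) = c.
Proof. by apply: complexP; rewrite /reC /imC /= ulimR_cst. Qed.

Lemma reC_ulim u : reC (ulim u) = ulimR (@reC R \o u).
Proof. by []. Qed.
Lemma imC_ulim u : imC (ulim u) = ulimR (@imC R \o u).
Proof. by []. Qed.

Lemma ulim_ge0 u : ubdd u -> U [set i | 0 <= u i] -> 0 <= ulim u.
Proof.
move=> [a b] u0; rewrite lecE; apply/andP; split; last first.
  apply: ulimR_ge => //; apply: filterS u0 => i /=.
  by rewrite lecE => /andP[].
apply/eqP; rewrite -[RHS](ulimR_cst 0); apply: ulimR_near_eq.
by apply: filterS u0 => i /=; rewrite lecE => /andP[/eqP].
Qed.

Lemma ulim_cvg_sqnorm u : ubdd u -> sqnorm (u i) @[i --> U] --> sqnorm (ulim u).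
Proof.
move=> [a b]; rewrite /sqnorm /reC /imC /=.
apply: cvgD; rewrite expr2; under eq_fun do rewrite expr2.
  exact: (cvgM (ulimR_cvg a) (ulimR_cvg a)).
exact: (cvgM (ulimR_cvg b) (ulimR_cvg b)).
Qed.

(* Fatou's lemma for finite sums. *)
Lemma ulim_sum_sqnorm_le (J : Type) (r : seq J) (u : J -> I -> C) (K : R) :
  (forall j, ubdd (u j)) ->
  U [set i | \sum_(j <- r) sqnorm (u j i) <= K] ->
  \sum_(j <- r) sqnorm (ulim (u j)) <= K.
Proof.
move=> bu uK.
have c : \sum_(j <- r) sqnorm (u j i) @[i --> U] -->
    \sum_(j <- r) sqnorm (ulim (u j)).
  elim: r {uK} => [|j r IH].
    rewrite big_nil; under eq_fun do rewrite big_nil.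
    exact: cvg_cst.
  rewrite big_cons; under eq_fun do rewrite big_cons.
  exact: (cvgD (ulim_cvg_sqnorm (bu j)) IH).
rewrite -(cvg_lim _ c)//; apply: limr_le => //; apply: cvgP c.
Qed.

End UltraLimit.

(** * Square-summable functions *)

Section FiniteSubsets.
Variable S : choiceType.

Definition fin_filter : set_system {fset S} :=
  filter_from setT (fun A => [set B | (A `<=` B)%fset]).

Lemma fin_filter_proper : ProperFilter fin_filter.
Proof.
apply: filter_from_proper; last by move=> A _; exists A; exact: fsubset_refl.
apply: filter_from_filter; first by exists fset0.
move=> A B _ _; exists (A `|` B)%fset => // D /=.
by rewrite fsubUset => /andP[].
Qed.

(** Passing from the filter of large finite sets to an ultrafilter makes every bounded family of
    partial sums converge, so infinite sums are linear without a theory of summable families. *)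
Definition fin_ultra : set_system {fset S} :=
  sval (cid (ultraFilterLemma fin_filter_proper)).

Global Instance fin_ultraP : UltraFilter fin_ultra.
Proof. by rewrite /fin_ultra; case: cid => ? []. Qed.

Lemma fin_ultra_sub A : fin_ultra [set B | (A `<=` B)%fset].
Proof.
by rewrite /fin_ultra; case: cid => G [_] /= sub; apply: sub; exists A.
Qed.

End FiniteSubsets.

Section SquareSummable.
Variables (R : realType) (S : choiceType).
Local Notation C := (Cplx R).

(** The index set will be the uncountable path space, hence a uniform bound over finite subsets
    instead of a series. *)
Definition sq_summable (f : S -> C) :=
  exists M : R, forall A : {fset S}, \sum_(s <- A) sqnorm (f s) <= M.

Definition l2_pred : {pred S -> C} := fun f => `[< sq_summable f >].

Lemma sqnormD_le (z w : C) : sqnorm (z + w) <= 2 * sqnorm z + 2 * sqnorm w.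
Proof.
rewrite /sqnorm reCD imCD.
set a := reC z; set b := imC z; set c := reC w; set d := imC w.
have := sqr_ge0 (a - c); have := sqr_ge0 (b - d); nra.
Qed.

Lemma l2_pred_closed : submod_closed l2_pred.
Proof.
split=> [|c f g /asboolP [M fM] /asboolP [N gN]]; apply/asboolP.
  by exists 0 => A; rewrite big1// => s _; rewrite /sqnorm /= expr0n addr0.
exists (2 * (sqnorm c * M) + 2 * N) => A.
apply: (@le_trans _ _ (\sum_(s <- A)
    (2 * (sqnorm c * sqnorm (f s)) + 2 * sqnorm (g s)))).
  by apply: ler_sum => s _; rewrite -sqnormM; exact: sqnormD_le.
rewrite big_split /= -!mulr_sumr lerD// ler_wpM2l//.
by rewrite ler_wpM2l// sqnorm_ge0.
Qed.

HB.instance Definition _ :=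
  GRing.isSubmodClosed.Build C (S -> C) l2_pred l2_pred_closed.

Record l2 := L2 { l2_fun :> S -> C; _ : l2_fun \in l2_pred }.

HB.instance Definition _ := [isSub for l2_fun].
HB.instance Definition _ := [Choice of l2 by <:].
HB.instance Definition _ := [SubChoice_isSubLmodule of l2 by <:].

Implicit Types (f g k : l2) (A B : {fset S}).

Lemma l2P f g : f =1 g -> f = g.
Proof. by move=> fg; apply: val_inj; apply/funext. Qed.

Lemma l2_summable f : sq_summable f.
Proof. by have /asboolP := valP f. Qed.

Definition mk_l2 (f : S -> C) (fP : sq_summable f) : l2 := L2 (asboolT fP).

Lemma l2DE f g s : (f + g) s = f s + g s. Proof. by []. Qed.
Lemma l2ZE (c : C) f s : (c *: f) s = c * f s. Proof. by []. Qed.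
Lemma l2BE f g s : (f - g) s = f s - g s. Proof. by []. Qed.
Lemma l2_sumE I (r : seq I) (P : pred I) (F : I -> l2) s :
  (\sum_(i <- r | P i) F i) s = \sum_(i <- r | P i) F i s.
Proof. by apply: (big_morph (fun f : l2 => f s)). Qed.

Local Notation U := (@fin_ultra S).
Local Notation psum F := (fun A : {fset S} => \sum_(s <- A) F s).

(** The value does not depend on the choice of the ultrafilter where it matters: on the diagonal it
    is the supremum of the partial sums ([sqhn_ub], [sqhn_le]). *)
Definition ip f g : C := ulim U (psum (fun s => (f s)^* * g s)).

Lemma reC_mulJ_le (z w : C) : `|reC (z^* * w)| <= sqnorm z + sqnorm w.
Proof.
rewrite reCM reCJ imCJ /sqnorm mulNr opprK ler_norml.
set a := reC z; set b := imC z; set c := reC w; set d := imC w.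
have h1 := sqr_ge0 (a - c); have h2 := sqr_ge0 (b - d).
have h3 := sqr_ge0 (a + c); have h4 := sqr_ge0 (b + d).
have h5 := sqr_ge0 a; have h6 := sqr_ge0 b.
have h7 := sqr_ge0 c; have h8 := sqr_ge0 d.
by apply/andP; split; nra.
Qed.

Lemma imC_mulJ_le (z w : C) : `|imC (z^* * w)| <= sqnorm z + sqnorm w.
Proof.
rewrite imCM reCJ imCJ /sqnorm mulNr ler_norml.
set a := reC z; set b := imC z; set c := reC w; set d := imC w.
have h1 := sqr_ge0 (a - d); have h2 := sqr_ge0 (b - c).
have h3 := sqr_ge0 (a + d); have h4 := sqr_ge0 (b + c).
have h5 := sqr_ge0 a; have h6 := sqr_ge0 b.
have h7 := sqr_ge0 c; have h8 := sqr_ge0 d.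
by apply/andP; split; nra.
Qed.

Lemma ip_ubdd f g : ubdd U (psum (fun s => (f s)^* * g s)).
Proof.
have [M fM] := l2_summable f; have [N gN] := l2_summable g.
have FU : Filter U by typeclasses eauto.
split; exists (M + N); apply: nearW => A /=.
  rewrite reC_sum; apply: le_trans (ler_norm_sum _ _ _) _.
  apply: le_trans (lerD (fM A) (gN A)); rewrite -big_split /=.
  by apply: ler_sum => s _; exact: reC_mulJ_le.
rewrite imC_sum; apply: le_trans (ler_norm_sum _ _ _) _.
apply: le_trans (lerD (fM A) (gN A)); rewrite -big_split /=.
by apply: ler_sum => s _; exact: imC_mulJ_le.
Qed.

Lemma ipDr f g k : ip f (g + k) = ip f g + ip f k.
Proof.
rewrite /ip -ulimD; [|exact: ip_ubdd..]; congr (ulim _ _); apply/funext => A.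
by rewrite -big_split; apply: eq_bigr => s _; exact: mulrDr.
Qed.

Lemma ipZr (c : C) f g : ip f (c *: g) = c * ip f g.
Proof.
rewrite /ip -ulimZ; last exact: ip_ubdd; congr (ulim _ _); apply/funext => A.
by rewrite mulr_sumr; apply: eq_bigr => s _; rewrite l2ZE mulrCA.
Qed.

Lemma ipJ f g : (ip f g)^* = ip g f.
Proof.
rewrite /ip -ulimJ; last exact: ip_ubdd; congr (ulim _ _); apply/funext => A.
by rewrite rmorph_sum /=; apply: eq_bigr => s _; rewrite rmorphM /= conjCK mulrC.
Qed.

Lemma ipDl f g k : ip (f + g) k = ip f k + ip g k.
Proof. by rewrite -ipJ ipDr rmorphD /= !ipJ. Qed.

Lemma ipZl (c : C) f g : ip (c *: f) g = c^* * ip f g.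
Proof. by rewrite -ipJ ipZr rmorphM /= !ipJ. Qed.

Lemma ip0r f : ip f 0 = 0.
Proof. by rewrite -(scale0r 0) ipZr mul0r. Qed.
Lemma ip0l f : ip 0 f = 0.
Proof. by rewrite -ipJ ip0r rmorph0. Qed.
Lemma ipBr f g k : ip f (g - k) = ip f g - ip f k.
Proof. by rewrite ipDr -scaleN1r ipZr mulN1r. Qed.
Lemma ipBl f g k : ip (f - g) k = ip f k - ip g k.
Proof. by rewrite -ipJ ipBr rmorphB /= !ipJ. Qed.
Lemma ip_suml I (r : seq I) (P : pred I) (F : I -> l2) k :
  ip (\sum_(i <- r | P i) F i) k = \sum_(i <- r | P i) ip (F i) k.
Proof. by apply: (big_morph (fun f => ip f k)) => [f g|]; rewrite ?ipDl ?ip0l. Qed.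

Definition sqhn f : R := reC (ip f f).
Definition hn f : R := Num.sqrt (sqhn f).

Lemma fsum_mono (F : S -> R) A B : (forall s, 0 <= F s) ->
  (A `<=` B)%fset -> \sum_(s <- A) F s <= \sum_(s <- B) F s.
Proof.
move=> F0 AB; rewrite [leRHS](big_fsetID _ (mem A)) /=.
rewrite (_ : [fset x in B | x \in mem A]%fset = A); first by rewrite lerDl sumr_ge0.
apply/fsetP => x; rewrite !inE /=.
by have [xA|] := boolP (x \in A); rewrite ?andbF// (fsubsetP AB).
Qed.

Lemma reC_psum f A :
  reC (\sum_(s <- A) (f s)^* * f s) = \sum_(s <- A) sqnorm (f s).
Proof.
by rewrite reC_sum; apply: eq_bigr => s _; rewrite sqnorm_mulJ.
Qed.

Lemma sqhn_ub f A : \sum_(s <- A) sqnorm (f s) <= sqhn f.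
Proof.
rewrite /sqhn /ip reC_ulim; apply: ulimR_ge; first by case: (ip_ubdd f f).
apply: filterS (fin_ultra_sub A) => B /= AB; rewrite reC_psum.
by apply: fsum_mono => // s; exact: sqnorm_ge0.
Qed.

Lemma sqhn_le f M : (forall A, \sum_(s <- A) sqnorm (f s) <= M) -> sqhn f <= M.
Proof.
move=> fM; rewrite /sqhn /ip reC_ulim; apply: ulimR_le.
  by case: (ip_ubdd f f).
by apply: nearW => A /=; rewrite reC_psum.
Qed.

Lemma sqhn_ge0 f : 0 <= sqhn f.
Proof. by have := sqhn_ub f fset0; rewrite big_seq_fset0. Qed.

Lemma hn_ge0 f : 0 <= hn f. Proof. exact: sqrtr_ge0. Qed.

Lemma hn_sqr f : hn f ^+ 2 = sqhn f.
Proof. by rewrite sqr_sqrtr// sqhn_ge0. Qed.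

Lemma ip_sqhn f : ip f f = cplx_of (sqhn f).
Proof.
apply: complexP => //; rewrite imC_of.
have := congr1 (@imC R) (ipJ f f); rewrite imCJ => /eqP.
by rewrite eq_sym -subr_eq0 opprK -mulr2n mulrn_eq0 /= => /eqP.
Qed.

Lemma sqnorm_le_sqhn f s : sqnorm (f s) <= sqhn f.
Proof. by have := sqhn_ub f [fset s]%fset; rewrite big_seq_fset1. Qed.

Lemma sqhn_eq0 f : sqhn f = 0 -> f = 0.
Proof.
move=> f0; apply: l2P => s; apply: sqnorm_eq0; apply/eqP.
by rewrite eq_le sqnorm_ge0 -f0 sqnorm_le_sqhn.
Qed.

Lemma ip_sqnorm_sym f g : sqnorm (ip g f) = sqnorm (ip f g).
Proof. by rewrite -ipJ sqnormJ. Qed.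

Lemma cauchy_schwarz f g : sqnorm (ip f g) <= sqhn f * sqhn g.
Proof.
have [g0|g0] := eqVneq (sqhn g) 0.
  by rewrite (sqhn_eq0 g0) ip0r /sqnorm reC0 imC0 expr0n addr0 mulr_ge0// sqhn_ge0.
(* [k] is the component of [f] orthogonal to [g], multiplied by [sqhn g] to avoid a division; its
   squared norm is [sqhn g] times the defect of the inequality. *)
set t := ip g f; set k := cplx_of (sqhn g) *: f - t *: g.
have kE : sqhn k = sqhn g * (sqhn f * sqhn g - sqnorm t).
  rewrite /sqhn /k !(ipBl, ipBr, ipZl, ipZr) !ip_sqhn -(ipJ g f) -/t.
  by rewrite !(reCB, reCM, imCB, imCM, reCJ, imCJ, reC_of, imC_of) /sqnorm; ring.
have : 0 <= sqhn k by exact: sqhn_ge0.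
by rewrite kE pmulr_rge0 ?lt_def ?g0 ?sqhn_ge0// subr_ge0 -ip_sqnorm_sym.
Qed.

Lemma ip_le f g : reC `|ip f g| <= hn f * hn g.
Proof.
rewrite sqnorm_norm /hn -sqrtrM ?sqhn_ge0// ler_sqrt ?mulr_ge0 ?sqhn_ge0//.
exact: cauchy_schwarz.
Qed.

Lemma hnD f g : hn (f + g) <= hn f + hn g.
Proof.
rewrite -(@ler_pXn2r _ 2)// ?nnegrE ?addr_ge0 ?hn_ge0// sqrrD !hn_sqr.
rewrite /sqhn ipDl !ipDr !reCD -/(sqhn f) -/(sqhn g) -(ipJ f g) reCJ.
have : reC (ip f g) <= hn f * hn g.
  by apply: le_trans (ip_le f g); rewrite (le_trans _ (reC_norm_le _))// ler_norm.
by lra.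
Qed.

Lemma hnZ (c : C) f : hn (c *: f) = reC `|c| * hn f.
Proof.
rewrite sqnorm_norm /hn -sqrtrM ?sqnorm_ge0//; congr Num.sqrt.
rewrite /sqhn ipZl ipZr mulrA ip_sqhn sqnorm_mulJ -cplx_ofM.
by rewrite reC_of.
Qed.

Lemma hn0 : hn 0 = 0.
Proof. by rewrite /hn /sqhn ip0r reC0 sqrtr0. Qed.

Lemma hn_eq0 f : hn f = 0 -> f = 0.
Proof. by move=> f0; apply: sqhn_eq0; rewrite -hn_sqr f0 expr0n. Qed.

Lemma hn_le f M : 0 <= M ->
  (forall A, \sum_(s <- A) sqnorm (f s) <= M ^+ 2) -> hn f <= M.
Proof.
move=> M0 fM; rewrite -(@ler_pXn2r _ 2)// ?nnegrE ?hn_ge0// hn_sqr.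
exact: sqhn_le.
Qed.

Lemma ip_eq f g : (forall k, ip k f = ip k g) -> f = g.
Proof.
move=> fg; apply/eqP; rewrite -subr_eq0; apply/eqP/sqhn_eq0.
by rewrite /sqhn ipBr fg subrr.
Qed.

Lemma finite_support_l2 A (f : S -> C) :
  (forall s, s \notin A -> f s = 0) -> sq_summable f.
Proof.
move=> f0; exists (\sum_(s <- A) sqnorm (f s)) => B.
rewrite (big_fsetID _ (mem A)) /= [X in _ + X]big1_seq ?addr0; last first.
  move=> s; rewrite !inE /= => /andP[_ sA].
  by rewrite f0// /sqnorm reC0 imC0 expr0n addr0.
apply: fsum_mono => [s|]; first exact: sqnorm_ge0.
by apply/fsubsetP => s; rewrite !inE => /andP[].
Qed.

Lemma ip_finite A f g :
  (forall s, s \notin A -> f s = 0) -> ip f g = \sum_(s <- A) (f s)^* * g s.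
Proof.
move=> f0; rewrite /ip -[RHS](ulim_cst (U := U)); apply: ulim_near_eq.
apply: filterS (fin_ultra_sub A) => B /= AB.
rewrite (big_fsetID _ (mem A)) /= [X in _ + X]big1_seq ?addr0; last first.
  move=> s; rewrite !inE /= => /andP[_ sA].
  by rewrite f0// conjC0 mul0r.
congr (\sum_(s <- enum_fset _) _); apply/fsetP => x; rewrite !inE /=.
by have [xA|] := boolP (x \in A); rewrite ?andbF// (fsubsetP AB).
Qed.

Lemma delta_summable (s : S) : sq_summable (fun t => (t == s)%:R : C).
Proof.
apply: (@finite_support_l2 [fset s]%fset) => t; rewrite inE => /negbTE.
by rewrite /mem /= => ->.
Qed.

Definition delta s : l2 := mk_l2 (delta_summable s).

Lemma deltaE s t : delta s t = (t == s)%:R. Proof. by []. Qed.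

Lemma ip_delta s f : ip (delta s) f = f s.
Proof.
rewrite (@ip_finite [fset s]%fset); first
  by rewrite big_seq_fset1 deltaE eqxx conjC1 mul1r.
by move=> t; rewrite inE deltaE => /negbTE ->.
Qed.

Lemma sqhn_delta s : sqhn (delta s) = 1.
Proof. by rewrite /sqhn ip_delta deltaE eqxx. Qed.

Lemma hn_delta s : hn (delta s) = 1.
Proof. by rewrite /hn sqhn_delta sqrtr1. Qed.

Lemma delta_combE A (c : S -> C) s :
  (\sum_(t <- A) c t *: delta t) s = if s \in A then c s else 0.
Proof.
rewrite l2_sumE; under eq_bigr do rewrite l2ZE deltaE.
case: ifPn => sA; last first.
  rewrite big1_seq// => t /andP[_ tA]; case: eqVneq => [e|_]; last by rewrite mulr0.
  by rewrite -e in tA; rewrite tA in sA.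
rewrite (big_fsetD1 s)//= eqxx mulr1 big1_seq ?addr0// => t.
by rewrite !inE => /andP[_ /andP[/negbTE ts _]]; rewrite eq_sym ts mulr0.
Qed.

Definition trunc A f : l2 := \sum_(s <- A) f s *: delta s.

Lemma truncE A f s : trunc A f s = if s \in A then f s else 0.
Proof. exact: delta_combE. Qed.

(** [sqhn f] is a supremum of partial sums, so some finite [A] carries all of it but [e]; the
    partial sums of the remainder are disjoint from [A] and share what is left. *)
Lemma trunc_approx f (e : R) : 0 < e -> exists A, sqhn (f - trunc A f) <= e.
Proof.
move=> e0; have [A fA] : exists A, sqhn f - e < \sum_(s <- A) sqnorm (f s).
  apply: contrapT => /forallNP H.
  have : sqhn f <= sqhn f - e.
    by apply: sqhn_le => A; rewrite leNgt; apply/negP/H.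
  by rewrite leNgt ltrBlDr ltrDl e0.
have dE s : (f - trunc A f) s = if s \in A then 0 else f s.
  by rewrite l2BE truncE; case: ifP => _; rewrite ?subrr ?subr0.
exists A; move: (f - trunc A f) dE => d dE; apply: sqhn_le => B.
have : \sum_(s <- (A `|` B)%fset) sqnorm (f s) <= sqhn f by exact: sqhn_ub.
rewrite (big_fsetID _ (mem A)) /= (_ : [fset x in _ | x \in mem A]%fset = A); last first.
  by apply/fsetP => x; rewrite !inE /=; case: (x \in A); rewrite ?andbF.
suff -> : \sum_(s <- B) sqnorm (d s) =
    \sum_(s <- [fset x in (A `|` B) | x \notin mem A]%fset) sqnorm (f s) by move: fA; lra.
rewrite (big_fsetID _ (mem A)) /= big1_seq ?add0r; last first.
  move=> s; rewrite !inE /= => /andP[_ sA].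
  by rewrite dE sA /sqnorm reC0 imC0 expr0n addr0.
rewrite (_ : [fset x in A `|` B | x \notin mem A]%fset =
             [fset x in B | x \notin mem A]%fset); last first.
  by apply/fsetP => x; rewrite !inE /=; case: (x \in A); rewrite ?andbF//= andbT.
rewrite big_seq [RHS]big_seq; apply: eq_bigr => s; rewrite !inE /= => /andP[_ sA].
by rewrite dE (negbTE sA).
Qed.

Definition is_bop (T : l2 -> l2) :=
  linear T /\ exists M : R, forall f, hn (T f) <= M * hn f.

(** * Adjoints of bounded operators *)

Section Adjoint.
Variable T : l2 -> l2.
Hypothesis bT : is_bop T.

Lemma bop_sum I (r : seq I) (P : pred I) (F : I -> l2) :
  T (\sum_(i <- r | P i) F i) = \sum_(i <- r | P i) T (F i).
Proof.
have [lT _] := bT.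
have T0 : T 0 = 0 by have := lT (-1) 0 0; rewrite scaler0 addr0 scaleN1r addNr.
by apply: (big_morph T) => // f g; have := lT 1 f g; rewrite !scale1r.
Qed.

Lemma bopZ (c : C) f : T (c *: f) = c *: T f.
Proof.
have [lT _] := bT.
have T0 : T 0 = 0 by have := lT (-1) 0 0; rewrite scaler0 addr0 scaleN1r addNr.
by rewrite -[c *: f]addr0 lT T0 addr0.
Qed.

Lemma bopD f g : T (f + g) = T f + T g.
Proof. by have [lT _] := bT; have := lT 1 f g; rewrite !scale1r. Qed.

Lemma bopB f g : T (f - g) = T f - T g.
Proof. by rewrite -scaleN1r bopD bopZ scaleN1r. Qed.

(** The adjoint is built from its coordinates. If [z] is the truncation of the candidate to [A] and
    [q] its squared norm, then [ip (T z) g] is again [q], and Cauchy-Schwarz gives q^2 <= M^2 q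
    [sqhn g]; dividing by q bounds q independently of [A]. *)
Lemma adj_summable g : sq_summable (fun s => ip (T (delta s)) g).
Proof.
have [_ [M TM]] := bT.
have M0 : 0 <= Num.max M 0 by rewrite le_max lexx orbT.
exists ((Num.max M 0) ^+ 2 * sqhn g) => A.
pose c s := ip (T (delta s)) g.
pose z : l2 := \sum_(s <- A) c s *: delta s.
have zE s : z s = if s \in A then c s else 0 by exact: delta_combE.
set q := \sum_(s <- A) sqnorm (c s).
have qz : sqhn z = q.
  rewrite /sqhn (@ip_finite A) ?reC_psum; last by move=> s /negbTE sA; rewrite zE sA.
  by apply: eq_big_seq => s sA; rewrite zE sA.
have qT : ip (T z) g = cplx_of q.
  rewrite bop_sum ip_suml /q (big_morph (@cplx_of R) (@cplx_ofD R) (cplx_of0 R)).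
  by apply: eq_bigr => s _; rewrite bopZ ipZl sqnorm_mulJ.
have q0 : 0 <= q by rewrite -qz sqhn_ge0.
have H : q ^+ 2 <= ((Num.max M 0) ^+ 2 * q) * sqhn g.
  have := cauchy_schwarz (T z) g; rewrite qT /sqnorm reC_of imC_of expr0n addr0.
  move=> /le_trans; apply; rewrite ler_wpM2r ?sqhn_ge0// -hn_sqr -qz -hn_sqr -exprMn.
  rewrite ler_pXn2r ?nnegrE ?hn_ge0 ?mulr_ge0 ?hn_ge0//.
  by apply: le_trans (TM z) _; rewrite ler_wpM2r ?hn_ge0// le_max lexx.
have [->|qn0] := eqVneq q 0; first by rewrite mulr_ge0 ?sqr_ge0 ?sqhn_ge0.
have qp : 0 < q by rewrite lt_def qn0.
by rewrite -(ler_pM2l qp) -expr2 (le_trans H)// mulrCA mulrA.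
Qed.

Definition adj_fun g : l2 := mk_l2 (adj_summable g).

(** On a truncation of [f] the identity is linearity. The error [d] is then the same for [f] and for
    the remainder, which has norm at most [e]; boundedness makes [d] at most [e * K] for every
    [e]. *)
Lemma adj_funP f g : ip (T f) g = ip f (adj_fun g).
Proof.
have [_ [M TM]] := bT.
have trE A : ip (T (trunc A f)) g = ip (trunc A f) (adj_fun g).
  rewrite /trunc bop_sum !ip_suml; apply: eq_bigr => s _.
  by rewrite bopZ !ipZl ip_delta.
set d := ip (T f) g - ip f (adj_fun g).
suff d0 : reC `|d| = 0.
  by apply/eqP; rewrite -subr_eq0 -/d -normr_eq0 -normC_reC d0.
pose K := Num.max M 0 * hn g + hn (adj_fun g).
have K0 : 0 <= K by rewrite addr_ge0 ?mulr_ge0 ?hn_ge0// le_max lexx orbT.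
have dK e : 0 < e -> reC `|d| <= e * K.
  move=> e0; have [|A fA] := @trunc_approx f (e ^+ 2); first by rewrite exprn_gt0.
  have hA : hn (f - trunc A f) <= e.
    by rewrite -(@ler_pXn2r _ 2) ?nnegrE ?hn_ge0 ?(ltW e0)// hn_sqr.
  have -> : d = ip (T (f - trunc A f)) g - ip (f - trunc A f) (adj_fun g).
    rewrite bopB !ipBl trE /d; ring.
  have h1 : reC `|ip (T (f - trunc A f)) g| <= e * (Num.max M 0 * hn g).
    apply: le_trans (ip_le _ _) _; rewrite mulrA ler_wpM2r ?hn_ge0//.
    apply: le_trans (TM _) _.
    apply: (@le_trans _ _ (Num.max M 0 * hn (f - trunc A f))).
      by rewrite ler_wpM2r ?hn_ge0// le_max lexx.
    by rewrite mulrC ler_wpM2r// le_max lexx orbT.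
  have h2 : reC `|ip (f - trunc A f) (adj_fun g)| <= e * hn (adj_fun g).
    by apply: le_trans (ip_le _ _) _; rewrite ler_wpM2r ?hn_ge0.
  rewrite -norm_le_of; apply: le_trans (ler_normB _ _) _.
  rewrite mulrDr cplx_ofD lerD// norm_le_of//.
apply/eqP; rewrite eq_le; apply/andP; split; last first.
  by rewrite sqnorm_norm sqrtr_ge0.
apply/ler_addgt0Pr => e e0; rewrite add0r.
have eK : 0 < e / (K + 1) by rewrite divr_gt0// ltr_wpDl.
apply: le_trans (dK _ eK) _.
rewrite mulrAC ler_pdivrMr ?ltr_wpDl// ler_wpM2l ?(ltW e0)//.
by rewrite lerDl.
Qed.

Lemma adj_fun_le M : 0 <= M -> (forall f, hn (T f) <= M * hn f) ->
  forall g, hn (adj_fun g) <= M * hn g.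
Proof.
move=> M0 TM g; have [->|h0] := eqVneq (hn (adj_fun g)) 0.
  by rewrite mulr_ge0 ?hn_ge0.
have hp : 0 < hn (adj_fun g) by rewrite lt_def h0 hn_ge0.
rewrite -(ler_pM2r hp) -expr2 hn_sqr.
have -> : sqhn (adj_fun g) = reC (ip (T (adj_fun g)) g) by rewrite adj_funP.
apply: (@le_trans _ _ (hn (T (adj_fun g)) * hn g)).
  by apply: le_trans (ip_le _ _); rewrite (le_trans _ (reC_norm_le _))// ler_norm.
by rewrite mulrAC ler_wpM2r ?hn_ge0.
Qed.

Lemma adj_fun_bop : is_bop adj_fun.
Proof.
split.
  move=> c f g; apply: ip_eq => k.
  by rewrite -adj_funP !ipDr !ipZr !adj_funP.
have [_ [M TM]] := bT; exists (Num.max M 0); apply: adj_fun_le => [|f].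
  by rewrite le_max lexx orbT.
by rewrite (le_trans (TM f))// ler_wpM2r ?hn_ge0// le_max lexx.
Qed.

End Adjoint.

End SquareSummable.

(** * Bounded operators on l^2 *)

Section BoundedOperators.
Variables (R : realType) (S : choiceType).
Local Notation C := (Cplx R).
Local Notation H := (l2 R S).

Definition bop_pred : {pred H -> H} := fun T => `[< is_bop T >].

Lemma bop_pred_closed : submod_closed bop_pred.
Proof.
split=> [|c T T' /asboolP [lT [M TM]] /asboolP [lT' [N TN]]]; apply/asboolP.
  split=> [a f g|]; first by rewrite scaler0 addr0.
  by exists 0 => f; rewrite hn0 mul0r.
split=> [a f g|].
  rewrite -[LHS]/(c *: T (a *: f + g) + T' (a *: f + g)).
  rewrite -[RHS]/(a *: (c *: T f + T' f) + (c *: T g + T' g)).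
  rewrite lT lT' !scalerDr !scalerA [c * a]mulrC -!addrA; congr (_ + _).
  by rewrite addrCA.
exists (reC `|c| * M + N) => f; apply: le_trans (hnD _ _) _.
rewrite mulrDl lerD// hnZ -mulrA ler_wpM2l//.
by rewrite sqnorm_norm sqrtr_ge0.
Qed.

HB.instance Definition _ :=
  GRing.isSubmodClosed.Build C (H -> H) bop_pred bop_pred_closed.

Record bop := Bop { bop_fun :> H -> H; _ : bop_fun \in bop_pred }.

HB.instance Definition _ := [isSub for bop_fun].
HB.instance Definition _ := [Choice of bop by <:].
HB.instance Definition _ := [SubChoice_isSubLmodule of bop by <:].

Implicit Types (T : bop) (f g : H).

Lemma bopP T T' : (forall f, T f = T' f) -> T = T'.
Proof. by move=> TT'; apply: val_inj; apply/funext. Qed.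

Lemma bop_is_bop T : is_bop T.
Proof. by have /asboolP := valP T. Qed.

Definition mk_bop (T : H -> H) (TP : is_bop T) : bop := Bop (asboolT TP).

Lemma bopDE T T' f : (T + T') f = T f + T' f. Proof. by []. Qed.
Lemma bopBE T T' f : (T - T') f = T f - T' f. Proof. by []. Qed.
Lemma bopZE (c : C) T f : (c *: T) f = c *: T f. Proof. by []. Qed.

Definition opn T : R := sup [set hn (T f) | f in [set f | hn f <= 1]].

Lemma opn_has_sup T : has_sup [set hn (T f) | f in [set f | hn f <= 1]].
Proof.
split; first by exists (hn (T 0)), 0; rewrite //= hn0.
have [_ [M TM]] := bop_is_bop T; exists (Num.max M 0) => _ [f /= f1 <-].
apply: le_trans (TM f) _; apply: (@le_trans _ _ (Num.max M 0 * hn f)).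
  by rewrite ler_wpM2r ?hn_ge0// le_max lexx.
by rewrite ler_piMr// le_max lexx orbT.
Qed.

Lemma opn_ge0 T : 0 <= opn T.
Proof.
apply: le_trans (hn_ge0 (T 0)) _; apply: sup_upper_bound (opn_has_sup T) _ _.
by exists 0; rewrite //= hn0.
Qed.

Lemma opn_ub T f : hn (T f) <= opn T * hn f.
Proof.
have bT := bop_is_bop T.
have [f0|f0] := eqVneq (hn f) 0.
  by rewrite (hn_eq0 f0) -(scale0r 0) (bopZ bT) !scale0r hn0 mulr0.
have fp : 0 < hn f by rewrite lt_def f0 hn_ge0.
have aux : reC `|cplx_of (hn f)^-1| = (hn f)^-1.
  by rewrite ger0_norm ?reC_of// -(cplx_of0 R) cplx_of_le invr_ge0 hn_ge0.
rewrite -ler_pdivrMr// mulrC -aux -hnZ -(bopZ bT).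
apply: sup_upper_bound (opn_has_sup T) _ _.
by exists (cplx_of (hn f)^-1 *: f) => //=; rewrite hnZ aux mulVf.
Qed.

Lemma opn_le T M : 0 <= M -> (forall f, hn (T f) <= M * hn f) -> opn T <= M.
Proof.
move=> M0 TM; apply: ge_sup; first by case: (opn_has_sup T).
move=> _ [f /= f1 <-]; apply: le_trans (TM f) _.
by rewrite ler_piMr.
Qed.

Definition bop_norm T : C := cplx_of (opn T).

Lemma opnD T T' : opn (T + T') <= opn T + opn T'.
Proof.
apply: opn_le => [|f]; first by rewrite addr_ge0 ?opn_ge0.
by rewrite bopDE (le_trans (hnD _ _))// mulrDl lerD// opn_ub.
Qed.

Lemma bop_normD T T' : bop_norm (T + T') <= bop_norm T + bop_norm T'.
Proof. by rewrite /bop_norm -cplx_ofD cplx_of_le opnD. Qed.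

Lemma bop_normZ (c : C) T : bop_norm (c *: T) = `|c| * bop_norm T.
Proof.
have le1 (a : C) T' : opn (a *: T') <= reC `|a| * opn T'.
  apply: opn_le => [|f]; first by rewrite mulr_ge0 ?opn_ge0// sqnorm_norm sqrtr_ge0.
  rewrite bopZE hnZ -mulrA ler_wpM2l ?opn_ub//.
  by rewrite sqnorm_norm sqrtr_ge0.
rewrite /bop_norm -(normC_reC c) -cplx_ofM; congr cplx_of.
have [->|c0] := eqVneq c 0.
  rewrite normr0 reC0 mul0r scale0r; apply/eqP; rewrite eq_le opn_ge0 andbT.
  by apply: opn_le => // f; rewrite mul0r hn0.
have cp : 0 < reC `|c| by rewrite -cplx_of_lt normC_reC normr_gt0.
apply/eqP; rewrite eq_le le1 /=.
rewrite -ler_pdivlMl//.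
have := le1 c^-1 (c *: T); rewrite scalerA mulVf// scale1r.
suff -> : reC `|c^-1| = (reC `|c|)^-1 by [].
by rewrite normfV -normC_reC -cplx_ofV !reC_of.
Qed.

Lemma bop_norm_eq0 T : bop_norm T = 0 -> T = 0.
Proof.
move=> [T0]; apply: bopP => f; apply: hn_eq0; apply/eqP.
by rewrite eq_le hn_ge0 andbT (le_trans (opn_ub T f))// T0 mul0r.
Qed.

HB.instance Definition _ :=
  Lmodule_isNormed.Build C bop bop_normD bop_normZ bop_norm_eq0.

Lemma bop_normE T : `|T| = cplx_of (opn T). Proof. by []. Qed.

Lemma sqnorm_le_opn T f s : sqnorm (T f s) <= (opn T * hn f) ^+ 2.
Proof.
apply: le_trans (sqnorm_le_sqhn _ _) _.
by rewrite -hn_sqr ler_pXn2r ?nnegrE ?hn_ge0 ?mulr_ge0 ?hn_ge0 ?opn_ge0// opn_ub.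
Qed.

Lemma norm_coord_le T f s : reC `|T f s| <= opn T * hn f.
Proof.
rewrite sqnorm_norm -[leRHS]ger0_norm ?mulr_ge0 ?hn_ge0 ?opn_ge0//.
by rewrite -sqrtr_sqr ler_sqrt ?sqr_ge0// sqnorm_le_opn.
Qed.

(** The limit operator is defined coordinatewise along an ultrafilter refining [F], where the
    coordinates are bounded. The Fatou bound on finite sums carries an operator norm estimate over
    to this limit, so it is square summable and close to the Cauchy family in norm. *)
Lemma bop_complete (F : set_system bop) : ProperFilter F -> cauchy F -> cvg F.
Proof.
move=> FF /cauchy_ballP cF.
have near0 (e : R) : 0 < e -> exists T0, F [set T | opn (T - T0) <= e].
  move=> e0; have := cF (cplx_of e); rewrite -(cplx_of0 R) cplx_of_lt => /(_ e0).
  case=> [[P Q]] [/= FP FQ] PQ.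
  have [T0 QT0] := @filter_ex _ _ FF _ FQ.
  exists T0; apply: filterS FP => T PT /=.
  have := PQ (T, T0) (conj PT QT0); rewrite -ball_normE /= /ball_ /= bop_normE.
  by rewrite cplx_of_lt => /ltW.
have [U [UU FU]] := ultraFilterLemma FF.
have UF : Filter U by typeclasses eauto.
have bU f s : ubdd U (fun T : bop => T f s).
  have [T0 /FU T0U] := near0 1 ltr01.
  apply: (@ubdd_norm _ _ _ UU _ ((1 + opn T0) * hn f)).
  apply: filterS T0U => T /= T1; apply: le_trans (norm_coord_le _ _ _) _.
  rewrite ler_wpM2r ?hn_ge0// -[X in opn X](subrK T0).
  by rewrite (le_trans (opnD _ _))// lerD2r.
pose Tf f s := ulim U (fun T : bop => T f s).
have T0e (e : R) T0 f (A : {fset S}) : 0 <= e -> U [set T | opn (T - T0) <= e] ->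
    \sum_(s <- A) sqnorm (Tf f s - T0 f s) <= (e * hn f) ^+ 2.
  move=> e0 UT0.
  have E s : Tf f s - T0 f s = ulim U (fun T : bop => T f s + - T0 f s).
    by rewrite ulimD ?ulim_cst//; exact: ubdd_cst.
  under eq_bigr do rewrite E.
  apply: ulim_sum_sqnorm_le => [s|]; first by apply: ubddD => //; exact: ubdd_cst.
  apply: filterS UT0 => T /= Te.
  apply: le_trans (sqhn_ub (T f - T0 f) A) _; rewrite -hn_sqr ler_pXn2r ?nnegrE ?hn_ge0 ?mulr_ge0 ?hn_ge0//.
  by rewrite -bopBE (le_trans (opn_ub _ _))// ler_wpM2r ?hn_ge0.
have Tsum f : sq_summable (Tf f).
  have [T0 /FU T0U] := near0 1 ltr01.
  have d : sq_summable (fun s => Tf f s - T0 f s).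
    by exists ((1 * hn f) ^+ 2) => A; exact: T0e.
  rewrite (_ : Tf f = mk_l2 d + T0 f); first exact: l2_summable.
  by apply/funext => s; rewrite l2DE /= subrK.
pose Tinf f := mk_l2 (Tsum f).
have hnT (e : R) T0 f : 0 <= e -> U [set T | opn (T - T0) <= e] ->
    hn (Tinf f - T0 f) <= e * hn f.
  move=> e0 UT0; apply: hn_le => [|A]; first by rewrite mulr_ge0 ?hn_ge0.
  exact: T0e.
have bT : is_bop Tinf.
  split=> [c f g|].
    apply: l2P => s; rewrite [LHS]/(Tf _ _) l2DE l2ZE /= /Tf.
    rewrite -(ulimZ UU)// -(ulimD UU)//; last exact: ubddZ.
    congr (ulim _ _); apply/funext => T.
    by have [lT _] := bop_is_bop T; rewrite lT.
  have [T0 /FU T0U] := near0 1 ltr01; exists (1 + opn T0) => f.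
  rewrite -[Tinf f](subrK (T0 f)) (le_trans (hnD _ _))// mulrDl lerD//.
    exact: hnT.
  exact: opn_ub.
apply/cvg_ex; exists (mk_bop bT); apply/fcvgrPdist_lt => e e0.
have ep : 0 < reC e by rewrite -cplx_of_lt cplx_of_reC// ltW.
have e2 : 0 < reC e / 3 by rewrite divr_gt0.
have [T0 FT0] := near0 _ e2.
have UT0 := FU _ FT0.
apply: filterS FT0 => T /= T0T; rewrite bop_normE -(cplx_of_reC (ltW e0)) cplx_of_lt.
apply: (@le_lt_trans _ _ (reC e / 3 + reC e / 3)); last by move: ep; lra.
set Ti := mk_bop bT.
have -> : Ti - T = (Ti - T0) + (T0 - T) by rewrite [RHS]subrKA.
apply: le_trans (opnD (Ti - T0) (T0 - T)) _; apply: lerD.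
  apply: opn_le => [|f]; first exact: ltW.
  by rewrite bopBE; exact: (hnT _ _ f (ltW e2) UT0).
by rewrite -cplx_of_le -!bop_normE distrC bop_normE cplx_of_le.
Qed.

HB.instance Definition _ := Uniform_isComplete.Build bop bop_complete.

Lemma comp_is_bop T T' : is_bop (T \o T').
Proof.
have [lT [M TM]] := bop_is_bop T; have [lT' [N TN]] := bop_is_bop T'.
split=> [c f g|]; first by rewrite /= lT' lT.
exists (opn T * opn T') => f /=; apply: le_trans (opn_ub _ _) _.
by rewrite -mulrA ler_wpM2l ?opn_ge0// opn_ub.
Qed.

Definition bop_mul T T' : bop := mk_bop (comp_is_bop T T').
Definition bop_star T : bop := mk_bop (adj_fun_bop (bop_is_bop T)).

Lemma bop_mulE T T' f : bop_mul T T' f = T (T' f). Proof. by []. Qed.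

Lemma bop_starP T f g : ip (T f) g = ip f (bop_star T g).
Proof. exact: adj_funP. Qed.

Lemma bop_starPl T f g : ip (bop_star T f) g = ip f (T g).
Proof. by rewrite -ipJ -bop_starP ipJ. Qed.

Lemma bop_star_uniq T T' : (forall f g, ip (T f) g = ip f (T' g)) ->
  T' = bop_star T.
Proof.
by move=> TT'; apply: bopP => g; apply: ip_eq => k; rewrite -TT' bop_starP.
Qed.

Lemma opn_star_le T : opn (bop_star T) <= opn T.
Proof.
apply: opn_le => [|f]; first exact: opn_ge0.
by apply: adj_fun_le; [exact: opn_ge0|exact: opn_ub].
Qed.

Lemma bop_starK : involutive bop_star.
Proof. by move=> T; apply/esym/bop_star_uniq => f g; rewrite bop_starPl. Qed.

Lemma bop_starD : {morph bop_star : T T' / T + T'}.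
Proof.
move=> T T'; apply/esym/bop_star_uniq => f g.
by rewrite !bopDE ipDl ipDr !bop_starP.
Qed.

Lemma bop_starZ (c : C) T : bop_star (c *: T) = c^* *: bop_star T.
Proof.
apply/esym/bop_star_uniq => f g.
by rewrite !bopZE ipZl ipZr !bop_starP.
Qed.

Lemma bop_starM T T' : bop_star (bop_mul T T') = bop_mul (bop_star T') (bop_star T).
Proof.
by apply/esym/bop_star_uniq => f g; rewrite !bop_mulE !bop_starP.
Qed.

Lemma opnM T T' : opn (bop_mul T T') <= opn T * opn T'.
Proof.
apply: opn_le => [|f]; first by rewrite mulr_ge0 ?opn_ge0.
rewrite bop_mulE (le_trans (opn_ub _ _))// -mulrA ler_wpM2l ?opn_ge0//.
exact: opn_ub.
Qed.

Lemma bop_normM T T' : `|bop_mul T T'| <= `|T| * `|T'|.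
Proof. by rewrite !bop_normE -cplx_ofM cplx_of_le opnM. Qed.

Lemma bop_cstarE T : `|bop_mul (bop_star T) T| = `|T| ^+ 2.
Proof.
rewrite !bop_normE -cplx_ofX; congr cplx_of; apply/eqP; rewrite eq_le.
apply/andP; split.
  rewrite (le_trans (opnM _ _))// expr2 ler_wpM2r ?opn_ge0//.
  exact: opn_star_le.
set q := opn (bop_mul _ _); have q0 : 0 <= q by exact: opn_ge0.
(* The squared norm of [T f] is the inner product of [f] with the image of [f] under the adjoint
   times [T], hence at most [q] times that of [f]. *)
apply: (@le_trans _ _ (Num.sqrt q ^+ 2)); last by rewrite sqr_sqrtr.
rewrite ler_pXn2r ?nnegrE ?opn_ge0 ?sqrtr_ge0//.
apply: opn_le => [|f]; first exact: sqrtr_ge0.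
rewrite -(@ler_pXn2r _ 2) ?nnegrE ?hn_ge0 ?mulr_ge0 ?hn_ge0 ?sqrtr_ge0//.
rewrite exprMn (sqr_sqrtr q0) hn_sqr /sqhn bop_starP -bop_mulE.
apply: le_trans (ler_norm _) _; apply: le_trans (reC_norm_le _) _.
apply: le_trans (ip_le _ _) _.
by rewrite expr2 mulrA mulrC ler_wpM2r ?hn_ge0// opn_ub.
Qed.

Lemma bop_mulA : associative bop_mul.
Proof. by move=> T T' T''; apply: bopP. Qed.
Lemma bop_mulDl : left_distributive bop_mul +%R.
Proof. by move=> T T' T''; apply: bopP. Qed.
Lemma bop_mulDr : right_distributive bop_mul +%R.
Proof.
move=> T T' T''; apply: bopP => f.
by rewrite bop_mulE bopDE (bopD (bop_is_bop T)).
Qed.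
Lemma bop_scaleAl (c : C) T T' : bop_mul (c *: T) T' = c *: bop_mul T T'.
Proof. exact: bopP. Qed.
Lemma bop_scaleAr (c : C) T T' : bop_mul T (c *: T') = c *: bop_mul T T'.
Proof.
by apply: bopP => f; rewrite bop_mulE !bopZE (bopZ (bop_is_bop T)).
Qed.

Definition bop_cstar : cstarAlg R :=
  CStarAlg bop_mulA bop_mulDl bop_mulDr bop_scaleAl bop_scaleAr bop_starK
    bop_starD bop_starZ bop_starM bop_normM bop_cstarE.

End BoundedOperators.

(** * Square roots and contractivity of homomorphisms *)

Section CStarFacts.
Variables (R : realType) (A : cstarAlg R).
Local Notation C := (Cplx R).
Implicit Types (a b c x y : A).

Lemma cs_mul0l a : 0 ** a = 0.
Proof. by have := cs_scaleAl 0 0 a; rewrite !scale0r. Qed.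
Lemma cs_mul0r a : a ** 0 = 0.
Proof. by have := cs_scaleAr 0 a 0; rewrite !scale0r. Qed.
Lemma cs_mulNl a b : (- a) ** b = - (a ** b).
Proof. by rewrite -scaleN1r cs_scaleAl scaleN1r. Qed.
Lemma cs_mulNr a b : a ** (- b) = - (a ** b).
Proof. by rewrite -scaleN1r cs_scaleAr scaleN1r. Qed.
Lemma cs_mulBl a b c : (a - b) ** c = a ** c - b ** c.
Proof. by rewrite cs_mulDl cs_mulNl. Qed.
Lemma cs_mulBr a b c : a ** (b - c) = a ** b - a ** c.
Proof. by rewrite cs_mulDr cs_mulNr. Qed.
Lemma cs_suml I (r : seq I) (P : pred I) (F : I -> A) a :
  (\sum_(i <- r | P i) F i) ** a = \sum_(i <- r | P i) (F i ** a).
Proof. by apply: (big_morph (fun x => x ** a)) => [x y|]; rewrite ?cs_mulDl ?cs_mul0l. Qed.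
Lemma cs_sumr I (r : seq I) (P : pred I) (F : I -> A) a :
  a ** (\sum_(i <- r | P i) F i) = \sum_(i <- r | P i) (a ** F i).
Proof. by apply: (big_morph (fun x => a ** x)) => [x y|]; rewrite ?cs_mulDr ?cs_mul0r. Qed.
Lemma cs_starN a : (- a)^† = - a^†.
Proof. by rewrite -scaleN1r cs_starZ rmorphN1 scaleN1r. Qed.
Lemma cs_star0 : (0 : A)^† = 0.
Proof. by have := @cs_starZ _ A 0 0; rewrite conjC0 !scale0r. Qed.
Lemma cs_starB a b : (a - b)^† = a^† - b^†.
Proof. by rewrite cs_starD cs_starN. Qed.
Lemma cs_star_sum I (r : seq I) (P : pred I) (F : I -> A) :
  (\sum_(i <- r | P i) F i)^† = \sum_(i <- r | P i) (F i)^†.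
Proof. by apply: (big_morph cs_star) => [x y|]; rewrite ?cs_starD ?cs_star0. Qed.

Lemma cs_norm_star a : `|a^†| = `|a|.
Proof.
have le b : `|b| <= `|b^†|.
  have [->|b0] := eqVneq b 0; first by rewrite normr0.
  have bp : 0 < `|b| by rewrite normr_gt0.
  by rewrite -(ler_pM2r bp) -expr2 -cs_normE cs_normM.
by apply/eqP; rewrite eq_le le andbT -{2}[a]cs_starK le.
Qed.

Lemma cs_cvg_star (I : Type) (F : set_system I) (FF : Filter F)
    (f : I -> A) a : f @ F --> a -> (fun i => (f i)^†) @ F --> a^†.
Proof.
move=> /cvgrPdist_lt fa; apply/cvgrPdist_lt => e /fa.
by apply: filterS => i; rewrite -cs_starB cs_norm_star.
Qed.

Lemma cs_cvgM (I : Type) (F : set_system I) (FF : Filter F)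
    (f g : I -> A) a b : f @ F --> a -> g @ F --> b ->
  (fun i => f i ** g i) @ F --> a ** b.
Proof.
move=> fa gb.
have squeeze (w : I -> A) (v : I -> C) : (forall i, `|w i| <= v i) ->
    v @ F --> (0 : C) -> w @ F --> (0 : A).
  move=> wv v0; apply/cvgrPdist_lt => e e0; move/cvgrPdist_lt : v0 => /(_ e e0).
  apply: filterS => i; rewrite !sub0r !normrN => /(le_lt_trans _); apply.
  by rewrite (ger0_norm (le_trans (normr_ge0 _) (wv i))).
have small (u v : I -> A) : u @ F --> (0 : A) -> v @ F --> (0 : A) ->
    (fun i => u i ** v i) @ F --> (0 : A).
  move=> /norm_cvg0P u0 /norm_cvg0P v0.
  apply: (squeeze _ (fun i => `|u i| * `|v i|)) => [i|]; first exact: cs_normM.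
  by rewrite -[X in _ --> X](mulr0 0); apply: cvgM; [exact: u0|exact: v0].
have cl (u : I -> A) c : u @ F --> (0 : A) -> (fun i => u i ** c) @ F --> (0 : A).
  move=> /norm_cvg0P u0.
  apply: (squeeze _ (fun i => `|u i| * `|c|)) => [i|]; first exact: cs_normM.
  by rewrite -[X in _ --> X](mul0r `|c|); apply: cvgM; [exact: u0|exact: cvg_cst].
have cr (u : I -> A) c : u @ F --> (0 : A) -> (fun i => c ** u i) @ F --> (0 : A).
  move=> /norm_cvg0P u0.
  apply: (squeeze _ (fun i => `|c| * `|u i|)) => [i|]; first exact: cs_normM.
  by rewrite -[X in _ --> X](mulr0 `|c|); apply: cvgM; [exact: cvg_cst|exact: u0].
have fa0 : (fun i => f i - a) @ F --> (0 : A).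
  by rewrite -(subrr a); apply: cvgB => //; exact: cvg_cst.
have gb0 : (fun i => g i - b) @ F --> (0 : A).
  by rewrite -(subrr b); apply: cvgB => //; exact: cvg_cst.
have E (V : zmodType) (X Y Z W : V) :
    X = (X - Y - (Z - W)) + ((Y - W) + (Z - W)) + W.
  by rewrite addrACA addNr addr0 subrKA subrK.
have fgE i : f i ** g i = (f i - a) ** (g i - b)
    + ((f i - a) ** b + a ** (g i - b)) + a ** b.
  by rewrite !(cs_mulBl, cs_mulBr); exact: E.
under eq_fun do rewrite fgE.
have K := cvgD (cvgD (small _ _ fa0 gb0) (cvgD (cl _ b fa0) (cr _ a gb0)))
  (cvg_cst (a ** b)).
rewrite !add0r in K; exact: K.
Qed.

Lemma cs_cvg_unique (I : Type) (F : set_system I) (FF : ProperFilter F)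
    (f : I -> A) a b : f @ F --> a -> f @ F --> b -> a = b.
Proof. by move=> fa fb; exact: (cvg_unique (@norm_hausdorff _ A) fa fb). Qed.

Lemma geometric_cvg (u : nat -> A) (q : R) : 0 <= q -> q < 1 ->
  (forall n, `|u n.+1 - u n| <= cplx_of (q ^+ n)) -> cvgn u.
Proof.
move=> q0 q1 uq; apply: (@cauchy_cvg A (u @ \oo)); apply: (@cauchy_exP _ A) => e e0.
have dist n m : `|u (n + m)%N - u n| <= cplx_of (q ^+ n / (1 - q)).
  apply: (@le_trans _ _ (cplx_of (q ^+ n * (1 - q ^+ m) / (1 - q)))); last first.
    rewrite cplx_of_le ler_wpM2r ?invr_ge0 ?subr_ge0 ?(ltW q1)//.
    by rewrite ler_piMr ?exprn_ge0// lerBlDr lerDl exprn_ge0.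
  elim: m => [|m IH].
    by rewrite addn0 subrr normr0 expr0 subrr mulr0 mul0r.
  rewrite -(subrKA (u (n + m)%N)) addnS (le_trans (ler_normD _ _))//.
  apply: le_trans (lerD (uq _) IH) _.
  rewrite -cplx_ofD cplx_of_le exprD exprS.
  have q1' : 1 - q != 0 by rewrite subr_eq0 eq_sym lt_eqF.
  by rewrite le_eqVlt; apply/orP; left; apply/eqP; field.
have [N qN] : exists N, q ^+ N / (1 - q) < reC e.
  have ep : 0 < reC e by rewrite -cplx_of_lt cplx_of_reC// ltW.
  have := @cvg_expr R q; rewrite ger0_norm// => /(_ q1) /cvgrPdist_lt.
  move=> /(_ (reC e * (1 - q))); rewrite mulr_gt0 ?subr_gt0// => /(_ isT) [N _ HN].
  exists N; rewrite ltr_pdivrMr ?subr_gt0//.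
  by have := HN N (leqnn N); rewrite /= sub0r normrN ger0_norm ?exprn_ge0.
exists (u N); exists N => // n /= Nn.
rewrite -ball_normE /ball_ /= distrC -(subnKC Nn) (le_lt_trans (dist _ _))//.
by rewrite -[ltRHS]cplx_of_reC ?cplx_of_lt// ltW.
Qed.

(* [1 - y] is a square root of [1 - k]; [y] is the limit of the Picard
   iteration [y <- (k + y^2) / 2]. *)
Lemma cs_sqrt_exists k : k^† = k -> `|k| < 1 ->
  exists y, [/\ y^† = y, forall c, c ** k = k ** c -> c ** y = y ** c &
    y + y = k + y ** y].
Proof.
move=> ks k1; pose h : C := 2^-1.
pose u := fix u n := if n is m.+1 then h *: (k + u m ** u m) else 0 : A.
have hr : h^* = h by rewrite /h fmorphV rmorph_nat.
have hp : `|h| = h by rewrite ger0_norm// invr_ge0 ler0n.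
have h2 : h * 2 = 1 by rewrite /h mulVf// pnatr_eq0.
have us n : (u n)^† = u n.
  by elim: n => [|n IH] /=; rewrite ?cs_star0// cs_starZ cs_starD cs_starM IH ks hr.
have uc c n : c ** k = k ** c -> c ** u n = u n ** c.
  move=> ck; elim: n => [|n IH] /=; first by rewrite cs_mul0l cs_mul0r.
  rewrite cs_scaleAl cs_scaleAr cs_mulDl cs_mulDr ck.
  by rewrite cs_mulA IH -cs_mulA IH cs_mulA.
(* The ball of radius |k| is stable: (|k| + |k|^2) / 2 <= |k| as |k| < 1. This radius is also the
   contraction factor below. *)
have un n : `|u n| <= `|k|.
  elim: n => [|n IH] /=; first by rewrite normr0.
  rewrite normrZ hp -[leRHS]mul1r -h2 -mulrA ler_wpM2l ?invr_ge0 ?ler0n//.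
  rewrite (le_trans (ler_normD _ _))// mulr_natl mulr2n lerD2l.
  rewrite (le_trans (cs_normM _ _))// (le_trans (ler_pM _ _ IH IH))//.
  by rewrite ler_piMr// ltW.
set q := reC `|k|.
have kq : `|k| = cplx_of q by rewrite /q cplx_of_reC.
have q0 : 0 <= q by rewrite -cplx_of_le -kq; exact: normr_ge0.
have q1 : q < 1 by rewrite -cplx_of_lt -kq; exact: k1.
have ud n : `|u n.+1 - u n| <= cplx_of (q ^+ n).
  elim: n => [|n IH].
    rewrite /= cs_mul0l addr0 subr0 normrZ hp expr0.
    apply: (@le_trans _ _ (h * 1)); last by rewrite mulr1 invf_le1 ?ltr0n// ler1n.
    by rewrite ler_wpM2l ?invr_ge0 ?ler0n// ltW.
  (* A difference of squares without commutativity; each of the two products loses a factor |k|, and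
     the half in front averages them. *)
  have -> : u n.+2 - u n.+1 =
      h *: (u n.+1 ** (u n.+1 - u n) + (u n.+1 - u n) ** u n).
    rewrite cs_mulBr cs_mulBl addrA subrK -[LHS]/(h *: (k + _) - h *: (k + _)).
    by rewrite -scalerBr opprD addrACA subrr add0r.
  rewrite normrZ hp exprS cplx_ofM -kq.
  rewrite -[leRHS]mul1r -h2 -mulrA ler_wpM2l ?invr_ge0 ?ler0n//.
  rewrite mulr_natl mulr2n (le_trans (ler_normD _ _))// lerD//.
    by rewrite (le_trans (cs_normM _ _))// ler_pM.
  by rewrite (le_trans (cs_normM _ _))// mulrC ler_pM.
have cu := geometric_cvg q0 q1 ud.
set y := limn u; have uy : u @ \oo --> y by exact: cu.
exists y; split.
- have uys : (fun n => (u n)^†) @ \oo --> y^† by exact: cs_cvg_star.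
  have usE : (fun n => (u n)^†) = u by exact/funext.
  by rewrite usE in uys; exact: cs_cvg_unique _ uys uy.
- move=> c ck.
  have cy : (fun n => c ** u n) @ \oo --> c ** y.
    exact: (cs_cvgM _ (cvg_cst c) uy).
  have yc : (fun n => u n ** c) @ \oo --> y ** c.
    exact: (cs_cvgM _ uy (cvg_cst c)).
  have ucE : (fun n => c ** u n) = (fun n => u n ** c).
    by apply/funext => n; exact: uc.
  by rewrite ucE in cy; exact: cs_cvg_unique _ cy yc.
- have yE : y = h *: (k + y ** y).
    have uSy : (fun n => u n.+1) @ \oo --> y by exact: (cvg_comp (addn 1) u (cvg_addnl 1) uy).
    have K : (fun n => k + u n ** u n) @ \oo --> k + y ** y.
      exact: (cvgD (cvg_cst k) (cs_cvgM _ uy uy)).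
    have K' : (fun n => h *: (k + u n ** u n)) @ \oo --> h *: (k + y ** y).
      by apply: cvgZl_tmp; exact: K.
    exact: cs_cvg_unique _ uSy K'.
  rewrite -mulr2n -scaler_nat {1}yE scalerA mulrC h2 scale1r //.
Qed.

Definition cs_is_unit (e : A) := forall a, e ** a = a /\ a ** e = a.

End CStarFacts.

(** * Contractivity of homomorphisms from a unital C*-algebra *)

Section Contractive.
Variables (R : realType) (A B : cstarAlg R) (f : A -> B) (e : A).
Local Notation C := (Cplx R).
Hypothesis hf : star_hom f.
Hypothesis eP : cs_is_unit e.

Lemma star_homD a b : f (a + b) = f a + f b.
Proof. by have := star_hom_linear hf 1 a b; rewrite !scale1r. Qed.
Lemma star_hom0 : f 0 = 0.
Proof. by have := star_hom_linear hf (-1) 0 0; rewrite scaler0 addr0 scaleN1r addNr. Qed.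
Lemma star_homZ (c : C) a : f (c *: a) = c *: f a.
Proof. by have := star_hom_linear hf c a 0; rewrite star_hom0 !addr0. Qed.

Lemma unit_star : e^† = e.
Proof. by rewrite -[LHS](proj1 (eP _)) -{1}[e]cs_starK -cs_starM (proj1 (eP _)) cs_starK. Qed.

Lemma norm_unit_image : `|f e| <= 1.
Proof.
have : `|f e| ^+ 2 = `|f e|.
  rewrite -cs_normE -(star_hom_star hf) -(star_hom_mul hf) unit_star.
  by rewrite (proj1 (eP _)).
have [->|fe0] := eqVneq `|f e| 0; first by rewrite ler01.
by rewrite expr2 -[RHS]mulr1 => /(mulfI fe0) ->.
Qed.

Lemma star_hom_selfadjoint_le1 h : h^† = h -> `|h| < 1 -> `|f h| <= 1.
Proof.
move=> hs h1.
have ks : (h ** h)^† = h ** h by rewrite cs_starM hs.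
have k1 : `|h ** h| < 1.
  apply: le_lt_trans (cs_normM _ _) _.
  by rewrite (le_lt_trans _ h1)// ler_piMr// ltW.
have [y [ys yc yy]] := cs_sqrt_exists ks k1.
set g := f h; set K := e - y; set l := f K.
have Ks : K^† = K by rewrite cs_starB unit_star ys.
have hK : h ** K = K ** h.
  rewrite cs_mulBr cs_mulBl (proj1 (eP h)) (proj2 (eP h)); congr (_ - _).
  by apply: yc; rewrite cs_mulA.
have KK : K ** K = e - h ** h.
  rewrite !(cs_mulBl, cs_mulBr) (proj1 (eP e)) (proj1 (eP y)) (proj2 (eP y)).
  have -> : h ** h = y + y - y ** y by rewrite yy addrK.
  by rewrite -addrA -opprD addrA.
(* [u] is formed in [B], where [f e] is a self-adjoint idempotent and not necessarily a unit: the
   product [v ** u] is [f e], of norm at most 1, and this already bounds [u]. *)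
pose u := g + 'i *: l; pose v := g - 'i *: l.
have uv : u^† = v.
  rewrite /u /v cs_starD cs_starZ -!(star_hom_star hf) hs Ks.
  by rewrite conjCi scaleNr.
have vu : v ** u = f e.
  rewrite /u /v cs_mulBl !cs_mulDr !cs_scaleAl !cs_scaleAr scalerA -expr2 sqrCi.
  rewrite scaleN1r -/g -/l /g /l -!(star_hom_mul hf) hK KK.
  by rewrite opprD opprK addrA addrK -star_homD addrC subrK.
have un : `|u| <= 1.
  rewrite -(@ler_pXn2r _ 2) ?nnegrE// expr1n -cs_normE uv vu.
  exact: norm_unit_image.
have gE : g = 2^-1 *: (u + v).
  have gg : g + g = 2 *: g by rewrite scaler_nat.
  by rewrite /u /v addrACA subrr addr0 gg scalerA mulVf ?scale1r// pnatr_eq0.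
rewrite gE normrZ (ger0_norm (_ : 0 <= 2^-1)) ?invr_ge0 ?ler0n//.
rewrite ler_pdivrMl ?ltr0n// mulr1 (le_trans (ler_normD _ _))//.
by rewrite -uv cs_norm_star -mulr2n -[leLHS]mulr_natr ler_piMl ?ler0n.
Qed.

(** Dividing [h] by |h| + d brings it into the open unit ball, and d > 0 is arbitrary; the slack d
    also covers [h = 0]. *)
Lemma star_hom_selfadjoint_contractive h : h^† = h -> `|f h| <= `|h|.
Proof.
move=> hs; rewrite -[leRHS]cplx_of_reC// -[leLHS]cplx_of_reC// cplx_of_le.
set n := reC `|h|; apply/ler_addgt0Pr => d d0.
have n0 : 0 <= n by rewrite -cplx_of_le /n cplx_of_reC//; exact: normr_ge0.
have c0 : 0 < n + d by rewrite ltr_wpDl.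
have cc : 0 < cplx_of (n + d) by rewrite -(cplx_of0 R) cplx_of_lt.
set c := cplx_of (n + d) in cc *.
have cJ : (c^-1)^* = c^-1 by rewrite /c -cplx_ofV cplx_ofJ.
have := @star_hom_selfadjoint_le1 (c^-1 *: h).
rewrite cs_starZ hs cJ normrZ normfV (gtr0_norm cc) => /(_ erefl).
rewrite ltr_pdivrMl// mulr1 -[X in X < _]cplx_of_reC// cplx_of_lt ltrDl => /(_ d0).
rewrite star_homZ normrZ normfV (gtr0_norm cc) ler_pdivrMl// mulr1.
by rewrite -[X in X <= _]cplx_of_reC// cplx_of_le.
Qed.

Lemma star_hom_contractive a : `|f a| <= `|a|.
Proof.
rewrite -(@ler_pXn2r _ 2) ?nnegrE// -!cs_normE -(star_hom_star hf) -(star_hom_mul hf).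
by apply: star_hom_selfadjoint_contractive; rewrite cs_starM cs_starK.
Qed.

End Contractive.

(** * The representation on l^2 *)

Section Functions.
Variables (R : realType) (Z : lhSystem).
Local Notation C := (Cplx R).
Local Notation CZ := (cfun R Z).
Local Notation h := (@lh_map Z).
Implicit Types (x y z : CZ) (a b : CZ).

Lemma cfunP x y : (forall z : Z, x z = y z) -> x = y.
Proof. by move=> xy; apply/continuousEP. Qed.

Lemma cfDE x y (w : Z) : (x + y) w = x w + y w. Proof. by []. Qed.
Lemma cf0E (w : Z) : (0 : CZ) w = 0. Proof. by []. Qed.
Lemma cf_sumE I (r : seq I) (P : pred I) (F : I -> CZ) (w : Z) :
  (\sum_(i <- r | P i) F i) w = \sum_(i <- r | P i) F i w.
Proof. by apply: (big_morph (fun f : CZ => f w)). Qed.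
Lemma cfmulE x y (w : Z) : cfmul x y w = x w * y w. Proof. by []. Qed.
Lemma cfconjE x (w : Z) : cfconj x w = (x w)^*. Proof. by []. Qed.
Lemma ractE x a (w : Z) : ract x a w = x w * a (h w). Proof. by []. Qed.
Lemma lactE a x (w : Z) : lact a x w = a w * x w. Proof. by []. Qed.

Definition cf1 : CZ := mkcts (@cst_continuous Z C (1 : C)).
Lemma cf1E (w : Z) : cf1 w = 1. Proof. by []. Qed.

Definition fibre (z : Z) : {fset Z} := fset_set (h @^-1` [set z]).

Lemma mem_fibre (z w : Z) : (w \in fibre z) = (h w == z).
Proof.
rewrite /fibre in_fset_set; last exact: lh_fibre_finite.
by apply/idP/eqP => [/set_mem|hw]; [|rewrite inE].
Qed.

Lemma innerE x y (z : Z) : inner x y z = \sum_(w <- fibre z) (x w)^* * y w.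
Proof.
transitivity (fibre_sum (fun w => (x w)^* * y w) z); first by [].
by rewrite /fibre_sum fsbig_finite//; exact: lh_fibre_finite.
Qed.

Lemma cfun_bounded x : exists2 M : R, 0 <= M & forall w : Z, reC `|x w| <= M.
Proof.
pose g (w : Z) : R := reC `|x w|.
have cg : continuous g.
  move=> w; apply/cvgrPdist_lt => e e0.
  have := @cts_fun _ _ x w; move/cvgrPdist_lt => /(_ (cplx_of e)).
  rewrite -[X in X < _](cplx_of0 R) cplx_of_lt => /(_ e0).
  apply: filterS => v; rewrite norm_lt_of; apply: le_lt_trans.
  rewrite -reCB; apply: le_trans (reC_norm_le _) _.
  by rewrite -cplx_of_le !normC_reC ler_dist_dist.
have : compact (g @` setT).
  by apply: continuous_compact (@lh_compact Z); exact: continuous_subspaceT.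
move=> /compact_bounded [M [_ HM]].
exists (`|M| + 1) => [|w]; first by rewrite addr_ge0.
have : M < `|M| + 1 by rewrite (le_lt_trans (ler_norm _))// ltrDl.
move=> /HM /(_ (g w)) H; apply: le_trans (ler_norm _) (H _).
by exists w.
Qed.

End Functions.

Section Representation.
Variables (R : realType) (Z : lhSystem) (K : nat).
Local Notation C := (Cplx R).
Local Notation CZ := (cfun R Z).
Local Notation h := (@lh_map Z).
Local Notation H := (l2 R Z).
Hypothesis fibreK : forall z : Z, (#|` fibre z| <= K)%N.
Implicit Types (x y a b : CZ) (f g : H).

(** At most [K] points share an image, so grouping by images costs a factor [K]. This is what makes
    composition with [h] bounded on l^2. *)
Lemma sum_comp_shift (F : Z -> R) (A : {fset Z}) : (forall w, 0 <= F w) ->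
  exists B : {fset Z}, \sum_(w <- A) F (h w) <= K%:R * \sum_(u <- B) F u.
Proof.
move=> F0; exists (h @` A)%fset.
rewrite (partition_big_imfset _ h) /= mulr_sumr; apply: ler_sum => u _.
rewrite (eq_bigr (fun=> F u)) => [|w /eqP -> //].
rewrite big_const_seq iter_addr_0 -[leLHS]mulr_natl ler_wpM2r// ler_nat.
rewrite -size_filter (leq_trans _ (fibreK u))//.
apply: uniq_leq_size; first exact: filter_uniq (fset_uniq A).
by move=> w; rewrite mem_filter mem_fibre => /andP[].
Qed.

Lemma sum_sqnormM_le x (M : R) (g : Z -> C) (A : {fset Z}) :
  (forall w, reC `|x w| <= M) ->
  \sum_(w <- A) sqnorm (x w * g w) <= M ^+ 2 * \sum_(w <- A) sqnorm (g w).
Proof.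
move=> xM; rewrite mulr_sumr; apply: ler_sum => w _.
rewrite sqnormM ler_wpM2r ?sqnorm_ge0//.
have xE : sqnorm (x w) = reC `|x w| ^+ 2.
  by rewrite sqnorm_norm sqr_sqrtr ?sqnorm_ge0.
have x0 : 0 <= reC `|x w| by rewrite sqnorm_norm sqrtr_ge0.
by rewrite xE ler_pXn2r ?nnegrE// (le_trans x0).
Qed.

Lemma psi_bound x : exists2 M : R, 0 <= M & forall f (A : {fset Z}),
  \sum_(w <- A) sqnorm (x w * f (h w)) <= M * sqhn f.
Proof.
have [M M0 xM] := cfun_bounded x.
exists (M ^+ 2 * K%:R) => [|f A]; first by rewrite mulr_ge0 ?sqr_ge0 ?ler0n.
have [|B AB] := @sum_comp_shift (fun u => sqnorm (f u)) A.
  by move=> w; exact: sqnorm_ge0.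
rewrite (le_trans (sum_sqnormM_le (f \o h) A xM))// -mulrA ler_wpM2l ?sqr_ge0//.
by rewrite (le_trans AB)// ler_wpM2l ?ler0n// sqhn_ub.
Qed.

Lemma pi_bound a : exists2 M : R, 0 <= M & forall f (A : {fset Z}),
  \sum_(w <- A) sqnorm (a w * f w) <= M * sqhn f.
Proof.
have [M M0 aM] := cfun_bounded a.
exists (M ^+ 2) => [|f A]; first exact: sqr_ge0.
rewrite (le_trans (sum_sqnormM_le f A aM))// ler_wpM2l ?sqr_ge0//.
exact: sqhn_ub.
Qed.

Lemma bop_of_bound (T : H -> H) (M : R) : linear T -> 0 <= M ->
  (forall f (A : {fset Z}), \sum_(s <- A) sqnorm (T f s) <= M * sqhn f) ->
  is_bop T.
Proof.
move=> lT M0 TM; split=> //; exists (Num.sqrt M) => f.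
apply: hn_le => [|A]; first by rewrite mulr_ge0 ?sqrtr_ge0 ?hn_ge0.
by rewrite exprMn sqr_sqrtr// hn_sqr.
Qed.

Lemma psi_summable x f : sq_summable (fun w => x w * f (h w)).
Proof. by have [M _ xM] := psi_bound x; exists (M * sqhn f) => A; exact: xM. Qed.

Lemma pi_summable a f : sq_summable (fun w => a w * f w).
Proof. by have [M _ aM] := pi_bound a; exists (M * sqhn f) => A; exact: aM. Qed.

Definition psi_fun x f : H := mk_l2 (psi_summable x f).
Definition pi_fun a f : H := mk_l2 (pi_summable a f).

Lemma psi_is_bop x : is_bop (psi_fun x).
Proof.
have [M M0 xM] := psi_bound x; apply: (@bop_of_bound (psi_fun x) M) => //.
by move=> c f g; apply: l2P => w; rewrite /= mulrDr mulrCA.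
Qed.

Lemma pi_is_bop a : is_bop (pi_fun a).
Proof.
have [M M0 aM] := pi_bound a; apply: (@bop_of_bound (pi_fun a) M) => //.
by move=> c f g; apply: l2P => w; rewrite /= mulrDr mulrCA.
Qed.

Local Notation B := (bop_cstar R Z).

Definition psi_rep x : B := mk_bop (psi_is_bop x).
Definition pi_rep a : B := mk_bop (pi_is_bop a).

Lemma psi_repE x f w : (psi_rep x : bop R Z) f w = x w * f (h w). Proof. by []. Qed.
Lemma pi_repE a f w : (pi_rep a : bop R Z) f w = a w * f w. Proof. by []. Qed.

Lemma star_repE (T : bop R Z) f w : (bop_star T) f w = ip (T (delta R w)) f.
Proof. by []. Qed.

Lemma psi_rep_starE x f w :
  ((psi_rep x)^† : bop R Z) f w = \sum_(v <- fibre w) (x v)^* * f v.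
Proof.
rewrite star_repE (@ip_finite _ _ (fibre w)) => [|v].
  apply: eq_big_seq => v; rewrite mem_fibre => /eqP hv.
  by rewrite psi_repE hv deltaE eqxx mulr1.
by rewrite mem_fibre psi_repE deltaE => /negbTE ->; rewrite mulr0.
Qed.

Lemma pi_rep_starE a f w : ((pi_rep a)^† : bop R Z) f w = (a w)^* * f w.
Proof.
rewrite star_repE (@ip_finite _ _ [fset w]%fset) => [|v].
  by rewrite big_seq_fset1 pi_repE deltaE eqxx mulr1.
by rewrite inE pi_repE deltaE => /negbTE ->; rewrite mulr0.
Qed.

Lemma l2_representation : representation psi_rep pi_rep.
Proof.
split.
- move=> c x y; apply: bopP => f; apply: l2P => w.
  by rewrite -[LHS]/((c * x w + y w) * f (h w)) mulrDl -mulrA.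
- move=> c x y; apply: bopP => f; apply: l2P => w.
  by rewrite -[LHS]/((c * x w + y w) * f w) mulrDl -mulrA.
- by move=> a b; apply: bopP => f; apply: l2P => w; rewrite /= mulrA.
- move=> a; apply: bopP => f; apply: l2P => w; rewrite pi_rep_starE //.
- move=> a x b; apply: bopP => f; apply: l2P => w.
  by rewrite -[RHS]/(a w * (x w * (b (h w) * f (h w)))) psi_repE ractE lactE !mulrA.
- move=> x y; apply: bopP => f; apply: l2P => w.
  rewrite -[RHS]/(((psi_rep x)^† : bop R Z) ((psi_rep y : bop R Z) f) w).
  rewrite psi_rep_starE pi_repE innerE mulr_suml; apply: eq_big_seq => v.
  by rewrite mem_fibre => /eqP hv; rewrite psi_repE hv mulrA.
Qed.

End Representation.

(** * Finite frames of the bimodule and covariance *)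

Section Frame.
Variables (R : realType) (Z : lhSystem) (J : finType).
Local Notation C := (Cplx R).
Local Notation CZ := (cfun R Z).
Local Notation h := (@lh_map Z).
Variable F : J -> CZ.
(** The pointwise form of the reconstruction formula x = sum_j F_j <F_j, x>. *)
Hypothesis frame : forall w v : Z, h w = h v ->
  \sum_j F j w * (F j v)^* = (w == v)%:R.
Implicit Types (x y z : CZ) (a b : CZ).

Lemma frame_expansion x : x = \sum_j ract (F j) (inner (F j) x).
Proof.
apply: cfunP => w; rewrite cf_sumE.
under eq_bigr do rewrite ractE innerE mulr_sumr.
rewrite exchange_big /= (big_fsetD1 w) ?mem_fibre//= [X in _ + X]big1_seq.
  under eq_bigr do rewrite mulrA.
  by rewrite -mulr_suml frame// eqxx mul1r addr0.
move=> v; rewrite !inE mem_fibre => /andP[_ /andP[vw /eqP hv]].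
under eq_bigr do rewrite mulrA.
by rewrite -mulr_suml frame// eq_sym (negbTE vw) mul0r.
Qed.

Lemma innerJ x y : cfconj (inner x y) = inner y x.
Proof.
apply: cfunP => w; rewrite cfconjE !innerE rmorph_sum; apply: eq_bigr => v _.
by rewrite rmorphM /= conjCK mulrC.
Qed.

Lemma inner_inj x y : (forall z, inner x z = inner y z) -> x = y.
Proof.
move=> xy; rewrite [x]frame_expansion [y]frame_expansion; apply: eq_bigr => j _.
by rewrite -innerJ xy innerJ.
Qed.

Lemma inner_ract_l x y b : inner (ract x b) y = cfmul (cfconj b) (inner x y).
Proof.
apply: cfunP => w; rewrite cfmulE cfconjE !innerE mulr_sumr.
apply: eq_big_seq => v; rewrite mem_fibre => /eqP hv.
by rewrite ractE hv rmorphM /= [_ * (b w)^*]mulrC mulrA.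
Qed.

Lemma inner_sum_l I (r : seq I) (P : pred I) (G : I -> CZ) y :
  inner (\sum_(i <- r | P i) G i) y = \sum_(i <- r | P i) inner (G i) y.
Proof.
apply: (big_morph (fun x => inner x y)).
  move=> x x'; apply: cfunP => w; rewrite cfDE !innerE -big_split.
  by apply: eq_bigr => v _; rewrite cfDE rmorphD mulrDl.
by apply: cfunP => w; rewrite innerE big1// => v _; rewrite cf0E conjC0 mul0r.
Qed.

(** [S] is not assumed linear: moving it to the other side of the inner product supplies additivity
    and right [CZ]-linearity. Hence every adjointable operator is the finite-rank sum of the
    Theta_{S F_j, F_j}. *)
Lemma adjointable_expansion (S S' : CZ -> CZ) x : adjoint_ops S S' ->
  S x = \sum_j ract (S (F j)) (inner (F j) x).
Proof.
move=> SS'; apply: inner_inj => z; rewrite SS' {1}[x]frame_expansion !inner_sum_l.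
by apply: eq_bigr => j _; rewrite !inner_ract_l SS'.
Qed.

Variables (B : cstarAlg R) (psi : CZ -> B) (pi : CZ -> B).
Hypothesis rep : representation psi pi.

(** [rep_act] multiplies on both sides at once and [pi 1] is not assumed to be a unit of [B]; it
    does fix [psi x] on the left, since x = 1 x 1 and [pi 1] is idempotent. *)
Lemma rep_ract x b : psi (ract x b) = psi x ** pi b.
Proof.
have e1 a y c : psi (ract (lact a y) c) = pi a ** psi y ** pi c := rep_act rep a y c.
have l1 y : lact (cf1 R Z) y = y by apply: cfunP => w; rewrite lactE cf1E mul1r.
have r1 y : ract y (cf1 R Z) = y by apply: cfunP => w; rewrite ractE cf1E mulr1.
have p1 : pi (cf1 R Z) ** pi (cf1 R Z) = pi (cf1 R Z).
  by rewrite -(rep_pi_mul rep); congr pi; apply: cfunP => w; rewrite cfmulE mulr1.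
have px : pi (cf1 R Z) ** psi x = psi x.
  have := e1 (cf1 R Z) x (cf1 R Z); rewrite l1 r1 => ->.
  by rewrite !cs_mulA p1.
by rewrite -{1}px -e1 l1.
Qed.

Lemma rep_lact a x : psi (lact a x) = pi a ** psi x.
Proof.
have r1 y : ract y (cf1 R Z) = y by apply: cfunP => w; rewrite ractE cf1E mulr1.
by rewrite -[lact a x]r1 (rep_act rep) -cs_mulA -rep_ract r1.
Qed.

Lemma rep_psi_sum I (r : seq I) (P : pred I) (G : I -> CZ) :
  psi (\sum_(i <- r | P i) G i) = \sum_(i <- r | P i) psi (G i).
Proof.
apply: (big_morph psi).
  by move=> x y; have := rep_psi_linear rep 1 x y; rewrite !scale1r.
by have := rep_psi_linear rep (-1) 0 0; rewrite scaler0 addr0 scaleN1r addNr.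
Qed.

(** The image of S = sum_j Theta_{S F_j, F_j} under the rule that sends Theta_{x, y} to
    [psi x ** (psi y)^†]. *)
Definition frame_hom (S : CZ -> CZ) : B := \sum_j psi (S (F j)) ** (psi (F j))^†.

Lemma rep_frame x : psi x = \sum_j psi (F j) ** pi (inner (F j) x).
Proof.
rewrite {1}[x]frame_expansion rep_psi_sum.
by apply: eq_bigr => j _; rewrite rep_ract.
Qed.

Lemma frame_hom_induced : induced_hom psi frame_hom.
Proof.
split.
- move=> c S T _ _; rewrite /frame_hom scaler_sumr -big_split /=.
  apply: eq_bigr => j _; rewrite -cs_scaleAl -cs_mulDl; congr (_ ** _).
  exact: (rep_psi_linear rep).
- move=> S T [[S' SS'] _] _; rewrite /frame_hom cs_sumr; apply: eq_bigr => j _.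
  rewrite /= (adjointable_expansion _ SS') rep_psi_sum !cs_suml.
  apply: eq_bigr => i _; rewrite rep_ract (rep_inner rep).
  by rewrite !cs_mulA.
- move=> S T [[S' SS'] _] _ ST; rewrite /frame_hom cs_star_sum.
  under eq_bigr do rewrite rep_frame cs_suml.
  rewrite exchange_big /=; apply: eq_bigr => i _.
  rewrite cs_starM cs_starK [psi (S _)]rep_frame cs_star_sum cs_sumr.
  apply: eq_bigr => j _; rewrite cs_starM -(rep_pi_conj rep) innerJ ST.
  by rewrite cs_mulA.
- move=> x y; rewrite /frame_hom [psi y]rep_frame cs_star_sum cs_sumr.
  apply: eq_bigr => j _.
  by rewrite rep_ract cs_starM -(rep_pi_conj rep) innerJ cs_mulA.
Qed.

Lemma frame_covariant :
  (forall a, pi a ** (\sum_j psi (F j) ** (psi (F j))^†) = pi a) ->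
  cp_covariant psi pi.
Proof.
move=> E; exists frame_hom; first exact: frame_hom_induced.
move=> a _; rewrite -[RHS]E cs_sumr; apply: eq_bigr => j _.
by rewrite rep_lact cs_mulA.
Qed.

End Frame.

(** [psi x ** (psi y)^†] mixes the values of a vector over the fibre through each point; summed over
    the frame, only the point itself survives, so the sum is the identity operator. *)
Lemma l2_covariant (R : realType) (Z : lhSystem) (K : nat) (J : finType)
    (F : J -> cfun R Z) (fibreK : forall z : Z, (#|` fibre z| <= K)%N) :
  (forall w v : Z, lh_map w = lh_map v ->
    \sum_j F j w * (F j v)^* = (w == v)%:R) ->
  cp_covariant (psi_rep fibreK) (@pi_rep R Z).
Proof.
move=> frame; apply: (frame_covariant frame (l2_representation R fibreK)) => a.
suff -> : \sum_j psi_rep fibreK (F j) ** (psi_rep fibreK (F j))^† =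
    pi_rep (cf1 R Z) :> bop_cstar R Z.
  rewrite -(rep_pi_mul (l2_representation R fibreK)); congr pi_rep.
  by apply: cfunP => w; rewrite cfmulE mulr1.
apply: bopP => f; apply: l2P => w.
have E (T : J -> bop R Z) : (\sum_j T j : bop R Z) f w = \sum_j T j f w.
  by apply: (big_morph (fun S : bop R Z => S f w)).
rewrite E pi_repE cf1E mul1r.
under eq_bigr do rewrite bop_mulE psi_repE psi_rep_starE mulr_sumr.
rewrite exchange_big /= (big_fsetD1 w) ?mem_fibre//= [X in _ + X]big1_seq.
  under eq_bigr do rewrite mulrA.
  by rewrite -mulr_suml frame// eqxx mul1r addr0.
move=> v; rewrite !inE mem_fibre => /andP[_ /andP[vw /eqP hv]].
under eq_bigr do rewrite mulrA.
by rewrite -mulr_suml frame// eq_sym (negbTE vw) mul0r.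
Qed.

(** * The transfer operator *)

Section Transfer.
Variables (R : realType) (Z : lhSystem) (K : nat).
Local Notation C := (Cplx R).
Local Notation CZ := (cfun R Z).
Local Notation h := (@lh_map Z).
Hypothesis fibreK : forall z : Z, (#|` fibre z| <= K)%N.
Implicit Types (F G : Z -> C).

Definition transfer F (z : Z) : C := \sum_(w <- fibre z) F w.

Lemma transferD F G z : transfer (fun w => F w + G w) z = transfer F z + transfer G z.
Proof. exact: big_split. Qed.
Lemma transferZ (c : C) F z : transfer (fun w => c * F w) z = c * transfer F z.
Proof. by rewrite /transfer mulr_sumr. Qed.
Lemma transferJ F z : transfer (fun w => (F w)^*) z = (transfer F z)^*.
Proof. by rewrite /transfer rmorph_sum. Qed.

Lemma iter_transferD k F G z :
  iter k transfer (fun w => F w + G w) z = iter k transfer F z + iter k transfer G z.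
Proof.
elim: k z => // k IH z; rewrite !iterS -transferD.
by congr (transfer _ z); apply/funext.
Qed.
Lemma iter_transferZ k (c : C) F z :
  iter k transfer (fun w => c * F w) z = c * iter k transfer F z.
Proof.
elim: k z => // k IH z; rewrite !iterS -transferZ.
by congr (transfer _ z); apply/funext.
Qed.
Lemma iter_transferJ k F z :
  iter k transfer (fun w => (F w)^*) z = (iter k transfer F z)^*.
Proof.
elim: k z => // k IH z; rewrite !iterS -transferJ.
by congr (transfer _ z); apply/funext.
Qed.
Lemma iter_transfer_ge0 k F z : (forall w, 0 <= F w) -> 0 <= iter k transfer F z.
Proof. by move=> F0; elim: k z => // k IH z; rewrite iterS sumr_ge0. Qed.

Lemma iter_transfer_le k F (b : C) z : (forall w, `|F w| <= b) ->
  `|iter k transfer F z| <= b * iter k transfer (fun=> 1) z.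
Proof.
move=> Fb; elim: k z => [|k IH] z; first by rewrite mulr1.
rewrite !iterS /transfer mulr_sumr (le_trans (ler_norm_sum _ _ _))//.
by apply: ler_sum => w _; exact: IH.
Qed.

(* Averages of the iterated transfer operator at the base point [z0], when the
   total masses [transfer^k 1] at [z0] grow like [N^k]. *)
Variables (N : nat) (z0 : Z) (M : R).
Hypothesis N0 : (0 < N)%N.
Hypothesis massN : forall k,
  cplx_of (N%:R ^+ k) <= iter k transfer (fun=> 1) z0 <= cplx_of (M * N%:R ^+ k).

Definition tterm F (k : nat) : C := N%:R ^- k * iter k transfer F z0.
Definition tmass (n : nat) : C := \sum_(k < n.+1) tterm (fun=> 1) k.
(** Division by the total mass instead of [n.+1] makes the mean of the constant 1 equal to 1 for
    every [n]. *)
Definition tmean F (n : nat) : C := (\sum_(k < n.+1) tterm F k) / tmass n.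

Let NC0 : (N%:R : C) != 0. Proof. by rewrite pnatr_eq0 -lt0n. Qed.

Lemma nat_cplx (n : nat) : cplx_of (n%:R : R) = n%:R.
Proof.
by apply: complexP; elim: n => // n IH; rewrite -natr1 cplx_ofD -[in RHS]natr1 ?reCD ?imCD IH.
Qed.

Lemma tterm_ge1 k : 1 <= tterm (fun=> 1) k.
Proof.
rewrite /tterm -ler_pdivrMl ?invr_gt0 ?exprn_gt0 ?ltr0n// invrK mulr1.
by rewrite -nat_cplx -cplx_ofX; case/andP: (massN k).
Qed.

Lemma tterm_leM k : tterm (fun=> 1) k <= cplx_of M.
Proof.
rewrite /tterm mulrC ler_pdivrMr ?exprn_gt0 ?ltr0n//.
by rewrite -nat_cplx -cplx_ofX -cplx_ofM; case/andP: (massN k).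
Qed.

Lemma tmass_ge n : n.+1%:R <= tmass n.
Proof.
have -> : n.+1%:R = \sum_(k < n.+1) (1 : C) by rewrite sumr_const card_ord.
by apply: ler_sum => k _; exact: tterm_ge1.
Qed.

Lemma tmass_gt0 n : 0 < tmass n.
Proof. by apply: lt_le_trans (tmass_ge n); rewrite ltr0n. Qed.

Lemma tterm_le F b k : (forall w, `|F w| <= b) -> `|tterm F k| <= b * tterm (fun=> 1) k.
Proof.
move=> Fb; rewrite /tterm normrM ger0_norm ?invr_ge0 ?exprn_ge0 ?ler0n//.
by rewrite mulrCA ler_wpM2l ?invr_ge0 ?exprn_ge0 ?ler0n// iter_transfer_le.
Qed.

Lemma tmean_le F b n : (forall w, `|F w| <= b) -> `|tmean F n| <= b.
Proof.
move=> Fb; rewrite /tmean normrM normfV (gtr0_norm (tmass_gt0 n)).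
rewrite ler_pdivrMr ?tmass_gt0// (le_trans (ler_norm_sum _ _ _))// mulr_sumr.
by apply: ler_sum => k _; exact: tterm_le.
Qed.

Lemma tmeanD F G n : tmean (fun w => F w + G w) n = tmean F n + tmean G n.
Proof.
rewrite /tmean -mulrDl -big_split; congr (_ / _); apply: eq_bigr => k _.
by rewrite /tterm iter_transferD mulrDr.
Qed.

Lemma tmeanZ c F n : tmean (fun w => c * F w) n = c * tmean F n.
Proof.
rewrite /tmean mulrA mulr_sumr; congr (_ / _); apply: eq_bigr => k _.
by rewrite /tterm iter_transferZ mulrCA.
Qed.

Lemma tmeanJ F n : tmean (fun w => (F w)^*) n = (tmean F n)^*.
Proof.
rewrite /tmean rmorphM fmorphV /= (CrealP (ger0_real (ltW (tmass_gt0 n)))).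
rewrite rmorph_sum; congr (_ / _); apply: eq_bigr => k _.
by rewrite /tterm iter_transferJ rmorphM /= fmorphV rmorphXn /= conjC_nat.
Qed.

Lemma tmean_ge0 F n : (forall w, 0 <= F w) -> 0 <= tmean F n.
Proof.
move=> F0; rewrite divr_ge0 ?(ltW (tmass_gt0 n))// sumr_ge0// => k _.
by rewrite mulr_ge0 ?invr_ge0 ?exprn_ge0 ?ler0n// iter_transfer_ge0.
Qed.

Lemma tmean_transfer F n : tmean (transfer F) n = N%:R * tmean F n +
  N%:R * (tterm F n.+1 - tterm F 0) / tmass n.
Proof.
rewrite /tmean !mulrA -mulrDl; congr (_ / _).
have tE k : tterm (transfer F) k = N%:R * tterm F k.+1.
  rewrite /tterm -iterSr iterS exprS invfM mulrA mulrA mulfV// mul1r //.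
rewrite (eq_bigr (fun k : 'I_n.+1 => N%:R * tterm F k.+1)) => [|k _]; last exact: tE.
rewrite -mulr_sumr -mulrDr; congr (_ * _).
have -> : \sum_(k < n.+1) tterm F k.+1 =
    \sum_(k < n.+2) tterm F k - tterm F 0.
  by rewrite [in RHS]big_ord_recl /= [RHS]addrC addKr.
by rewrite big_ord_recr /= addrA.
Qed.

Variable U : set_system nat.
Hypothesis UU : UltraFilter U.
Hypothesis Uoo : \oo `<=` U.

Definition tau F : C := ulim U (tmean F).

Definition bounded_cfun F := exists b : R, forall w, `|F w| <= cplx_of b.

Lemma tmean_ubdd F : bounded_cfun F -> ubdd U (tmean F).
Proof.
move=> [b Fb]; apply: (@ubdd_norm _ _ _ UU _ b); apply: nearW => n /=.
by rewrite -norm_le_of tmean_le.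
Qed.

Lemma tauD F G : bounded_cfun F -> bounded_cfun G ->
  tau (fun w => F w + G w) = tau F + tau G.
Proof.
move=> bF bG; rewrite /tau -ulimD; [|exact: tmean_ubdd..].
by congr (ulim _ _); apply/funext => n; exact: tmeanD.
Qed.

Lemma tauZ c F : bounded_cfun F -> tau (fun w => c * F w) = c * tau F.
Proof.
move=> bF; rewrite /tau -ulimZ; [|exact: tmean_ubdd..].
by congr (ulim _ _); apply/funext => n; exact: tmeanZ.
Qed.

Lemma tauJ F : bounded_cfun F -> tau (fun w => (F w)^*) = (tau F)^*.
Proof.
move=> bF; rewrite /tau -ulimJ; [|exact: tmean_ubdd..].
by congr (ulim _ _); apply/funext => n; exact: tmeanJ.
Qed.

Lemma tau_ge0 F : bounded_cfun F -> (forall w, 0 <= F w) -> 0 <= tau F.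
Proof.
move=> bF F0; apply: ulim_ge0; first exact: tmean_ubdd.
by apply: nearW => n /=; exact: tmean_ge0.
Qed.

Lemma tau1 : tau (fun=> 1) = 1.
Proof.
rewrite /tau (_ : tmean _ = fun=> 1) ?ulim_cst//.
by apply/funext => n; rewrite /tmean mulfV// gt_eqF// tmass_gt0.
Qed.

Lemma tau_le F (b : R) : (forall w, `|F w| <= cplx_of b) -> `|tau F| <= cplx_of b.
Proof.
move=> Fb.
have b0 : 0 <= b by rewrite -cplx_of_le (le_trans _ (Fb z0))//; exact: normr_ge0.
rewrite norm_le_of sqnorm_norm -[leRHS]ger0_norm// -sqrtr_sqr ler_sqrt ?sqr_ge0//.
(* The limit is taken in real and imaginary parts separately; the one-term case of the Fatou bound
   controls its modulus without losing a constant. *)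
have := @ulim_sum_sqnorm_le _ _ _ UU _ [:: tt] (fun=> tmean F) (b ^+ 2).
rewrite !big_seq1; apply=> [_|]; first by apply: tmean_ubdd; exists b.
apply: nearW => n /=; rewrite big_seq1 -cplx_of_le sqnormE cplx_ofX.
by rewrite ler_pXn2r ?nnegrE ?tmean_le// -(cplx_of0 R) cplx_of_le.
Qed.

(** By [Uoo] the ultrafilter contains all tails, so an ordinary limit is also the limit along
    [U]. *)
Lemma ulim_small (u : nat -> C) (c : R) :
  (forall n, `|u n| <= cplx_of (c / n.+1%:R)) -> ulim U u = 0.
Proof.
move=> uc.
have c0 (v : nat -> R) : (forall n, `|v n| <= c / n.+1%:R) -> ulimR U v = 0.
  move=> vc; apply: ulimR_eq; apply: (cvg_trans (G := v @ \oo)).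
    by move=> A; exact: Uoo.
  have H : (fun n => c * harmonic n) @ \oo --> (0 : R).
    by rewrite -[X in _ --> X](mulr0 c); apply: cvgM; [exact: cvg_cst|exact: cvg_harmonic].
  apply/cvgrPdist_lt => e e0; move/cvgrPdist_lt : H => /(_ e e0).
  apply: filterS => n; rewrite !sub0r !normrN; apply: le_lt_trans.
  by rewrite (le_trans (vc n))// ler_norm.
apply: complexP; rewrite ?reC0 ?imC0 ?reC_ulim ?imC_ulim; apply: c0 => n /=.
  by rewrite (le_trans (reC_norm_le _))// -norm_le_of.
by rewrite (le_trans (imC_norm_le _))// -norm_le_of.
Qed.

(* The transfer operator telescopes the averages up to two boundary terms. *)
Lemma tau_transfer F : bounded_cfun F -> tau (transfer F) = N%:R * tau F.
Proof.
move=> bF; have [b Fb] := bF.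
pose r n := N%:R * (tterm F n.+1 - tterm F 0) / tmass n.
have rc n : `|r n| <= cplx_of ((N%:R * (b * M + b * M)) / n.+1%:R).
  rewrite /r 2!normrM normfV (gtr0_norm (tmass_gt0 n)) ger0_norm ?ler0n//.
  have h1 k : `|tterm F k| <= cplx_of b * cplx_of M.
    apply: le_trans (tterm_le _ Fb) _; rewrite ler_wpM2l ?tterm_leM//.
    by rewrite (le_trans _ (Fb z0)).
  rewrite ler_pdivrMr ?tmass_gt0//.
  apply: (@le_trans _ _ (N%:R * (cplx_of b * cplx_of M + cplx_of b * cplx_of M))).
    by rewrite ler_wpM2l ?ler0n// (le_trans (ler_normB _ _))// lerD.
  rewrite cplx_ofM cplx_ofV cplx_ofM nat_cplx cplx_ofD !cplx_ofM nat_cplx.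
  rewrite -[leRHS]mulrA ler_peMr//.
    rewrite mulr_ge0 ?ler0n// addr_ge0// (le_trans _ (h1 0%N))//.
  by rewrite mulrC ler_pdivlMr ?ltr0n// mul1r tmass_ge.
have ur : ubdd U r.
  apply: (@ubdd_norm _ _ _ UU _ (N%:R * (b * M + b * M))); apply: nearW => n /=.
  rewrite -norm_le_of (le_trans (rc n))// cplx_of_le ler_pdivrMr ?ltr0n//.
  rewrite ler_peMr ?ler1n//.
  have := le_trans (normr_ge0 _) (rc 0%N); rewrite -(cplx_of0 R) cplx_of_le.
  by rewrite divr1.
have E : tmean (transfer F) = fun n => N%:R * tmean F n + r n.
  by apply/funext => n; exact: tmean_transfer.
rewrite /tau E ulimD//; last by apply: ubddZ; exact: tmean_ubdd.
by rewrite ulimZ; [rewrite (ulim_small rc) addr0|exact: tmean_ubdd].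
Qed.

(** * The functional on operators given by their diagonals *)

Local Notation B := (bop_cstar R Z).
Local Notation psi := (psi_rep fibreK (R := R)).
Local Notation pi := (@pi_rep R Z).

Definition diag (T : bop R Z) (w : Z) : C := T (delta R w) w.

Definition diag_state (T : B) : C := tau (diag T).

Lemma diag_le (T : bop R Z) w : `|diag T w| <= cplx_of (opn T).
Proof.
by rewrite norm_le_of (le_trans (norm_coord_le _ _ _))// hn_delta mulr1.
Qed.

Lemma diag_bounded T : bounded_cfun (diag T).
Proof. by exists (opn T) => w; exact: diag_le. Qed.

Lemma diag_state_linear : linear (diag_state : B -> C^o).
Proof.
move=> c T T'; rewrite /diag_state.
rewrite -[RHS]/(c * tau (diag T) + tau (diag T')).
have bc : bounded_cfun (fun w => c * diag T w) by exact: (diag_bounded (c *: T : bop R Z)).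
rewrite -tauZ; last exact: diag_bounded.
by rewrite -tauD//; exact: diag_bounded.
Qed.

Lemma diag_state_ge0 T : 0 <= diag_state (T^† ** T).
Proof.
apply: tau_ge0 => [|w]; first exact: diag_bounded.
rewrite /diag -ip_delta bop_mulE -bop_starP ip_sqhn.
by rewrite -(cplx_of0 R) cplx_of_le sqhn_ge0.
Qed.

Lemma diag_state_le T : `|diag_state T| <= `|T|.
Proof. by apply: tau_le => w; exact: diag_le. Qed.

Lemma diag_stateJ T : diag_state (T^†) = (diag_state T)^*.
Proof.
rewrite /diag_state -tauJ; last exact: diag_bounded.
congr tau; apply/funext => w.
by rewrite /diag -!ip_delta -bop_starP ipJ.
Qed.

Lemma diag_state1 : diag_state (pi (cf1 R Z)) = 1.
Proof.
rewrite -tau1; congr tau; apply/funext => w.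
by rewrite /diag pi_repE cf1E mul1r deltaE eqxx.
Qed.

(** [pi a] is a diagonal operator, so both products have the diagonal [a w * diag T w]. *)
Lemma diag_state_pi a T : diag_state (pi a ** T) = diag_state (T ** pi a).
Proof.
congr tau; apply/funext => w; rewrite /diag !bop_mulE pi_repE.
have -> : (pi a : bop R Z) (delta R w) = a w *: delta R w.
  apply: l2P => v; rewrite pi_repE l2ZE !deltaE.
  by case: eqVneq => [->|]; rewrite ?mulr0.
by rewrite (bopZ (bop_is_bop T)).
Qed.

Lemma diag_state_psi x T :
  diag_state (T ** psi x) = N%:R * diag_state (psi x ** T).
Proof.
rewrite /diag_state -tau_transfer; last exact: diag_bounded.
congr tau; apply/funext => w; rewrite /diag /transfer bop_mulE.
(* [psi x] spreads a basis vector over its fibre; reading off the diagonal of [T ** psi x] at [w]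
   therefore sums over that fibre, which is the transfer operator. *)
have -> : (psi x : bop R Z) (delta R w) = \sum_(v <- fibre w) x v *: delta R v.
  apply: l2P => u; rewrite psi_repE l2_sumE deltaE.
  under eq_bigr do rewrite l2ZE deltaE.
  have [uw|uw] := boolP (u \in fibre w); last first.
    rewrite big1_seq; first by move: uw; rewrite mem_fibre => /negbTE ->; rewrite mulr0.
    move=> v /andP[_ vw]; case: eqVneq => [e|_]; last by rewrite mulr0.
    by rewrite e vw in uw.
  have := uw; rewrite mem_fibre => ->.
  rewrite (big_fsetD1 u)//= eqxx big1_seq ?addr0// => v.
  by rewrite !inE => /andP[_ /andP[vu _]]; rewrite eq_sym (negbTE vu) mulr0.
rewrite (bop_sum (bop_is_bop T)) l2_sumE; apply: eq_big_seq => v.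
rewrite mem_fibre => /eqP hv.
by rewrite (bopZ (bop_is_bop T)) l2ZE bop_mulE psi_repE hv.
Qed.

End Transfer.

(** * The complex exponential *)

Section ComplexExponential.
Variable R : realType.
Local Notation C := (Cplx R).

Lemma is_derive_approx (f : R -> R) (d : R) : is_derive (0 : R) (1 : R) f d ->
  forall e : R, 0 < e ->
    exists2 D : R, 0 < D & forall t, `|t| < D -> `|f t - f 0 - d * t| <= e * `|t|.
Proof.
move=> [df dE] e e0.
have cd : h^-1 *: (f (h *: 1 + 0) - f 0) @[h --> (0 : R)^'] --> d.
  by rewrite -dE; exact: df.
move/cvgrPdist_le : cd => /(_ e e0).
rewrite near_withinE => /nbhs_ballP [D /= D0 HD]; exists D => // t tD.
have [->|t0] := eqVneq t 0; first by rewrite subrr mulr0 subr0 normr0 mulr0.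
have := HD t; rewrite /ball /= sub0r normrN => /(_ tD t0).
rewrite /GRing.scale /= mulr1 addr0 => H.
have -> : f t - f 0 - d * t = - (d - t^-1 * (f t - f 0)) * t.
  rewrite mulNr mulrBl opprB mulrAC mulVf// mul1r //.
by rewrite normrM normrN ler_wpM2r.
Qed.

(** The function e^(irz), the entire extension of t |-> [expi (r * t)]. *)
Definition cexp (r : R) (z : C) : C :=
  cplx_of (expR (- r * imC z)) * expi (r * reC z).

Lemma expiD (s t : R) : expi (s + t) = expi s * expi t.
Proof.
apply: complexP; rewrite ?reCM ?imCM /reC /imC /expi /=.
  exact: cosD.
by rewrite sinD addrC.
Qed.

Lemma reC_expi (t : R) : reC (expi t) = cos t. Proof. by []. Qed.
Lemma imC_expi (t : R) : imC (expi t) = sin t. Proof. by []. Qed.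
Lemma reC_mk (a b : R) : reC (a +i* b)%C = a. Proof. by []. Qed.
Lemma imC_mk (a b : R) : imC (a +i* b)%C = b. Proof. by []. Qed.

Lemma expi0 : expi 0 = 1 :> C.
Proof. by rewrite /expi cos0 sin0. Qed.

Lemma norm_expi t : `|expi t| = 1 :> C.
Proof.
rewrite -normC_reC sqnorm_norm /sqnorm /expi /reC /imC /= cos2Dsin2 sqrtr1 //.
Qed.

Lemma cexpD r z w : cexp r (z + w) = cexp r z * cexp r w.
Proof.
rewrite /cexp reCD imCD !mulrDr expRD expiD cplx_ofM; ring.
Qed.

Lemma reC_norm_triangle (z : C) : reC `|z| <= `|reC z| + `|imC z|.
Proof.
rewrite sqnorm_norm -[leRHS]ger0_norm ?addr_ge0// -sqrtr_sqr ler_sqrt ?sqr_ge0//.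
rewrite sqrrD !real_normK ?num_real// /sqnorm addrAC lerDl.
by rewrite mulrn_wge0// mulr_ge0.
Qed.

(** The first-order expansion of e^(p+iq) at 0, assembled from the real derivatives of exp, sin and
    cos. *)
Lemma cexp_approx (e : R) : 0 < e -> exists2 D : R, 0 < D &
  forall p q : R, `|p| < D -> `|q| < D ->
    reC `|cplx_of (expR p) * expi q - 1 - (p +i* q)%C| <= e * (`|p| + `|q|).
Proof.
(* The errors in the two coordinates add up to k|p| + 5k|q|, which 8k(|p| + |q|) covers. *)
move=> e0; set k := e / 8; have k0 : 0 < k by rewrite divr_gt0.
have ek : e = 8 * k by rewrite /k mulrC divfK.
have [D1 D10 H1] := is_derive_approx (is_derive_expR 0) k0.
have [D2 D20 H2] := is_derive_approx (is_derive_sin 0) k0.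
have [D3 D30 H3] := is_derive_approx (is_derive_cos 0) k0.
(* [m] bounds |e^p - 1|: the bound 1 keeps e^p below 2, the bound [k] absorbs the cross term (e^p -
   1) q. As |e^p - 1| <= (1 + k)|p|, the radius m / (1 + k) achieves it. *)
pose m := Num.min 1 k; have m0 : 0 < m by rewrite lt_min ltr01.
have k1 : 0 < 1 + k by rewrite addr_gt0.
pose D := Num.min (Num.min D1 D2) (Num.min D3 (m / (1 + k))).
exists D => [|p q].
  by rewrite !lt_min D10 D20 D30 divr_gt0.
rewrite !lt_min => /andP[/andP[p1 p2] /andP[p3 p4]] /andP[/andP[q1 q2] /andP[q3 q4]].
have h1 : `|expR p - 1 - p| <= k * `|p|.
  by have := H1 p p1; rewrite expR0 mul1r.
have h2 : `|sin q - q| <= k * `|q|.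
  by have := H2 q q2; rewrite sin0 cos0 mul1r subr0.
have h3 : `|cos q - 1| <= k * `|q|.
  by have := H3 q q3; rewrite sin0 cos0 oppr0 mul0r subr0.
have h4 : `|expR p - 1| <= m.
  have -> : expR p - 1 = (expR p - 1 - p) + p by rewrite subrK.
  apply: le_trans (ler_normD _ _) _.
  apply: (@le_trans _ _ ((1 + k) * `|p|)); first by rewrite mulrDl mul1r addrC lerD2l.
  by rewrite mulrC -ler_pdivlMr// ltW.
have [m1 mk] : m <= 1 /\ m <= k by rewrite !ge_min !lexx orbT.
have h5 : `|expR p| <= 2.
  have -> : expR p = (expR p - 1) + 1 by rewrite subrK.
  by apply: le_trans (ler_normD _ _) _; rewrite normr1; move: h4 m1; lra.
apply: le_trans (reC_norm_triangle _) _.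
rewrite !reCB !imCB reCM imCM reC_of imC_of !mul0r subr0 addr0.
rewrite reC_expi imC_expi reC_mk imC_mk -[reC 1]/(1 : R) -[imC 1]/(0 : R) subr0.
have r1 : `|expR p * cos q - 1 - p| <= k * `|p| + 2 * (k * `|q|).
  have -> : expR p * cos q - 1 - p = (expR p - 1 - p) + expR p * (cos q - 1) by ring.
  apply: le_trans (ler_normD _ _) _; rewrite normrM.
  by apply: lerD => //; rewrite ler_pM.
have r2 : `|expR p * sin q - q| <= 2 * (k * `|q|) + k * `|q|.
  have -> : expR p * sin q - q = expR p * (sin q - q) + (expR p - 1) * q by ring.
  apply: le_trans (ler_normD _ _) _; rewrite !normrM.
  by apply: lerD; [rewrite ler_pM|rewrite ler_wpM2r// (le_trans h4)].
have kp : 0 <= k * `|p| by rewrite mulr_ge0// ltW.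
have kq : 0 <= k * `|q| by rewrite mulr_ge0// ltW.
move: r1 r2 kp kq; rewrite ek mulrDr -!mulrA.
set X := k * `|p|; set Y := k * `|q|; lra.
Qed.

Lemma cexp_cvg0 r :
  (fun h : C => h^-1 * (cexp r h - 1)) @ (0 : C)^' --> 'i * cplx_of r.
Proof.
apply/cvgrPdist_le => e' e'0; set e := reC e'.
have ee : e' = cplx_of e by rewrite /e cplx_of_reC// ltW.
have e0 : 0 < e by rewrite -cplx_of_lt -ee.
have r1 : 0 < 2 * `|r| + 1 by rewrite ltr_wpDl ?mulr_ge0.
(* For p + iq = irh both |p| and |q| are at most |r||h|, so |p| + |q| <= (2|r| + 1)|h|; the summand
   1 keeps the divisor positive when r = 0. *)
have [D D0 HD] := @cexp_approx (e / (2 * `|r| + 1)) (divr_gt0 e0 r1).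
rewrite near_withinE; apply/nbhs_ballP.
exists (cplx_of (D / (`|r| + 1))) => /=.
  by rewrite -(cplx_of0 R) cplx_of_lt divr_gt0// ltr_wpDl.
move=> h; rewrite -ball_normE /ball_ /= sub0r normrN => hD h0.
rewrite norm_lt_of in hD.
have hE : h^-1 * h = 1 by rewrite mulVf.
have -> : 'i * cplx_of r - h^-1 * (cexp r h - 1) =
    - (h^-1 * (cexp r h - 1 - 'i * cplx_of r * h)).
  by rewrite [in RHS]mulrBr mulrCA hE mulr1 opprB.
rewrite normrN normrM normfV ee.
have hp : 0 < `|h| by rewrite normr_gt0.
rewrite mulrC ler_pdivrMr// -(normC_reC h) -cplx_ofM norm_le_of.
set t := reC `|h| in hD *.
have t0 : 0 <= t by rewrite /t sqnorm_norm sqrtr_ge0.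
have tD : `|r| * t < D.
  apply: le_lt_trans (_ : (`|r| + 1) * t < D); first by rewrite mulrDl lerDl mul1r.
  by rewrite mulrC -ltr_pdivlMr// ltr_wpDl.
have p1 : `|- r * imC h| <= `|r| * t.
  by rewrite normrM normrN ler_wpM2l// imC_norm_le.
have q1 : `|r * reC h| <= `|r| * t.
  by rewrite normrM ler_wpM2l// reC_norm_le.
have := HD _ _ (le_lt_trans p1 tD) (le_lt_trans q1 tD).
have -> : ((- r * imC h) +i* (r * reC h))%C = 'i * cplx_of r * h :> C.
  have ii : ('i : C) = (0 +i* 1)%C by [].
  apply: complexP; rewrite ii !(reCM, imCM) reC_of imC_of.
    by rewrite !reC_mk !imC_mk; ring.
  by rewrite !reC_mk !imC_mk; ring.
move=> /le_trans; apply.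
rewrite mulrAC ler_pdivrMr// -mulrA ler_wpM2l ?(ltW e0)//.
apply: le_trans (lerD p1 q1) _.
by rewrite mulrDr mulr1 -mulr2n -[leLHS]mulr_natl mulrA [t * _]mulrC lerDl.
Qed.

Lemma cexp_entire (A : cstarAlg R) (r : R) (a : A) : entire (fun z => cexp r z *: a).
Proof.
move=> z; apply/cvg_ex; exists (('i * cplx_of r * cexp r z) *: a).
have -> : (fun h : C => h^-1 *: (((fun z => cexp r z *: a) \o shift z) (h *: (1 : C)) -
    cexp r z *: a)) = (fun h : C => (h^-1 * (cexp r h - 1) * cexp r z) *: a).
  apply/funext => h; have h1 : h *: (1 : C) = h := mulr1 h.
  by rewrite /= h1 -scalerBl scalerA cexpD -[in RHS]mulrA mulrBl mul1r.
by apply: cvgZr_tmp; apply: cvgM; [exact: cexp_cvg0|exact: cvg_cst].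
Qed.

Lemma cexp_real r t : cexp r (cplx_of t) = expi (r * t).
Proof. by rewrite /cexp reC_of imC_of mulr0 expR0 mul1r. Qed.

Lemma cexp_imag r b : cexp r (0 +i* b)%C = cplx_of (expR (- r * b)).
Proof.
by rewrite /cexp reC_mk imC_mk mulr0 expi0 mulr1.
Qed.

End ComplexExponential.

(** * KMS states *)

Section Density.
Variables (R : realType) (A : cstarAlg R).
Local Notation C := (Cplx R).
Implicit Types (D : set A) (a b : A).

Lemma closed_fixed (f : A -> A) : continuous f -> closed [set a | f a = a].
Proof.
move=> cf; have -> : [set a | f a = a] = (fun a => f a - a) @^-1` [set 0].
  apply/seteqP; split=> a /= => [->|/eqP]; first by rewrite subrr.
  by rewrite subr_eq0 => /eqP.
apply: preimage_closed => [a _|].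
  by apply: cvgB; [exact: cf|exact: cvg_id].
exact/accessible_closed_set1/hausdorff_accessible/norm_hausdorff.
Qed.

Lemma mull_continuous a : continuous (fun b => a ** b).
Proof. by move=> b; apply: cs_cvgM; [exact: cvg_cst|exact: cvg_id]. Qed.
Lemma mulr_continuous a : continuous (fun b => b ** a).
Proof. by move=> b; apply: cs_cvgM; [exact: cvg_id|exact: cvg_cst]. Qed.
Lemma star_continuous : continuous (@cs_star R A).
Proof. by move=> b; apply: cs_cvg_star; exact: cvg_id. Qed.

Lemma closure_image_sub D (f : A -> A) : continuous f ->
  (forall a, D a -> closure D (f a)) -> forall a, closure D a -> closure D (f a).
Proof.
move=> cf Df a Da.
have cl : closed (f @^-1` closure D).
  by apply: preimage_closed => [b _|]; [exact: cf|exact: closed_closure].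
by rewrite -[_ (f a)]/((f @^-1` closure D) a) ((closure_id _).1 cl); apply: closureS Da => b /Df.
Qed.

(** The operations are extended to the closure one variable at a time, so continuity in each
    variable separately suffices. *)
Lemma closure_star_subalg D : star_subalg D -> star_subalg (closure D).
Proof.
move=> [D0 DZD DM Ds]; have sub := @subset_closure _ D; split.
- exact: sub.
- move=> c a b clDa clDb.
  apply: (@closure_image_sub D (fun b => c *: a + b)) => // [x|{clDb}b Db].
    by apply: cvgD; [exact: cvg_cst|exact: cvg_id].
  apply: (@closure_image_sub D (fun a => c *: a + b)) => // [x|{clDa}a Da].
    apply: cvgD; [|exact: cvg_cst].
    by apply: cvgZl_tmp; exact: cvg_id.
  exact/sub/DZD.
- move=> a b clDa clDb.
  apply: (@closure_image_sub D (fun b => a ** b)) => // [|{clDb}b Db].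
    exact: mull_continuous.
  apply: (@closure_image_sub D (fun a => a ** b)) => // [|{clDa}a Da].
    exact: mulr_continuous.
  exact/sub/DM.
- apply: closure_image_sub; first exact: star_continuous.
  by move=> a Da; exact/sub/Ds.
Qed.

Lemma contractive_continuous (B : cstarAlg R) (f : A -> B) :
  linear f -> (forall a, `|f a| <= `|a|) -> continuous f.
Proof.
move=> lf cf a; apply/cvgrPdist_lt => e e0.
have fB x y : f (x - y) = f x - f y.
  by rewrite -[- y]scaleN1r addrC lf scaleN1r addrC.
have := @cvg_id _ (nbhs a); move/cvgrPdist_lt => /(_ e e0).
by apply: filterS => x; rewrite -fB; apply: le_lt_trans.
Qed.

End Density.

(** * KMS states on the Cuntz-Pimsner algebra *)

Section KMS.
Variables (R : realType) (Z : lhSystem) (K : nat).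
Local Notation C := (Cplx R).
Local Notation CZ := (cfun R Z).
Hypothesis fibreK : forall z : Z, (#|` fibre z| <= K)%N.
Variables (J : finType) (F : J -> CZ).
Hypothesis frame : forall w v : Z, lh_map w = lh_map v ->
  \sum_j F j w * (F j v)^* = (w == v)%:R.
Variables (N : nat) (z0 : Z) (M : R).
Hypothesis N0 : (0 < N)%N.
Hypothesis massN : forall k, cplx_of (N%:R ^+ k)
  <= iter k (@transfer R Z) (fun=> 1) z0 <= cplx_of (M * N%:R ^+ k).

Variables (T : cstarAlg R) (iX : CZ -> T) (iA : CZ -> T).
Hypothesis hT : toeplitz_algebra iX iA.
Variables (gamma : C -> T -> T) (hgamma : gauge_action iX iA gamma).
Variables (O : cstarAlg R) (q : T -> O).
Hypothesis hO : cuntz_pimsner_algebra iX iA q.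
Variables (alpha : R -> O -> O) (halpha : gauge_dynamics gamma q alpha).

Local Notation e := (iA (cf1 R Z)).
Local Notation B := (bop_cstar R Z).

(** The elements fixed by [e] on both sides form a closed *-subalgebra that contains the
    generators. *)
Lemma toeplitz_unit : cs_is_unit e.
Proof.
have rep := toeplitz_rep hT.
have c1 a : cfmul (cf1 R Z) a = a by apply: cfunP => w; rewrite cfmulE mul1r.
have c1' a : cfmul a (cf1 R Z) = a by apply: cfunP => w; rewrite cfmulE mulr1.
have ee : e ** e = e by rewrite -(rep_pi_mul rep) c1.
have es : e^† = e.
  rewrite -(rep_pi_conj rep); congr iA; apply: cfunP => w.
  by rewrite cfconjE cf1E conjC1.
pose D : set T := [set t | e ** t = t] `&` [set t | t ** e = t].
suff DT : D = setT by move=> t; have : D t by rewrite DT.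
apply: (toeplitz_gen hT).
- split.
  + by split; rewrite /= ?cs_mul0r ?cs_mul0l.
  + move=> c a b [/= a1 a2] [b1 b2]; split => /=.
      by rewrite cs_mulDr cs_scaleAr a1 b1.
    by rewrite cs_mulDl cs_scaleAl a2 b2.
  + move=> a b [/= a1 a2] [b1 b2]; split => /=.
      by rewrite cs_mulA a1.
    by rewrite -cs_mulA b2.
  + move=> a [/= a1 a2]; split => /=.
      by rewrite -{1}es -cs_starM a2.
    by rewrite -{1}es -cs_starM a1.
- apply: closedI; apply: closed_fixed; [exact: mull_continuous|exact: mulr_continuous].
- move=> _ [[x _ <-]|[a _ <-]].
    split => /=.
      by rewrite -(rep_lact rep); congr iX; apply: cfunP => w; rewrite lactE mul1r.
    by rewrite -(rep_ract rep); congr iX; apply: cfunP => w; rewrite ractE mulr1.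
  by split; rewrite /= -(rep_pi_mul rep) ?c1 ?c1'.
Qed.

Lemma cp_surjE (b : O) : exists a, q a = b.
Proof.
have : range q b by rewrite (cp_surj hO).
by move=> [a _ <-]; exists a.
Qed.

Lemma cp_unit : cs_is_unit (q e).
Proof.
move=> b; have [a <-] := cp_surjE b.
by rewrite -!(star_hom_mul (cp_quotient hO)) (proj1 (toeplitz_unit a)) (proj2 (toeplitz_unit a)).
Qed.

Lemma q_continuous : continuous q.
Proof.
apply: contractive_continuous; first exact: star_hom_linear (cp_quotient hO).
exact: star_hom_contractive (cp_quotient hO) toeplitz_unit.
Qed.

(** Generation is known in [T], so the closure of [D] is pulled back along [q]; that this preimage
    is closed is the continuity of [q]. *)
Lemma dense_of_generators (D : set O) : star_subalg D ->
  (forall x, D (q (iX x))) -> (forall a, D (q (iA a))) -> dense D.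
Proof.
move=> sD DX DA.
have cD := closure_star_subalg sD; have hq := cp_quotient hO.
have qT : q @^-1` closure D = setT.
  apply: (toeplitz_gen hT).
  - split=> /=.
    + by rewrite (star_hom0 hq); exact: star_subalg0 cD.
    + by move=> c a b; rewrite (star_hom_linear hq); exact: (star_subalgZD cD).
    + by move=> a b; rewrite (star_hom_mul hq); exact: (star_subalgM cD).
    + by move=> a; rewrite (star_hom_star hq); exact: (star_subalg_star cD).
  - apply: preimage_closed => [a _|]; first exact: q_continuous.
    exact: closed_closure.
  - by move=> _ [[x _ <-]|[a _ <-]]; apply: subset_closure.
move=> V [v Vv] oV; have [a qa] := cp_surjE v.
have : (q @^-1` closure D) a by rewrite qT.
rewrite /= qa => /(_ V); rewrite setIC; apply.
exact: open_nbhs_nbhs.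
Qed.

Lemma alpha_star_hom t : star_hom (alpha t).
Proof.
have [hg _ _] := hgamma (norm_expi t).
have hq := cp_quotient hO.
split.
- move=> c a b; have [a' <-] := cp_surjE a; have [b' <-] := cp_surjE b.
  rewrite -(star_hom_linear hq) !halpha (star_hom_linear hg).
  by rewrite (star_hom_linear hq).
- move=> a b; have [a' <-] := cp_surjE a; have [b' <-] := cp_surjE b.
  rewrite -(star_hom_mul hq) !halpha (star_hom_mul hg).
  by rewrite (star_hom_mul hq).
- move=> a; have [a' <-] := cp_surjE a.
  by rewrite -(star_hom_star hq) !halpha (star_hom_star hg) (star_hom_star hq).
Qed.

Lemma alphaX t x : alpha t (q (iX x)) = expi t *: q (iX x).
Proof.
have [_ gX _] := hgamma (norm_expi t).
by rewrite halpha gX (star_homZ (cp_quotient hO)).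
Qed.

Lemma alphaA t a : alpha t (q (iA a)) = q (iA a).
Proof. by have [_ _ gA] := hgamma (norm_expi t); rewrite halpha gA. Qed.

(** * Homogeneous elements and the KMS condition *)

Section State.
Variable phi : O -> C.
Hypothesis phi_linear : linear (phi : O -> C^o).
Hypothesis phiJ : forall b, phi (b^†) = (phi b)^*.
Hypothesis phiX : forall x b, phi (b ** q (iX x)) = N%:R * phi (q (iX x) ** b).
Hypothesis phiA : forall a b, phi (b ** q (iA a)) = phi (q (iA a) ** b).

Lemma phiD a b : phi (a + b) = phi a + phi b.
Proof. by have := phi_linear 1 a b; rewrite !scale1r. Qed.
Lemma phi0 : phi 0 = 0.
Proof. by have := phi_linear (-1) 0 0; rewrite scaler0 addr0 scaleN1r addNr. Qed.
Lemma phiZ (c : C) a : phi (c *: a) = c * phi a.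
Proof. by have := phi_linear c a 0; rewrite phi0 !addr0. Qed.

(** Two degrees in one: the weight under the gauge action and the exponent in the twisted trace
    relation. Tying them to the same [n] lets the KMS factor be read off from the weight. *)
Definition homogeneous (n : int) (a : O) :=
  (forall t, alpha t a = expi t ^ n *: a) /\
  (forall b, phi (b ** a) = N%:R ^ n * phi (a ** b)).

Inductive graded_sum : O -> Prop :=
| graded_sum0 : graded_sum 0
| graded_sumD n a b : homogeneous n a -> graded_sum b -> graded_sum (a + b).

Let expi_neq0 t : expi t != 0 :> C.
Proof. by rewrite -normr_eq0 norm_expi oner_eq0. Qed.
Let NC0 : (N%:R : C) != 0. Proof. by rewrite pnatr_eq0 -lt0n. Qed.

Lemma homogeneousZ n (c : C) a : homogeneous n a -> homogeneous n (c *: a).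
Proof.
move=> [aa ak]; split=> [t|b].
  by rewrite (star_homZ (alpha_star_hom t)) aa !scalerA mulrC.
by rewrite cs_scaleAr cs_scaleAl !phiZ ak mulrCA.
Qed.

Lemma homogeneousM n m a b : homogeneous n a -> homogeneous m b ->
  homogeneous (n + m) (a ** b).
Proof.
move=> [aa ak] [ba bk]; split=> [t|c].
  rewrite (star_hom_mul (alpha_star_hom t)) aa ba cs_scaleAl cs_scaleAr scalerA.
  by rewrite expfzDr.
rewrite cs_mulA bk cs_mulA ak mulrA -cs_mulA; congr (_ * _).
by rewrite mulrC expfzDr.
Qed.

Lemma conjC_expz (z : C) n : (z ^ n)^* = z^* ^ n.
Proof.
case: n => k; first exact: rmorphXn.
by rewrite NegzE -!exprnN fmorphV rmorphXn.
Qed.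

(** Conjugating the relation for [phi (b^† ** a)] reverses the products: [phi (a^† ** b)] is N^n
    [phi (b ** a^†)], and solving for the latter gives the exponent -n. *)
Lemma homogeneous_star n a : homogeneous n a -> homogeneous (- n) (a^†).
Proof.
move=> [aa ak]; split=> [t|b].
  rewrite (star_hom_star (alpha_star_hom t)) aa cs_starZ; congr (_ *: _).
  have u1 : (expi t)^* = (expi t)^-1 :> C.
    by apply: (mulIf (expi_neq0 t)); rewrite mulVf// mulrC -normCK norm_expi expr1n.
  by rewrite conjC_expz u1 exprz_inv.
have -> : phi (a^† ** b) = N%:R ^ n * phi (b ** a^†).
  rewrite -[b in LHS]cs_starK -cs_starM phiJ ak rmorphM /= -phiJ cs_starM cs_starK.
  by congr (_ * _); rewrite conjC_expz conjC_nat.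
by rewrite mulrA -expfzDr// addNr expr0z mul1r.
Qed.

Lemma graded_sum_homogeneous n a : homogeneous n a -> graded_sum a.
Proof. by move=> na; rewrite -[a]addr0; apply: graded_sumD na graded_sum0. Qed.

Lemma graded_sum_add a b : graded_sum a -> graded_sum b -> graded_sum (a + b).
Proof.
move=> ga gb; elim: ga => [|n x y nx _ IH]; first by rewrite add0r.
by rewrite -addrA; exact: graded_sumD nx IH.
Qed.

Lemma graded_sumZ (c : C) a : graded_sum a -> graded_sum (c *: a).
Proof.
elim=> [|n x y nx _ IH]; first by rewrite scaler0; exact: graded_sum0.
by rewrite scalerDr; apply: graded_sumD IH; exact: homogeneousZ nx.
Qed.

Lemma graded_sum_mul a b : graded_sum a -> graded_sum b -> graded_sum (a ** b).
Proof.
move=> ga gb; elim: ga => [|n x y nx _ IH].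
  by rewrite cs_mul0l; exact: graded_sum0.
rewrite cs_mulDl; apply: graded_sum_add IH.
elim: gb => [|m u v mu _ IH]; first by rewrite cs_mul0r; exact: graded_sum0.
by rewrite cs_mulDr; apply: graded_sumD IH; exact: homogeneousM nx mu.
Qed.

Lemma graded_sum_star a : graded_sum a -> graded_sum (a^†).
Proof.
elim=> [|n x y nx _ IH]; first by rewrite cs_star0; exact: graded_sum0.
by rewrite cs_starD; apply: graded_sumD IH; exact: homogeneous_star nx.
Qed.

Lemma graded_sum_alpha t a : graded_sum a -> graded_sum (alpha t a).
Proof.
elim=> [|n x y nx _ IH]; first by rewrite (star_hom0 (alpha_star_hom t)); exact: graded_sum0.
rewrite (star_homD (alpha_star_hom t)); apply: graded_sumD IH.
by rewrite (proj1 nx t); exact: homogeneousZ nx.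
Qed.

Lemma graded_sum_subalg : star_subalg graded_sum.
Proof.
split.
- exact: graded_sum0.
- by move=> c a b ga gb; apply: graded_sum_add gb; exact: graded_sumZ.
- exact: graded_sum_mul.
- exact: graded_sum_star.
Qed.

Lemma homogeneousX x : homogeneous 1 (q (iX x)).
Proof. by split=> [t|b]; rewrite ?expr1z ?alphaX// phiX. Qed.

Lemma homogeneousA a : homogeneous 0 (q (iA a)).
Proof. by split=> [t|b]; rewrite ?expr0z ?alphaA ?scale1r// phiA mul1r. Qed.

Lemma exp_law_int (L : fieldType) (f : R -> L) (n : int) (t : R) :
  f 0 = 1 -> (forall s u, f (s + u) = f s * f u) -> f (n%:~R * t) = f t ^ n.
Proof.
move=> f0 fD.
have fnat k s : f (k%:R * s) = f s ^+ k.
  elim: k => [|k IH]; first by rewrite mul0r f0.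
  by rewrite -natr1 mulrDl mul1r fD IH exprSr.
have fN s : f (- s) = (f s)^-1.
  have : f (- s) * f s = 1 by rewrite -fD addNr.
  have [->|fs0] := eqVneq (f s) 0; first by rewrite mulr0 => /esym/eqP; rewrite oner_eq0.
  by move=> H; apply: (mulIf fs0); rewrite H mulVf.
case: n => k; first by rewrite -exprnP -fnat.
by rewrite NegzE mulrNz mulNr fN -exprnN -fnat.
Qed.

(** A component of degree n extends by the factor e^(inz). The relation holds against every [b],
    which lets the induction treat one component at a time. *)
Lemma graded_sum_analytic a : graded_sum a ->
  exists2 G : C -> O, analytic_extension alpha a G &
    forall b, phi (a ** b) = phi (b ** G (0 +i* ln N%:R)%C).
Proof.
elim=> [|n x y [nx xk] _ [G [Ge Gt] Gk]].
  exists (fun=> 0); last by move=> b; rewrite cs_mul0l cs_mul0r.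
  split=> [z|t]; first exact: derivable_cst.
  by rewrite (star_hom0 (alpha_star_hom t)).
exists (fun z => cexp n%:~R z *: x + G z).
  split=> [z|t]; first by apply: derivableD; [exact: cexp_entire|exact: Ge].
  rewrite cexp_real (@exp_law_int C (@expi R) n t (expi0 R)); last exact: expiD.
  by rewrite (star_homD (alpha_star_hom t)) nx Gt.
move=> b; rewrite cs_mulDl cs_mulDr !phiD Gk; congr (_ + _).
rewrite cs_scaleAr phiZ xk mulrA cexp_imag.
(* At z = i ln N the factor e^(inz) is N^-n; it cancels the N^n of the trace relation. *)
suff -> : cplx_of (expR (- n%:~R * ln N%:R)) * N%:R ^ n = 1 :> C by rewrite mul1r.
rewrite -mulrNz (@exp_law_int C (fun s => cplx_of (expR s))); first last.
- by move=> s u; rewrite expRD cplx_ofM.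
- by rewrite expR0.
by rewrite lnK ?posrE ?ltr0n// nat_cplx -expfzDr// addNr expr0z.
Qed.

Hypothesis phi_ge0 : forall a, 0 <= phi (a^† ** a).
Hypothesis phi_le : forall a, `|phi a| <= `|a|.
Hypothesis phi1 : phi (q e) = 1.

Lemma kms_of_functional : kms_state alpha (ln N%:R) phi.
Proof.
split.
  split=> //.
  have e1 : `|q e| <= 1.
    have := norm_unit_image (cp_quotient hO) toeplitz_unit; exact.
  have ub : ubound [set complex.Re `|phi a| | a in [set a : O | `|a| <= 1]] 1.
    move=> _ [a /= a1 <-]; suff : reC `|phi a| <= 1 by [].
    by rewrite -norm_le_of; exact: le_trans (phi_le a) a1.
  have in1 : [set complex.Re `|phi a| | a in [set a : O | `|a| <= 1]] 1.
    by exists (q e) => //; rewrite phi1 normr1.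
  apply/eqP; rewrite eq_le; apply/andP; split.
    by apply: ge_sup => //; exists 1.
  by apply: ub_le_sup => //; exists 1.
exists graded_sum; split.
- exact: graded_sum_subalg.
- apply: dense_of_generators; first exact: graded_sum_subalg.
    by move=> x; exact: graded_sum_homogeneous (homogeneousX x).
  by move=> a; exact: graded_sum_homogeneous (homogeneousA a).
- exact: graded_sum_alpha.
- by move=> a /graded_sum_analytic [G Ga Gk]; exists G.
Qed.

End State.

Lemma kms_exists : exists phi : O -> C, kms_state alpha (ln N%:R) phi.
Proof.
have [U [UU Uoo]] := ultraFilterLemma eventually_filter.
(* Covariance lets the l^2 representation factor through [O]; the state is the diagonal functional
   composed with [rho]. *)
have [rho hr [rX rA]] := cp_univ hO (l2_representation R fibreK) (l2_covariant fibreK frame).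
have rXE x : rho (q (iX x)) = psi_rep fibreK x by rewrite -rX.
have rAE a : rho (q (iA a)) = pi_rep a by rewrite -rA.
pose phi (a : O) : C := diag_state N z0 U (rho a).
exists phi; apply: kms_of_functional.
- move=> c a b; rewrite /phi (star_hom_linear hr).
  exact: (@diag_state_linear).
- by move=> b; rewrite /phi (star_hom_star hr); exact: diag_stateJ.
- move=> x b; rewrite /phi !(star_hom_mul hr) rXE; exact: diag_state_psi.
- by move=> a b; rewrite /phi !(star_hom_mul hr) rAE diag_state_pi.
- by move=> a; rewrite /phi (star_hom_mul hr) (star_hom_star hr); exact: diag_state_ge0.
- move=> a; apply: le_trans (star_hom_contractive hr cp_unit a).
  exact: diag_state_le.
- by rewrite /phi rAE; exact: diag_state1.
Qed.

End KMS.

(** * The example graph *)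

Section PreimageCount.
Variable Z : lhSystem.
Local Notation h := (@lh_map Z).

Lemma preim_finite n (z : Z) : finite_set (iter n h @^-1` [set z]).
Proof.
elim: n z => [|n IH] z; first by apply: (sub_finite_set _ (finite_set1 z)).
have -> : iter n.+1 h @^-1` [set z] =
    \bigcup_(w in h @^-1` [set z]) (iter n h @^-1` [set w]).
  apply/seteqP; split=> [x /= hx|x [w /= <- <-] //].
  by exists (iter n h x).
by apply: bigcup_finite => //; exact: lh_fibre_finite.
Qed.

Lemma mem_preim n (z x : Z) :
  (x \in fset_set (iter n h @^-1` [set z])) = (iter n h x == z).
Proof.
rewrite in_fset_set; last exact: preim_finite.
by apply/idP/eqP => [/set_mem|hw]; [|rewrite inE].
Qed.

Lemma preim_card0 (z : Z) : preim_card h 0 z = 1%N.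
Proof.
rewrite /preim_card (_ : fset_set _ = [fset z]%fset) ?cardfs1//.
by apply/fsetP => x; rewrite mem_preim inE.
Qed.

(** Each point of the larger preimage is counted once, at its image under the first [n] steps, which
    lies in the fibre of [z]. *)
Lemma preim_cardS n (z : Z) :
  preim_card h n.+1 z = (\sum_(w <- fibre z) preim_card h n w)%N.
Proof.
rewrite /preim_card; set X := fset_set _.
transitivity (\sum_(x <- X) \sum_(w <- fibre z) (iter n h x == w))%N.
  rewrite -[LHS]/(size X) -sum1_size; apply: eq_big_seq => x; rewrite mem_preim iterS => hx.
  rewrite (big_fsetD1 (iter n h x)) ?mem_fibre//= eqxx big1_seq// => w.
  by rewrite !inE => /andP[_ /andP[/negbTE]]; rewrite eq_sym => ->.
rewrite exchange_big; apply: eq_big_seq => w; rewrite mem_fibre => /eqP hw.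
have -> : (\sum_(x <- X) (iter n h x == w) = \sum_(x <- X | iter n h x == w) 1)%N.
  by rewrite [RHS]big_mkcond; apply: eq_bigr => x _; case: (_ == _).
rewrite -big_filter sum1_size; apply: perm_size; apply: uniq_perm.
- exact: filter_uniq (fset_uniq X).
- exact: fset_uniq.
- move=> x; rewrite mem_filter !mem_preim iterS.
  by case: eqVneq => [->|//]; rewrite hw eqxx.
Qed.

(** One count serves twice: for the growth rates and for the mass bounds needed at the base
    points. *)
Lemma preim_card_transfer (R : realType) n (z : Z) :
  iter n (@transfer R Z) (fun=> 1) z = (preim_card h n z)%:R.
Proof.
elim: n z => [|n IH] z; first by rewrite preim_card0.
by rewrite iterS preim_cardS natr_sum; apply: eq_bigr => w _; exact: IH.
Qed.

End PreimageCount.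

(** * Fibres of the shift and the frame of edge indicators *)

Section PathFibres.
Variables (E : digraph) (Esrc : forall v, exists e : edge E, src e = v).
Local Notation Z := (path_system Esrc).

Definition first_edge (z : path_space E) : edge E := set_val z 0.

Lemma perm_fibre (z : Z) : perm_eq (fibre z)
  [seq (path_cons e z : Z) | e <- enum [pred e : edge E | src e == rng (first_edge z)]].
Proof.
apply: uniq_perm; first exact: fset_uniq.
  rewrite map_inj_in_uniq ?enum_uniq// => e e'; rewrite !mem_enum !inE.
  move=> /eqP he /eqP he' /(congr1 first_edge).
  by rewrite /first_edge !path_consE.
move=> w; rewrite mem_fibre; apply/eqP/mapP => [hw|[e]].
  exists (first_edge w); last by rewrite -hw; exact/esym/cons_shift.
  by rewrite mem_enum inE -hw; apply/eqP; exact: (path_valP w 0).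
by rewrite mem_enum inE => /eqP he ->; exact: shift_cons.
Qed.

Lemma card_fibre_le (z : Z) : (#|` fibre z| <= #|edge E|)%N.
Proof.
rewrite -[X in (X <= _)%N]/(size (fibre z)) (perm_size (perm_fibre z)) size_map -cardE.
exact: max_card.
Qed.

Lemma sum_fibre (g : edge E -> nat) (z : Z) :
  (\sum_(w <- fibre z) g (first_edge w) =
   \sum_(e : edge E | src e == rng (first_edge z)) g e)%N.
Proof.
rewrite (perm_big _ (perm_fibre z)) big_map big_enum /=.
by apply: eq_bigr => e /eqP he; rewrite /first_edge path_consE.
Qed.

Variable R : realType.
Local Notation C := (Cplx R).

Lemma edge_indicator_continuous (e : edge E) :
  continuous (fun w : Z => (first_edge w == e)%:R : C).
Proof.
move=> w; apply/(@cvgrPdist_lt _ _ _ _ (nbhs_filter w)) => d d0.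
have := near_coord (w : path_space E) 0.
apply: (@filterS _ _ (nbhs_filter (w : path_space E))) => v vw.
by rewrite /first_edge vw subrr normr0.
Qed.

Definition edge_indicator (e : edge E) : cfun R Z :=
  mkcts (@edge_indicator_continuous e).

(** Two paths with the same shift and the same first edge are equal, so the set of paths beginning
    with a given edge meets each fibre at most once. *)
Lemma edge_frame (w v : Z) : lh_map w = lh_map v ->
  \sum_e edge_indicator e w * (edge_indicator e v)^* = (w == v)%:R.
Proof.
move=> wv; rewrite (bigD1 (first_edge w))//= big1 => [|e ew]; last first.
  by rewrite [edge_indicator e w]/(_%:R) eq_sym (negbTE ew) mul0r.
rewrite addr0 [edge_indicator _ w]/(_%:R) eqxx mul1r.
rewrite [edge_indicator _ v]/(_%:R) conjC_nat; congr (_ %:R); congr nat_of_bool.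
apply/eqP/eqP => [e|->//].
rewrite -(cons_shift w) -(cons_shift v) -[set_val w 0]/(first_edge w) -e.
by congr path_cons.
Qed.

End PathFibres.

(** * Preimage counts and growth rates of the example *)

Section Example.
Local Notation Z := ex_system.
Local Notation h := (@lh_map Z).

(** A path with range v extends backwards by the two loops at v only. One with range w extends by
    three loops at w and by the edge into v, so c_w(n+1) = 3 c_w(n) + 2^n with c_w(0) = 1. *)
Definition ex_count (n : nat) (u : ex_vertex) : nat :=
  if u is vtx_v then 2 ^ n else (2 * 3 ^ n - 2 ^ n)%N.

Definition path_range (z : Z) : ex_vertex :=
  ex_rng (first_edge (z : path_space ex_graph)).

Lemma leq_exp23 n : (2 ^ n <= 3 ^ n)%N.
Proof. by case: n => // n; rewrite leq_exp2r. Qed.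

Lemma ex_preim_card n (z : Z) : preim_card h n z = ex_count n (path_range z).
Proof.
elim: n z => [|n IH] z; first by rewrite preim_card0; case: (path_range z).
rewrite preim_cardS (eq_bigr (fun w => ex_count n (path_range w))).
  rewrite (sum_fibre (Esrc := ex_graph_src) (fun e => ex_count n (ex_rng e))).
  rewrite -[rng _]/(path_range z).
  rewrite big_mkcond !big_sumType /= !big_ord_recl !big_ord0 /=.
  rewrite (bigD1 tt)//= big1 => [|[]//].
  have pow3 := leq_exp23 n.
  case: (path_range z); rewrite /ex_count /= !expnS; lia.
by move=> w _; exact: IH.
Qed.

Lemma ex_count_le n u : (2 ^ n <= ex_count n u <= 2 * 3 ^ n - 2 ^ n)%N.
Proof.
have pow3 := leq_exp23 n.
by case: u => /=; lia.
Qed.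

Lemma vpath_is_path : is_path (fun _ => inl (inl ord0) : edge ex_graph).
Proof. by []. Qed.
Lemma wpath_is_path : is_path (fun _ => inl (inr ord0) : edge ex_graph).
Proof. by []. Qed.

Definition vpath : Z := SigSub (mem_set vpath_is_path).
Definition wpath : Z := SigSub (mem_set wpath_is_path).

Lemma nat_max_eq (A : set nat) m : A m -> (forall k, A k -> (k <= m)%N) -> nat_max A = m.
Proof.
move=> Am mA; apply: xget_subset1 => [|i j [Ai iA] [Aj jA]].
  by split=> // k /mA; rewrite leEnat.
by apply/eqP; rewrite eqn_leq; have := iA _ Aj; have := jA _ Ai; rewrite !leEnat => -> ->.
Qed.

Lemma nat_min_eq (A : set nat) m : A m -> (forall k, A k -> (m <= k)%N) -> nat_min A = m.
Proof.
move=> Am mA; apply: xget_subset1 => [|i j [Ai iA] [Aj jA]].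
  by split=> // k /mA; rewrite leEnat.
by apply/eqP; rewrite eqn_leq; have := iA _ Aj; have := jA _ Ai; rewrite !leEnat => -> ->.
Qed.

Lemma ex_max n : nat_max (range (preim_card h n)) = (2 * 3 ^ n - 2 ^ n)%N.
Proof.
apply: nat_max_eq; first by exists wpath; rewrite ?ex_preim_card.
by move=> _ [z _ <-]; rewrite ex_preim_card; case/andP: (ex_count_le n (path_range z)).
Qed.

Lemma ex_min n : nat_min (range (preim_card h n)) = (2 ^ n)%N.
Proof.
apply: nat_min_eq; first by exists vpath; rewrite ?ex_preim_card.
by move=> _ [z _ <-]; rewrite ex_preim_card; case/andP: (ex_count_le n (path_range z)).
Qed.

Variable R : realType.

Lemma limn_esup_EFin (u : nat -> R) (l : R) : u @ \oo --> l ->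
  limn_esup (fun n => (u n)%:E) = l%:E.
Proof.
move=> ul; have cu : (fun n => (u n)%:E) @ \oo --> l%:E.
  by apply: cvg_EFin => //; apply: nearW.
by have [_ ->] := cvg_limn_einf_sup cu.
Qed.

Lemma ex_beta_l : beta_l R h = (ln 2)%:E.
Proof.
rewrite /beta_l; apply: limn_esup_EFin.
apply: (@cvg_trans _ ((cst (ln 2 : R)) @ \oo)); last exact: cvg_cst.
(* The sequence is constant from n = 1 on; at n = 0 the inverse of 0 is 0 by convention. *)
apply: near_eq_cvg; exists 1%N => // n /= n1.
rewrite ex_min natrX lnXn ?ltr0n// -[ln 2 *+ n]mulr_natl mulKf//.
by rewrite pnatr_eq0 -lt0n.
Qed.

(** Since 3^n <= 2 * 3^n - 2^n <= 2 * 3^n, the terms lie between ln 3 and ln 3 + (ln 2) / n. *)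
Lemma ex_beta_c : beta_c R h = (ln 3)%:E.
Proof.
rewrite /beta_c; apply: limn_esup_EFin.
(* [harmonic n] is 1 / (n + 1), hence the index n - 1. *)
have hn : (fun n => harmonic (n - 1)%N : R) @ \oo --> (0 : R).
  exact: (cvg_comp (fun n => n - 1)%N _ (cvg_subnr 1) (@cvg_harmonic R)).
have up : (fun n => ln 2 * harmonic (n - 1)%N + ln 3 : R) @ \oo -->
    (ln 2 * 0 + ln 3 : R).
  exact: (cvgD (cvgM (cvg_cst (ln 2)) hn) (cvg_cst (ln 3))).
rewrite mulr0 add0r in up.
apply: (squeeze_cvgr (f := fun=> ln 3 : R) _ (cvg_cst _) up).
exists 1%N => // n /= n1; rewrite ex_max.
have n0 : 0 < n%:R :> R by rewrite ltr0n.
have pow3 := leq_exp23 n.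
have p3 : (0 < 3 ^ n)%N by rewrite expn_gt0.
apply/andP; split.
  rewrite ler_pdivlMl// mulr_natl -lnXn ?ltr0n// -natrX ler_ln ?posrE ?ltr0n ?ler_nat; lia.
rewrite ler_pdivrMl// mulrDr /harmonic /= subn1 prednK// mulrCA mulfV ?gt_eqF// mulr1.
rewrite [n%:R * ln 3]mulr_natl -lnXn ?ltr0n// -natrX -lnM ?posrE ?ltr0n//.
by rewrite -natrM ler_ln ?posrE ?ltr0n ?ler_nat; lia.
Qed.

End Example.

Theorem mainTheorem1 (R : realType)
    (T : cstarAlg R) (iX : cfun R ex_system -> T) (iA : cfun R ex_system -> T)
    (hT : toeplitz_algebra iX iA)
    (gamma : Cplx R -> T -> T) (hgamma : gauge_action iX iA gamma)
    (O : cstarAlg R) (q : T -> O) (hO : cuntz_pimsner_algebra iX iA q)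
    (alpha : R -> O -> O) (halpha : gauge_dynamics gamma q alpha) :
  [/\ beta_c R (@lh_map ex_system) = (ln 3)%:E,
      beta_l R (@lh_map ex_system) = (ln 2)%:E,
      exists phi : O -> Cplx R, kms_state alpha (ln 3) phi &
      exists phi : O -> Cplx R, kms_state alpha (ln 2) phi].
Proof.
have card z := @card_fibre_le ex_graph ex_graph_src z.
have frame := @edge_frame ex_graph ex_graph_src R.
split; [exact: ex_beta_c|exact: ex_beta_l| |].
(* The mass at [wpath] is 2 * 3^k - 2^k, between 3^k and 2 * 3^k, so [M] is 2; at [vpath] it is
   exactly 2^k, so [M] is 1. *)
- apply: (kms_exists card frame (N := 3) (z0 := wpath) (M := 2) _ _ hT hgamma hO halpha) => // k.
  rewrite preim_card_transfer ex_preim_card -nat_cplx !cplx_of_le.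
  rewrite -natrX -natrM !ler_nat /=; have := leq_exp23 k; lia.
- apply: (kms_exists card frame (N := 2) (z0 := vpath) (M := 1) _ _ hT hgamma hO halpha) => // k.
  by rewrite preim_card_transfer ex_preim_card -nat_cplx !cplx_of_le mul1r -natrX lexx.
Qed.
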